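(* Let $S$ be any ring and $V$ an $S,S$-bimodule, let $I=\bigoplus_{n\ge2}R_n$ (with $R_n\subseteq V^{\otimes n}$) be a homogeneous two-sided ideal of $T^+_S(V)=\bigoplus_{n\ge1}V^{\otimes n}$ contained in $\bigoplus_{n\ge2}V^{\otimes n}$, and let $A=T^+_S(V)/I$. Let $B^\infty_\bullet(V,I)$ be the $A_\infty$-coalgebra over $S$ defined in the context. Then $$\operatorname{Cobar} B^\infty_\bullet(V,I)\simeq A,$$ i.e. the dg algebra $\operatorname{Cobar} B^\infty_\bullet(V,I)$ is quasi-isomorphic to the algebra $A$ (concentrated in degree $0$), via the dg algebra morphism that is the quotient map $T^+_S(V)\to A$ in degree $0$ and zero in positive degrees.
   Context: All tensor products are over $S$; $V^n=V^{\otimes n}$. Algebras are non-unital $S$-algebras ($S,S$-bimodules with associative multiplication $A\otimes_S A\to A$). For a graded bimodule $K_\bullet$, $K_\bullet[1]$ is the shift $K[1]_n=K_{n+1}$. $A_\infty$-coalgebras. An $A_\infty$-coalgebra over $S$ is a graded $S,S$-bimodule $K_\bullet$ with $S,S$-morphisms $\Delta_k\colon K_\bullet\to K_\bullet^{\otimes k}$, $k\ge1$, of degree $k-2$, with $\sum_{r+s+t=n}(-1)^{r+st}(1^{\otimes r}\otimes\Delta_s\otimes1^{\otimes t})\circ\Delta_{r+1+t}=0$ for all $n\ge1$, and locally finite: for each $x$, $\Delta_n(x)\ne0$ for only finitely many $n$. Its cobar construction is the dg algebra $\operatorname{Cobar}K_\bullet=(T^+_S(K_\bullet[1]),d)$,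 where $d$ is determined by the Leibniz rule $d(v\cdot w)=dv\cdot w+(-1)^{\deg v}v\cdot dw$ and by having components $-[1]^{\otimes n}\circ\Delta_n\circ[-1]\colon K_\bullet[1]\to K_\bullet[1]^{\otimes n}$. Here $[1]^{\otimes n}$ is evaluated with the Koszul sign rule, e.g. $[1]\otimes[1]=(-1)^m$ on $K_m\otimes K_n$. Bracketings. Let $\mathcal{B}^{[2]}$ be the set of closed non-degenerate bracketings (equivalently, planar rooted trees in which every internal vertex has at least two branches): $\bullet\in\mathcal{B}^{[2]}$ (one input, no brackets), and $[\beta_1\cdots\beta_k]\in\mathcal{B}^{[2]}$ whenever $k\ge2$ and $\beta_1,\dots,\beta_k\in\mathcal{B}^{[2]}$. An innermost bracket is a pair enclosing only inputs, i.e. $[\bullet^n]$, $n\ge2$. An internal bracket of $\beta$ is any bracket pair other than the outer one. Definition of $B^\infty_\bullet(V,I)$. For $\beta\in\mathcal{B}^{[2]}$ let $(V,I)^\beta$ be the tensor product over $S$, from left to right, of one copy of $R_n$ for each innermost bracket $[\bullet^n]$ of $\beta$ and one copy of $V$ for each input not in an innermost bracket. It is in homological degree $d$ if $\beta$ has $d-1$ bracket pairs. Set $B^\infty_\bullet(V,I)=\bigoplus_{\beta\in\mathcal{B}^{[2]}}(V,I)^\beta$; so $B^\infty_1(V,I)=V$ and $B^\infty_2(V,I)=I$. The structure maps are as follows. (1) $\Delta_1$ has, for each $m$, the component $(-1)^{m-1}\tau$ from $(V,I)^\beta$ to $(V,I)^{\beta(\widehat m)}$, where $\beta(\widehat m)$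 is obtained from $\beta$ by removing the $m$th internal left bracket (counted from the left) together with its matching right bracket. If the removed pair is not innermost, $\tau$ is the tautological identity. If it is an innermost $[\bullet^n]$ lying inside matching brackets whose whole content is $\bullet^a[\bullet^n]\bullet^b$, then $\tau$ is induced by the multiplication $V^a\otimes R_n\otimes V^b\to R_{n+a+b}$. If it is any other innermost $[\bullet^n]$, $\tau$ is induced by the inclusion $R_n\subseteq V^n$. (2) On $(V,I)^{[\beta_1\cdots\beta_k]}$, $k\ge2$, the only non-zero higher coproduct is $\Delta_k$, which maps to $(V,I)^{\beta_1}\otimes\cdots\otimes(V,I)^{\beta_k}$ and is $-(-1)^{\sum_{i=1}^k(k-i)d_i}$ times the tautological map, where $d_i$ is the homological degree of $(V,I)^{\beta_i}$; when $\beta_1=\dots=\beta_k=\bullet$ the ''tautological map'' is the inclusion $R_k\subseteq V^k$. (3) All coproducts vanish on $V=(V,I)^\bullet$. *)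

(* Defs.v *)
From HB Require Import structures.
From mathcomp Require Import all_boot all_order all_algebra.
From mathcomp Require Import generic_quotient ring_quotient.
From mathcomp Require Import boolp classical_sets.
From mathcomp Require Import freeg.

Set Implicit Arguments.
Unset Strict Implicit.
Unset Printing Implicit Defensive.

Import GRing.Theory.
Local Open Scope ring_scope.
Local Open Scope quotient_scope.

Reserved Notation "v *:r a" (at level 40, left associativity).

(* MathComp has left modules only: a bimodule is a left module with a commuting
   right action. *)
HB.mixin Record Lmodule_hasRightScale (S : pzRingType) V of GRing.Lmodule S V := {
  rscale : V -> S -> V;
  rscaleA : forall v a b, rscale (rscale v a) b = rscale v (a * b);
  rscaler1 : forall v, rscale v 1 = v;
  rscalerDl : forall u v a, rscale (u + v) a = rscale u a + rscale v a;
  rscalerDr : forall v a b, rscale v (a + b) = rscale v a + rscale v b;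
  rscaleAl : forall (a b : S) (v : V), rscale (a *: v) b = a *: rscale v b
}.

#[short(type="bimodType")]
HB.structure Definition Bimodule (S : pzRingType) :=
  {V of Lmodule_hasRightScale S V & GRing.Lmodule S V}.

Notation "v *:r a" := (rscale v a) : ring_scope.

HB.instance Definition _ (S : pzRingType) :=
  Lmodule_hasRightScale.Build S S^o
    (fun v a b => esym (mulrA v a b)) (@mulr1 S) (@mulrDl S) (@mulrDr S)
    (fun a b v => esym (mulrA a v b)).

Definition regular (S : pzRingType) : bimodType S := Bimodule.clone S S^o _.

Record bimodHom (S : pzRingType) (M N : bimodType S) := BimodHom {
  bhom_fun :> M -> N;
  bhomD : {morph bhom_fun : x y / x + y};
  bhomZ : forall a, {morph bhom_fun : x / a *: x};
  bhomZr : forall a, {morph bhom_fun : x / x *:r a}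
}.

Section HomTheory.
Variables (S : pzRingType).
Implicit Types M N P : bimodType S.

Lemma bhom_is_linear M N (f : bimodHom M N) : linear f.
Proof. by move=> a u v; rewrite bhomD bhomZ. Qed.
HB.instance Definition _ M N (f : bimodHom M N) :=
  GRing.isLinear.Build S M N *:%R f (bhom_is_linear f).

Lemma bhom_ext M N (f g : bimodHom M N) : f =1 g -> f = g.
Proof.
case: f g => [f fD fZ fR] [g gD gZ gR] /= /funext fg.
by subst g; f_equal; apply: Prop_irrelevance.
Qed.

Lemma rscaler0 M (v : M) : v *:r 0 = 0.
Proof. by apply: (addIr (v *:r 0)); rewrite -rscalerDr addr0 add0r. Qed.
Lemma rscale0r M (a : S) : (0 : M) *:r a = 0.
Proof. by apply: (addIr ((0 : M) *:r a)); rewrite -rscalerDl addr0 add0r. Qed.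
Lemma rscaleNr M (v : M) (a : S) : (- v) *:r a = - (v *:r a).
Proof. by apply: (addIr (v *:r a)); rewrite -rscalerDl !addNr rscale0r. Qed.
Lemma rscaler_sum M I (r : seq I) (F : I -> M) (a : S) :
  (\sum_(i <- r) F i) *:r a = \sum_(i <- r) F i *:r a.
Proof.
elim: r => [|i r IH]; first by rewrite !big_nil rscale0r.
by rewrite !big_cons rscalerDl IH.
Qed.

Definition hid M : bimodHom M M :=
  @BimodHom S M M id (fun _ _ => erefl) (fun _ _ => erefl) (fun _ _ => erefl).

Lemma hcomp_subproof M N P (g : bimodHom N P) (f : bimodHom M N) :
  [/\ {morph g \o f : x y / x + y}, forall a, {morph g \o f : x / a *: x}
    & forall a, {morph g \o f : x / x *:r a}].
Proof. by split=> [x y|a x|a x] /=; rewrite ?bhomD ?bhomZ ?bhomZr. Qed.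
Definition hcomp M N P (g : bimodHom N P) (f : bimodHom M N) : bimodHom M P :=
  let: And3 pD pZ pR := hcomp_subproof g f in BimodHom pD pZ pR.

Lemma hcompE M N P (g : bimodHom N P) (f : bimodHom M N) x :
  hcomp g f x = g (f x).
Proof. by rewrite /hcomp; case: hcomp_subproof. Qed.

Lemma hzero_subproof M N :
  [/\ {morph (fun _ : M => 0 : N) : x y / x + y},
      forall a, {morph (fun _ : M => 0 : N) : x / a *: x}
    & forall a, {morph (fun _ : M => 0 : N) : x / x *:r a}].
Proof. by split=> [x y|a x|a x] /=; rewrite ?addr0 ?scaler0 ?rscale0r. Qed.
Definition hzero M N : bimodHom M N :=
  let: And3 pD pZ pR := hzero_subproof M N in BimodHom pD pZ pR.

Lemma hadd_subproof M N (f g : bimodHom M N) :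
  [/\ {morph f \+ g : x y / x + y}, forall a, {morph f \+ g : x / a *: x}
    & forall a, {morph f \+ g : x / x *:r a}].
Proof.
split=> [x y|a x|a x] /=; rewrite ?bhomD ?bhomZ ?bhomZr ?scalerDr ?rscalerDl //.
by rewrite addrACA.
Qed.
Definition hadd M N (f g : bimodHom M N) : bimodHom M N :=
  let: And3 pD pZ pR := hadd_subproof f g in BimodHom pD pZ pR.

Lemma hopp_subproof M N (f : bimodHom M N) :
  [/\ {morph \- f : x y / x + y}, forall a, {morph \- f : x / a *: x}
    & forall a, {morph \- f : x / x *:r a}].
Proof.
by split=> [x y|a x|a x] /=; rewrite ?bhomD ?bhomZ ?bhomZr ?opprD ?scalerN ?rscaleNr.
Qed.
Definition hopp M N (f : bimodHom M N) : bimodHom M N :=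
  let: And3 pD pZ pR := hopp_subproof f in BimodHom pD pZ pR.

HB.instance Definition _ M N := gen_eqMixin (bimodHom M N).
HB.instance Definition _ M N := gen_choiceMixin (bimodHom M N).

Lemma hzero_fun M N x : hzero M N x = 0. Proof. by rewrite /hzero; case: hzero_subproof. Qed.
Lemma hadd_fun M N (f g : bimodHom M N) x : hadd f g x = f x + g x.
Proof. by rewrite /hadd; case: hadd_subproof. Qed.
Lemma hopp_fun M N (f : bimodHom M N) x : hopp f x = - f x.
Proof. by rewrite /hopp; case: hopp_subproof. Qed.

Lemma haddA M N : associative (@hadd M N).
Proof. by move=> f g h; apply: bhom_ext => x; rewrite !hadd_fun addrA. Qed.
Lemma haddC M N : commutative (@hadd M N).
Proof. by move=> f g; apply: bhom_ext => x; rewrite !hadd_fun addrC. Qed.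
Lemma hadd0 M N : left_id (hzero M N) (@hadd M N).
Proof. by move=> f; apply: bhom_ext => x; rewrite !hadd_fun hzero_fun add0r. Qed.
Lemma haddN M N : left_inverse (hzero M N) (@hopp M N) (@hadd M N).
Proof. by move=> f; apply: bhom_ext => x; rewrite !hadd_fun hopp_fun hzero_fun addNr. Qed.
HB.instance Definition _ M N :=
  GRing.isZmodule.Build (bimodHom M N) (@haddA M N) (@haddC M N) (@hadd0 M N) (@haddN M N).

Lemma hzeroE M N x : (0 : bimodHom M N) x = 0. Proof. exact: hzero_fun. Qed.
Lemma haddE M N (f g : bimodHom M N) x : (f + g) x = f x + g x. Proof. exact: hadd_fun. Qed.
Lemma hoppE M N (f : bimodHom M N) x : (- f) x = - f x. Proof. exact: hopp_fun. Qed.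
Lemma hsumE M N I (r : seq I) (P : pred I) (F : I -> bimodHom M N) x :
  (\sum_(i <- r | P i) F i) x = \sum_(i <- r | P i) F i x.
Proof.
elim: r => [|i r IH]; first by rewrite !big_nil hzeroE.
by rewrite !big_cons; case: ifP => _ //; rewrite haddE IH.
Qed.

End HomTheory.

(* ---------------- tensor_of product ---------------- *)
Section Tensor.
Variables (S : pzRingType) (M N : bimodType S).

Local Notation free := {freeg (M * N)%type / int}.
Local Notation gen x y := (<< (x, y) >> : free).

(* The tensor product over S is the free abelian group on M * N modulo the subgroup
   generated by biadditivity and balancedness. *)
Inductive tensor_rel : free -> Prop :=
| tensor_rel_Dl x x' y : tensor_rel (gen (x + x') y - gen x y - gen x' y)
| tensor_rel_Dr x y y' : tensor_rel (gen x (y + y') - gen x y - gen x y')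
| tensor_rel_bal x a y : tensor_rel (gen (x *:r a) y - gen x (a *: y))
| tensor_rel_0 : tensor_rel 0
| tensor_rel_B u v : tensor_rel u -> tensor_rel v -> tensor_rel (u - v).

Definition tensor_relb : {pred free} := fun u => `[< tensor_rel u >].

Lemma tensor_relb_closed : zmod_closed tensor_relb.
Proof.
split; first exact/asboolP/tensor_rel_0.
by move=> u v /asboolP hu /asboolP hv; apply/asboolP/tensor_rel_B.
Qed.
HB.instance Definition _ := GRing.isZmodClosed.Build free tensor_relb tensor_relb_closed.
Definition tensor_relZ : zmodClosed free := tensor_relb.


Definition tensor_of : Type := Quotient.quot tensor_relZ.
HB.instance Definition _ := GRing.Zmodule.on tensor_of.

Definition tpure (x : M) (y : N) : tensor_of := \pi_(Quotient.quot tensor_relZ) (gen x y).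


Let Q := Quotient.quot tensor_relZ.
Local Lemma piB (u v : free) : \pi_Q (u - v) = \pi_Q u - \pi_Q v :> Q.
Proof. by rewrite !piE. Qed.
Local Lemma pi0 : \pi_Q (0 : free) = 0 :> Q.
Proof. by apply/esym; rewrite !piE. Qed.
Local Lemma piD (u v : free) : \pi_Q (u + v) = \pi_Q u + \pi_Q v :> Q.
Proof. by rewrite !piE. Qed.
Local Lemma piN (u : free) : \pi_Q (- u) = - \pi_Q u :> Q.
Proof. by rewrite !piE. Qed.
Local Lemma pi_rel (u : free) : tensor_rel u -> \pi_Q u = 0 :> Q.
Proof.
move=> hu; have -> : (0 : Q) = \pi_Q (0 : free) by rewrite !piE.
by apply/eqP; rewrite -(Quotient.idealrBE tensor_relZ) subr0; apply/asboolP.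
Qed.

Lemma tpureDl x x' y : tpure (x + x') y = tpure x y + tpure x' y.
Proof.
apply/eqP; rewrite -subr_eq0 opprD addrA -!piB.
by rewrite (pi_rel (tensor_rel_Dl x x' y)).
Qed.
Lemma tpureDr x y y' : tpure x (y + y') = tpure x y + tpure x y'.
Proof.
apply/eqP; rewrite -subr_eq0 opprD addrA -!piB.
by rewrite (pi_rel (tensor_rel_Dr x y y')).
Qed.
Lemma tpure_bal x a y : tpure (x *:r a) y = tpure x (a *: y).
Proof.
by apply/eqP; rewrite -subr_eq0 -piB (pi_rel (tensor_rel_bal x a y)).
Qed.
Lemma tpure0l y : tpure 0 y = 0.
Proof. by apply: (addIr (tpure 0 y)); rewrite -tpureDl addr0 add0r. Qed.
Lemma tpure0r x : tpure x 0 = 0.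
Proof. by apply: (addIr (tpure x 0)); rewrite -tpureDr addr0 add0r. Qed.
Lemma tpureNl x y : tpure (- x) y = - tpure x y.
Proof. by apply: (addIr (tpure x y)); rewrite -tpureDl !addNr tpure0l. Qed.
Lemma tpureNr x y : tpure x (- y) = - tpure x y.
Proof. by apply: (addIr (tpure x y)); rewrite -tpureDr !addNr tpure0r. Qed.

Lemma tensor_ofP (t : tensor_of) :
  exists s : seq (M * N), t = \sum_(p <- s) tpure p.1 p.2.
Proof.
rewrite -[t](@reprK _ Q); set u := repr t; rewrite -(freeg_sumE u).
elim: (dom u) => [|z r [s hs]].
  by exists [::]; rewrite !big_nil; exact: pi0.
rewrite big_cons.
have hz : exists s' : seq (M * N), \pi_Q << coeff z u *g z >> = \sum_(p <- s') tpure p.1 p.2.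
  case: (coeff z u) => n; case: z => x y.
    exists (nseq n (x, y)); elim: n => [|n IHn].
      by rewrite freegU0 big_nil; exact: pi0.
    by rewrite intS -freegUD big_cons -IHn /= piD.
  exists (nseq n.+1 (- x, y)); elim: n => [|n IHn].
    by rewrite /= big_cons big_nil addr0 tpureNl NegzE -freegUN piN.
  rewrite NegzE intS opprD -NegzE -freegUD big_cons -IHn /= tpureNl -freegUN.
  by rewrite piD piN; congr (_ - _); rewrite -piN freegUN.
have [s' hs'] := hz; exists (s' ++ s); rewrite big_cat /= -hs' -hs.
by rewrite piD.
Qed.

Section Lift.
Variables (G : zmodType) (f : M -> N -> G).
Hypothesis fDl : forall x x' y, f (x + x') y = f x y + f x' y.
Hypothesis fDr : forall x y y', f x (y + y') = f x y + f x y'.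
Hypothesis fbal : forall x a y, f (x *:r a) y = f x (a *: y).

Let pre (u : free) : G := fglift (fun p => f p.1 p.2 : zmodule G) u.
Local Lemma preB u v : pre (u - v) = pre u - pre v.
Proof. exact: (lift_is_additive (fun p => f p.1 p.2 : zmodule G)). Qed.
Local Lemma pre0 : pre 0 = 0.
Proof. by have := preB 0 0; rewrite !subrr. Qed.
Local Lemma preN u : pre (- u) = - pre u.
Proof. by rewrite -[- u]sub0r preB pre0 sub0r. Qed.
Local Lemma preD u v : pre (u + v) = pre u + pre v.
Proof. by rewrite -[v in LHS]opprK preB preN opprK. Qed.
Local Lemma pre_gen x y : pre (gen x y) = f x y.
Proof. by rewrite /pre liftU scale1r. Qed.

Local Lemma prelift_rel (u : free) : tensor_rel u -> pre u = 0.
Proof.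
elim=> [x x' y|x y y'|x a y||v w _ hv _ hw]; rewrite ?preB ?pre_gen.
- by rewrite fDl addrAC addrK subrr.
- by rewrite fDr addrAC addrK subrr.
- by rewrite fbal subrr.
- exact: pre0.
- by rewrite hv hw subrr.
Qed.

Definition tlift_of (t : tensor_of) : G :=
  fglift (fun p => f p.1 p.2 : zmodule G) (repr (t : Q)).

Local Lemma tlift_of_pi u : tlift_of (\pi_Q u) = pre u.
Proof.
apply/eqP; rewrite -subr_eq0 -[tlift_of _]/(pre _) -preB; apply/eqP/prelift_rel/asboolP.
by rewrite -/(tensor_relb _) -[tensor_relb _]/(_ \in tensor_relZ) Quotient.idealrBE reprK.
Qed.

Lemma tlift_ofE x y : tlift_of (tpure x y) = f x y.
Proof. by rewrite tlift_of_pi pre_gen. Qed.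

Lemma tlift_ofD : {morph tlift_of : t u / t + u}.
Proof.
move=> t u; rewrite -[t](@reprK _ Q) -[u](@reprK _ Q) -[_ + _ in LHS]piD.
by rewrite !tlift_of_pi preD.
Qed.
End Lift.
End Tensor.

Section TensorBimod.
Variables (S : pzRingType) (M N : bimodType S).
Local Notation T := (tensor_of M N).

Lemma tensor_of_ext (G : zmodType) (f g : T -> G) :
  {morph f : t u / t + u} -> {morph g : t u / t + u} ->
  (forall x y, f (tpure x y) = g (tpure x y)) -> f =1 g.
Proof.
move=> fD gD fg t; have [s ->] := tensor_ofP t.
have f0 : f 0 = 0 by apply: (addIr (f 0)); rewrite -fD !add0r.
have g0 : g 0 = 0 by apply: (addIr (g 0)); rewrite -gD !add0r.
elim: s => [|p s IH]; first by rewrite big_nil f0 g0.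
by rewrite big_cons fD gD IH fg.
Qed.

Definition tensor_scale (a : S) : T -> T :=
  tlift_of (fun x y => tpure (a *: x) y).
Definition tensor_rscale (t : T) (a : S) : T :=
  tlift_of (fun x y => tpure x (y *:r a)) t.

Local Lemma scale_ok (a : S) :
  [/\ forall (x x' : M) (y : N), tpure (a *: (x + x')) y = tpure (a *: x) y + tpure (a *: x') y,
      forall (x : M) (y y' : N), tpure (a *: x) (y + y') = tpure (a *: x) y + tpure (a *: x) y'
    & forall (x : M) b (y : N), tpure (a *: (x *:r b)) y = tpure (a *: x) (b *: y)].
Proof.
split=> [x x' y|x y y'|x b y]; rewrite ?scalerDr ?tpureDl ?tpureDr //.
by rewrite -rscaleAl tpure_bal.
Qed.
Local Lemma rscale_ok (a : S) :
  [/\ forall (x x' : M) (y : N), tpure (x + x') (y *:r a) = tpure x (y *:r a) + tpure x' (y *:r a),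
      forall (x : M) (y y' : N), tpure x ((y + y') *:r a) = tpure x (y *:r a) + tpure x (y' *:r a)
    & forall (x : M) b (y : N), tpure (x *:r b) (y *:r a) = tpure x ((b *: y) *:r a)].
Proof.
split=> [x x' y|x y y'|x b y]; rewrite ?rscalerDl ?tpureDl ?tpureDr //.
by rewrite tpure_bal rscaleAl.
Qed.

Lemma tensor_scaleE a x y : tensor_scale a (tpure x y) = tpure (a *: x) y.
Proof. by have [Dl Dr bal] := scale_ok a; rewrite /tensor_scale tlift_ofE. Qed.
Lemma tensor_rscaleE a x y : tensor_rscale (tpure x y) a = tpure x (y *:r a).
Proof. by have [Dl Dr bal] := rscale_ok a; rewrite /tensor_rscale tlift_ofE. Qed.
Lemma tensor_scaleD a : {morph tensor_scale a : t u / t + u}.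
Proof. by have [Dl Dr bal] := scale_ok a; apply: tlift_ofD. Qed.
Lemma tensor_rscaleD a : {morph tensor_rscale^~ a : t u / t + u}.
Proof. by have [Dl Dr bal] := rscale_ok a; apply: tlift_ofD. Qed.

Lemma tensor_scaleA a b t : tensor_scale a (tensor_scale b t) = tensor_scale (a * b) t.
Proof.
apply: (@tensor_of_ext _ (fun t => tensor_scale a (tensor_scale b t)) (tensor_scale (a * b))) => /= [u v|u v|x y];
  by rewrite ?(tensor_scaleD, tensor_scaleE) ?scalerA.
Qed.
Lemma tensor_scale1 : left_id 1 tensor_scale.
Proof.
apply: (@tensor_of_ext _ (tensor_scale 1) id) => //= [u v|x y];
  by rewrite ?tensor_scaleD ?tensor_scaleE ?scale1r.
Qed.
Lemma tensor_scaleDl t : {morph tensor_scale^~ t : a b / a + b}.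
Proof.
move=> a b.
apply: (@tensor_of_ext _ (tensor_scale (a + b))
          (fun t => tensor_scale a t + tensor_scale b t)) => /= [u v|u v|x y].
- by rewrite tensor_scaleD.
- by rewrite !tensor_scaleD addrACA.
- by rewrite !tensor_scaleE scalerDl tpureDl.
Qed.
HB.instance Definition _ := GRing.Zmodule_isLmodule.Build S T
  tensor_scaleA tensor_scale1 (fun a => @tensor_scaleD a) tensor_scaleDl.

Lemma tensor_rscaleA t a b :
  tensor_rscale (tensor_rscale t a) b = tensor_rscale t (a * b).
Proof.
apply: (@tensor_of_ext _ (fun t => tensor_rscale (tensor_rscale t a) b)
  (fun t => tensor_rscale t (a * b))) => /= [u v|u v|x y];
  by rewrite ?(tensor_rscaleD, tensor_rscaleE) ?rscaleA.
Qed.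
Lemma tensor_rscale1 t : tensor_rscale t 1 = t.
Proof.
apply: (@tensor_of_ext _ (tensor_rscale^~ 1) id) => //= [u v|x y];
  by rewrite ?tensor_rscaleD ?tensor_rscaleE ?rscaler1.
Qed.
Lemma tensor_rscaleDr t a b :
  tensor_rscale t (a + b) = tensor_rscale t a + tensor_rscale t b.
Proof.
apply: (@tensor_of_ext _ (fun t => tensor_rscale t (a + b))
          (fun t => tensor_rscale t a + tensor_rscale t b)) => /= [u v|u v|x y].
- by rewrite tensor_rscaleD.
- by rewrite !tensor_rscaleD addrACA.
- by rewrite !tensor_rscaleE rscalerDr tpureDr.
Qed.
Lemma tensor_rscaleAl (a b : S) (t : T) :
  tensor_rscale (a *: t) b = a *: tensor_rscale t b.
Proof.
apply: (@tensor_of_ext _ (fun t => tensor_rscale (tensor_scale a t) b)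
  (fun t => tensor_scale a (tensor_rscale t b))) => /= [u v|u v|x y];
  by rewrite ?(tensor_rscaleD, tensor_scaleD) ?(tensor_rscaleE, tensor_scaleE).
Qed.
HB.instance Definition _ := Lmodule_hasRightScale.Build S T
  tensor_rscaleA tensor_rscale1 (fun u v a => @tensor_rscaleD a u v)
  tensor_rscaleDr tensor_rscaleAl.

Definition tensor : bimodType S := Bimodule.clone S (tensor_of M N) _.
Definition pure (x : M) (y : N) : tensor := tpure x y.

Lemma pureDl (x x' : M) (y : N) : pure (x + x') y = pure x y + pure x' y.
Proof. exact: tpureDl. Qed.
Lemma pureDr (x : M) (y y' : N) : pure x (y + y') = pure x y + pure x y'.
Proof. exact: tpureDr. Qed.
Lemma pure_bal (x : M) (a : S) (y : N) : pure (x *:r a) y = pure x (a *: y).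
Proof. exact: tpure_bal. Qed.
Lemma pure0l (y : N) : pure 0 y = 0. Proof. exact: tpure0l. Qed.
Lemma pure0r (x : M) : pure x 0 = 0. Proof. exact: tpure0r. Qed.
Lemma pureNl (x : M) (y : N) : pure (- x) y = - pure x y.
Proof. exact: tpureNl. Qed.
Lemma pureNr (x : M) (y : N) : pure x (- y) = - pure x y.
Proof. exact: tpureNr. Qed.
Lemma pureZ (a : S) (x : M) (y : N) : a *: pure x y = pure (a *: x) y.
Proof. exact: tensor_scaleE. Qed.
Lemma pureZr (a : S) (x : M) (y : N) : pure x y *:r a = pure x (y *:r a).
Proof. exact: tensor_rscaleE. Qed.

Lemma tensorP (t : tensor) :
  exists s : seq (M * N), t = \sum_(p <- s) pure p.1 p.2.
Proof. exact: tensor_ofP. Qed.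

Lemma tensor_ext (G : zmodType) (f g : tensor -> G) :
  {morph f : t u / t + u} -> {morph g : t u / t + u} ->
  (forall x y, f (pure x y) = g (pure x y)) -> f =1 g.
Proof. exact: tensor_of_ext. Qed.

Section Lift.
Variables (G : zmodType) (f : M -> N -> G).
Hypothesis fDl : forall x x' y, f (x + x') y = f x y + f x' y.
Hypothesis fDr : forall x y y', f x (y + y') = f x y + f x y'.
Hypothesis fbal : forall x a y, f (x *:r a) y = f x (a *: y).
Definition tlift : tensor -> G := @tlift_of S M N G f.
Lemma tliftE x y : tlift (pure x y) = f x y. Proof. exact: tlift_ofE. Qed.
Lemma tliftD : {morph tlift : t u / t + u}. Proof. exact: tlift_ofD. Qed.
End Lift.

Record balanced (P : bimodType S) (f : M -> N -> P) : Prop := Balanced {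
  bal_Dl : forall x x' y, f (x + x') y = f x y + f x' y;
  bal_Dr : forall x y y', f x (y + y') = f x y + f x y';
  bal_mid : forall x a y, f (x *:r a) y = f x (a *: y);
  bal_Z : forall a x y, f (a *: x) y = a *: f x y;
  bal_Zr : forall x y a, f x (y *:r a) = f x y *:r a
}.

Section LiftHom.
Variables (P : bimodType S) (f : M -> N -> P) (hf : balanced f).

Local Lemma lift_hom_subproof :
  [/\ {morph tlift f : t u / t + u}, forall a, {morph tlift f : t / a *: t}
    & forall a, {morph tlift f : t / t *:r a}].
Proof.
have [fDl fDr fm fZ fZr] := hf.
have D := tliftD fDl fDr fm; split=> // a t.
- apply: (@tensor_ext _ (fun t => tlift f (a *: t)) (fun t => a *: tlift f t)).
  + by move=> u v; rewrite scalerDr D.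
  + by move=> u v; rewrite D scalerDr.
  + by move=> x y; rewrite pureZ !tliftE.
- apply: (@tensor_ext _ (fun t => tlift f (t *:r a)) (fun t => tlift f t *:r a)).
  + by move=> u v; rewrite rscalerDl D.
  + by move=> u v; rewrite D rscalerDl.
  + by move=> x y; rewrite pureZr !tliftE.
Qed.
Definition tensor_lift : bimodHom tensor P :=
  let: And3 pD pZ pR := lift_hom_subproof in BimodHom pD pZ pR.

Lemma tensor_liftE x y : tensor_lift (pure x y) = f x y.
Proof.
have [fDl fDr fm _ _] := hf.
by rewrite /tensor_lift; case: lift_hom_subproof => * /=; rewrite tliftE.
Qed.
End LiftHom.

Lemma tensor_hom_ext (P : bimodType S) (f g : bimodHom tensor P) :
  (forall x y, f (pure x y) = g (pure x y)) -> f = g.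
Proof. by move=> fg; apply/bhom_ext/tensor_ext => //; apply: bhomD. Qed.
End TensorBimod.

Section TensorMaps.
Variable S : pzRingType.
Implicit Types M N P : bimodType S.

Lemma tmap_subproof M M' N N' (f : bimodHom M M') (g : bimodHom N N') :
  balanced (fun x y => pure (f x) (g y)).
Proof.
split=> *; rewrite ?bhomD ?bhomZ ?bhomZr.
- exact: pureDl.
- exact: pureDr.
- exact: pure_bal.
- by rewrite pureZ.
- by rewrite pureZr.
Qed.
Definition tmap M M' N N' (f : bimodHom M M') (g : bimodHom N N') :
  bimodHom (tensor M N) (tensor M' N') := tensor_lift (tmap_subproof f g).

Lemma unitl_subproof M : balanced (fun (a : regular S) (x : M) => (a : S) *: x).
Proof.
split=> *; rewrite ?scalerDl ?scalerDr ?scalerA //.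
by rewrite rscaleAl.
Qed.
Definition unitl M : bimodHom (tensor (regular S) M) M := tensor_lift (unitl_subproof M).

Lemma unitl_inv_subproof M :
  [/\ {morph (fun x : M => pure (1 : regular S) x) : x y / x + y},
     forall a, {morph (fun x : M => pure (1 : regular S) x) : x / a *: x}
   & forall a, {morph (fun x : M => pure (1 : regular S) x) : x / x *:r a}].
Proof.
split=> [x y|a x|a x]; rewrite ?pureDr ?pureZ ?pureZr //.
by rewrite -pure_bal; congr pure; rewrite /rscale /= mul1r /GRing.scale /= mulr1.
Qed.
Definition unitl_inv M : bimodHom M (tensor (regular S) M) :=
  let: And3 pD pZ pR := unitl_inv_subproof M in BimodHom pD pZ pR.

Lemma unitr_inv_subproof M :
  [/\ {morph (fun x : M => pure x (1 : regular S)) : x y / x + y},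
     forall a, {morph (fun x : M => pure x (1 : regular S)) : x / a *: x}
   & forall a, {morph (fun x : M => pure x (1 : regular S)) : x / x *:r a}].
Proof.
split=> [x y|a x|a x]; rewrite ?pureDl ?pureZ ?pureZr //.
by rewrite pure_bal; congr pure; rewrite /rscale /= mul1r /GRing.scale /= mulr1.
Qed.
Definition unitr_inv M : bimodHom M (tensor M (regular S)) :=
  let: And3 pD pZ pR := unitr_inv_subproof M in BimodHom pD pZ pR.

End TensorMaps.

Section DirectSum.
Variables (S : pzRingType) (I : choiceType) (M : I -> bimodType S).

(* Direct sums: dependent families of finite support. *)
Definition finsupp (f : forall i, M i) : Prop :=
  exists s : seq I, forall i, i \notin s -> f i = 0.

Record dsum_of : Type := DSumOf { dsum_fun :> forall i, M i; dsumP : finsupp dsum_fun }.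

HB.instance Definition _ := gen_eqMixin dsum_of.
HB.instance Definition _ := gen_choiceMixin dsum_of.

Lemma dsum_of_ext (x y : dsum_of) : (forall i, x i = y i) -> x = y.
Proof.
case: x y => [f hf] [g hg] /= fg.
have {}fg : f = g by apply: functional_extensionality_dep.
by subst g; f_equal; apply: Prop_irrelevance.
Qed.

Lemma dsum0_subproof : finsupp (fun i => 0 : M i).
Proof. by exists [::]. Qed.
Lemma dsumD_subproof (x y : dsum_of) : finsupp (fun i => x i + y i).
Proof.
have [[s hs] [t ht]] := (dsumP x, dsumP y); exists (s ++ t) => i.
by rewrite mem_cat negb_or => /andP[/hs -> /ht ->]; rewrite addr0.
Qed.
Lemma dsumN_subproof (x : dsum_of) : finsupp (fun i => - x i).
Proof. by have [s hs] := dsumP x; exists s => i /hs ->; rewrite oppr0. Qed.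
Lemma dsumZ_subproof (a : S) (x : dsum_of) : finsupp (fun i => a *: x i).
Proof. by have [s hs] := dsumP x; exists s => i /hs ->; rewrite scaler0. Qed.
Lemma dsumZr_subproof (x : dsum_of) (a : S) : finsupp (fun i => x i *:r a).
Proof. by have [s hs] := dsumP x; exists s => i /hs ->; rewrite rscale0r. Qed.

Definition dsum0 := DSumOf dsum0_subproof.
Definition dsumD x y := DSumOf (dsumD_subproof x y).
Definition dsumN x := DSumOf (dsumN_subproof x).
Definition dsumZ a x := DSumOf (dsumZ_subproof a x).
Definition dsumZr x a := DSumOf (dsumZr_subproof x a).

Lemma dsum_addA : associative dsumD.
Proof. by move=> x y z; apply: dsum_of_ext => i /=; rewrite addrA. Qed.
Lemma dsum_addC : commutative dsumD.
Proof. by move=> x y; apply: dsum_of_ext => i /=; rewrite addrC. Qed.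
Lemma dsum_add0 : left_id dsum0 dsumD.
Proof. by move=> x; apply: dsum_of_ext => i /=; rewrite add0r. Qed.
Lemma dsum_addN : left_inverse dsum0 dsumN dsumD.
Proof. by move=> x; apply: dsum_of_ext => i /=; rewrite addNr. Qed.
HB.instance Definition _ :=
  GRing.isZmodule.Build dsum_of dsum_addA dsum_addC dsum_add0 dsum_addN.

Lemma dsum_scaleA a b (x : dsum_of) : dsumZ a (dsumZ b x) = dsumZ (a * b) x.
Proof. by apply: dsum_of_ext => i /=; rewrite scalerA. Qed.
Lemma dsum_scale1 : left_id 1 dsumZ.
Proof. by move=> x; apply: dsum_of_ext => i /=; rewrite scale1r. Qed.
Lemma dsum_scaleDr : right_distributive dsumZ +%R.
Proof. by move=> a x y; apply: dsum_of_ext => i /=; rewrite scalerDr. Qed.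
Lemma dsum_scaleDl (x : dsum_of) : {morph dsumZ^~ x : a b / a + b}.
Proof. by move=> a b; apply: dsum_of_ext => i /=; rewrite scalerDl. Qed.
HB.instance Definition _ := GRing.Zmodule_isLmodule.Build S dsum_of
  dsum_scaleA dsum_scale1 dsum_scaleDr dsum_scaleDl.

Lemma dsum_rscaleA (x : dsum_of) a b : dsumZr (dsumZr x a) b = dsumZr x (a * b).
Proof. by apply: dsum_of_ext => i /=; rewrite rscaleA. Qed.
Lemma dsum_rscale1 (x : dsum_of) : dsumZr x 1 = x.
Proof. by apply: dsum_of_ext => i /=; rewrite rscaler1. Qed.
Lemma dsum_rscaleDl (x y : dsum_of) a : dsumZr (x + y) a = dsumZr x a + dsumZr y a.
Proof. by apply: dsum_of_ext => i /=; rewrite rscalerDl. Qed.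
Lemma dsum_rscaleDr (x : dsum_of) a b : dsumZr x (a + b) = dsumZr x a + dsumZr x b.
Proof. by apply: dsum_of_ext => i /=; rewrite rscalerDr. Qed.
Lemma dsum_rscaleAl (a b : S) (x : dsum_of) : dsumZr (a *: x) b = a *: dsumZr x b.
Proof. by apply: dsum_of_ext => i /=; rewrite rscaleAl. Qed.
HB.instance Definition _ := Lmodule_hasRightScale.Build S dsum_of
  dsum_rscaleA dsum_rscale1 dsum_rscaleDl dsum_rscaleDr dsum_rscaleAl.

Definition dsum : bimodType S := Bimodule.clone S dsum_of _.
Definition DSum (f : forall i, M i) (hf : finsupp f) : dsum := DSumOf hf.

Lemma dsum_ext (x y : dsum) : (forall i, x i = y i) -> x = y.
Proof. exact: dsum_of_ext. Qed.
Lemma dsum0E i : (0 : dsum) i = 0. Proof. by []. Qed.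
Lemma dsumDE (x y : dsum) i : (x + y) i = x i + y i. Proof. by []. Qed.
Lemma dsumNE (x : dsum) i : (- x) i = - x i. Proof. by []. Qed.
Lemma dsum_sumE (J : Type) (r : seq J) (P : pred J) (F : J -> dsum) i :
  (\sum_(j <- r | P j) F j) i = \sum_(j <- r | P j) F j i.
Proof.
elim: r => [|j r IH]; first by rewrite !big_nil.
by rewrite !big_cons; case: ifP => _ //; rewrite dsumDE IH.
Qed.

Definition dproj (i : I) : bimodHom dsum (M i) :=
  @BimodHom S dsum (M i) (fun x => x i)
    (fun _ _ => erefl) (fun _ _ => erefl) (fun _ _ => erefl).

Definition dinj_fun i (x : M i) : forall j, M j := dfwith (fun j => 0 : M j) x.
Lemma dinj_finsupp i (x : M i) : finsupp (dinj_fun x).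
Proof.
exists [:: i] => j; rewrite inE => ji.
by rewrite /dinj_fun dfwith_out // eq_sym.
Qed.

Lemma dinj_subproof i :
  [/\ {morph (fun x : M i => DSum (dinj_finsupp x)) : x y / x + y},
      forall a, {morph (fun x : M i => DSum (dinj_finsupp x)) : x / a *: x}
    & forall a, {morph (fun x : M i => DSum (dinj_finsupp x)) : x / x *:r a}].
Proof.
split=> [x y|a x|a x]; apply: dsum_ext => j /=; rewrite /dinj_fun;
  have [<-|ij] := eqVneq i j; rewrite ?dfwith_in // !dfwith_out //.
- by rewrite addr0.
- by rewrite scaler0.
- by rewrite rscale0r.
Qed.
Definition dinj i : bimodHom (M i) dsum :=
  let: And3 pD pZ pR := dinj_subproof i in BimodHom pD pZ pR.

Lemma dinjE i (x : M i) j : dinj i x j = dfwith (fun j => 0 : M j) x j.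
Proof. by rewrite /dinj; case: dinj_subproof. Qed.
Lemma dinj_in i (x : M i) : dinj i x i = x.
Proof. by rewrite dinjE dfwith_in. Qed.
Lemma dinj_out i j (x : M i) : i != j -> dinj i x j = 0.
Proof. by move=> ij; rewrite dinjE dfwith_out. Qed.

Lemma dproj_inj i (x : M i) : dproj i (dinj i x) = x.
Proof. exact: dinj_in. Qed.
Lemma dproj_inj_out i j (x : M i) : i != j -> dproj j (dinj i x) = 0.
Proof. exact: dinj_out. Qed.

Definition dsupp (x : dsum) : seq I := undup (sval (cid (dsumP x))).
Lemma dsupp_uniq x : uniq (dsupp x). Proof. exact: undup_uniq. Qed.
Lemma dsupp_out x i : i \notin dsupp x -> x i = 0.
Proof. by rewrite mem_undup; apply: (svalP (cid (dsumP x))). Qed.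

Lemma dsum_recompose (x : dsum) : x = \sum_(i <- dsupp x) dinj i (x i).
Proof.
apply: dsum_ext => j; rewrite dsum_sumE.
have [js|js] := boolP (j \in dsupp x).
  rewrite (bigD1_seq j) ?dsupp_uniq //= dinj_in big1 ?addr0 // => i ij.
  by rewrite dinj_out.
rewrite big_seq big1 ?dsupp_out // => i ix; rewrite dinj_out //.
by apply: contraNneq js => <-.
Qed.

Section Copair.
Variables (N : zmodType) (f : forall i, M i -> N).
Hypothesis fD : forall i, {morph @f i : x y / x + y}.

Definition dlift (x : dsum) : N := \sum_(i <- dsupp x) @f i (x i).

Local Lemma f0 i : @f i 0 = 0.
Proof. by apply: (addIr (@f i 0)); rewrite -fD !add0r. Qed.

Lemma dlift_supp (x : dsum) (s : seq I) :
  uniq s -> (forall i, i \notin s -> x i = 0) -> dlift x = \sum_(i <- s) @f i (x i).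
Proof.
move=> us hs; rewrite /dlift.
have E (t : seq I) : uniq t -> (forall i, i \notin t -> x i = 0) ->
    \sum_(i <- t) @f i (x i) = \sum_(i <- t | x i != 0) @f i (x i).
  move=> _ _; rewrite [LHS](bigID (fun i => x i != 0)) /= [X in _ + X]big1 ?addr0 //.
  by move=> i /negPn/eqP ->; rewrite f0.
rewrite E ?dsupp_uniq ?E //; last exact: dsupp_out.
rewrite -[LHS]big_filter -[RHS]big_filter; apply: perm_big.
apply: uniq_perm; rewrite ?filter_uniq ?dsupp_uniq // => i.
rewrite !mem_filter; case: eqP => //= /eqP xi.
have -> : i \in dsupp x by apply: contraNT xi => /dsupp_out ->.
by apply/esym; apply: contraNT xi => /hs ->.
Qed.

Lemma dliftD : {morph dlift : x y / x + y}.
Proof.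
move=> x y; set s := undup (dsupp x ++ dsupp y).
have us : uniq s by apply: undup_uniq.
have hx i : i \notin s -> x i = 0.
  by rewrite mem_undup mem_cat negb_or => /andP[/dsupp_out].
have hy i : i \notin s -> y i = 0.
  by rewrite mem_undup mem_cat negb_or => /andP[_ /dsupp_out].
rewrite (dlift_supp us hx) (dlift_supp us hy) (@dlift_supp (x + y) s) //; last first.
  by move=> i hi; rewrite dsumDE hx // hy // addr0.
by rewrite -big_split; apply: eq_bigr => i _; rewrite dsumDE fD.
Qed.

Lemma dlift_inj i (x : M i) : dlift (dinj i x) = @f i x.
Proof.
rewrite (@dlift_supp _ [:: i]) ?big_seq1 ?dinj_in // => j.
by rewrite inE eq_sym => /dinj_out.
Qed.
End Copair.

Section CopairHom.
Variables (N : bimodType S) (f : forall i, bimodHom (M i) N).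

Local Lemma copair_subproof :
  [/\ {morph dlift (fun i => f i : M i -> N) : x y / x + y}, forall a, {morph dlift (fun i => f i : M i -> N) : x / a *: x}
    & forall a, {morph dlift (fun i => f i : M i -> N) : x / x *:r a}].
Proof.
have fD i : {morph f i : x y / x + y} by apply: bhomD.
split=> [|a x|a x]; first exact: (dliftD fD).
- rewrite (dlift_supp fD (dsupp_uniq x)) => [|i /dsupp_out /= ->]; last by rewrite scaler0.
  by rewrite scaler_sumr; apply: eq_bigr => i _; rewrite bhomZ.
- rewrite (dlift_supp fD (dsupp_uniq x)) => [|i /dsupp_out /= ->]; last by rewrite rscale0r.
  by rewrite rscaler_sum; apply: eq_bigr => i _; rewrite bhomZr.
Qed.
Definition dcopair : bimodHom dsum N :=
  let: And3 pD pZ pR := copair_subproof in BimodHom pD pZ pR.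

Lemma dcopairE x : dcopair x = \sum_(i <- dsupp x) f i (x i).
Proof. by rewrite /dcopair; case: copair_subproof. Qed.
Lemma dcopair_inj i (x : M i) : dcopair (dinj i x) = f i x.
Proof. by rewrite dcopairE; apply: (dlift_inj (f := fun i => f i : M i -> N)) => j; apply: bhomD. Qed.
End CopairHom.

Lemma dsum_hom_ext (N : bimodType S) (f g : bimodHom dsum N) :
  (forall i (x : M i), f (dinj i x) = g (dinj i x)) -> f = g.
Proof.
move=> fg; apply: bhom_ext => x; rewrite (dsum_recompose x) !raddf_sum.
by apply: eq_bigr => i _; apply: fg.
Qed.

Section Pair.
Variables (N : bimodType S) (f : forall i, bimodHom N (M i)).
Hypothesis hf : forall x, finsupp (fun i => f i x).

Local Lemma dpair_subproof :
  [/\ {morph (fun x => DSum (hf x)) : x y / x + y},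
      forall a, {morph (fun x => DSum (hf x)) : x / a *: x}
    & forall a, {morph (fun x => DSum (hf x)) : x / x *:r a}].
Proof.
by split=> [x y|a x|a x]; apply: dsum_ext => i /=; rewrite ?bhomD ?bhomZ ?bhomZr.
Qed.
Definition dpair : bimodHom N dsum :=
  let: And3 pD pZ pR := dpair_subproof in BimodHom pD pZ pR.
Lemma dpairE x i : dpair x i = f i x.
Proof. by rewrite /dpair; case: dpair_subproof. Qed.
End Pair.
End DirectSum.

Section Distr.
Variables (S : pzRingType) (I : choiceType) (M : I -> bimodType S) (N P : bimodType S).

Section L.
Variable f : forall i, bimodHom (tensor (M i) N) P.
Lemma dcopairl_subproof :
  balanced (fun (x : dsum M) (y : N) => dlift (fun i xi => f i (pure xi y)) x).
Proof.
have fD y i : {morph (fun xi : M i => f i (pure xi y)) : u v / u + v}.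
  by move=> u v; rewrite pureDl bhomD.
split=> [x x' y|x y y'|x a y|a x y|x y a].
- by rewrite dliftD.
- by rewrite /dlift -big_split; apply: eq_bigr => i _; rewrite pureDr bhomD.
- rewrite (dlift_supp (fD y) (dsupp_uniq x)) => [|i /dsupp_out /= ->]; last by rewrite rscale0r.
  by apply: eq_bigr => i _; rewrite pure_bal.
- rewrite (dlift_supp (fD y) (dsupp_uniq x)) => [|i /dsupp_out /= ->]; last by rewrite scaler0.
  by rewrite scaler_sumr; apply: eq_bigr => i _; rewrite -pureZ bhomZ.
- by rewrite rscaler_sum; apply: eq_bigr => i _; rewrite -pureZr bhomZr.
Qed.
Definition dcopairl : bimodHom (tensor (dsum M) N) P := tensor_lift dcopairl_subproof.
End L.

Section R.
Variable f : forall i, bimodHom (tensor N (M i)) P.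
Lemma dcopairr_subproof :
  balanced (fun (y : N) (x : dsum M) => dlift (fun i xi => f i (pure y xi)) x).
Proof.
have fD y i : {morph (fun xi : M i => f i (pure y xi)) : u v / u + v}.
  by move=> u v; rewrite pureDr bhomD.
split=> [y y' x|y x x'|y a x|a y x|y x a].
- by rewrite /dlift -big_split; apply: eq_bigr => i _; rewrite pureDl bhomD.
- by rewrite dliftD.
- rewrite [RHS](dlift_supp (fD y) (dsupp_uniq x)) => [|i /dsupp_out /= ->]; last by rewrite scaler0.
  by apply: eq_bigr => i _; rewrite pure_bal.
- by rewrite scaler_sumr; apply: eq_bigr => i _; rewrite -pureZ bhomZ.
- rewrite (dlift_supp (fD y) (dsupp_uniq x)) => [|i /dsupp_out /= ->]; last by rewrite rscale0r.
  by rewrite rscaler_sum; apply: eq_bigr => i _; rewrite -pureZr bhomZr.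
Qed.
Definition dcopairr : bimodHom (tensor N (dsum M)) P := tensor_lift dcopairr_subproof.
End R.
End Distr.

Section SubQuotient.
Variables (S : pzRingType) (M : bimodType S).

Record subbimod := SubBimod {
  sb_set :> M -> Prop;
  sb0 : sb_set 0;
  sbD : forall x y, sb_set x -> sb_set y -> sb_set (x + y);
  sbZ : forall a x, sb_set x -> sb_set (a *: x);
  sbZr : forall a x, sb_set x -> sb_set (x *:r a)
}.

Variable P : subbimod.
Definition sb_pred : {pred M} := fun x => `[< P x >].

Lemma sb_pred_closed : submod_closed sb_pred.
Proof.
split; first exact/asboolP/sb0.
by move=> a x y /asboolP hx /asboolP hy; apply/asboolP/sbD => //; apply: sbZ.
Qed.
HB.instance Definition _ := GRing.isSubmodClosed.Build S M sb_pred sb_pred_closed.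

Record sub_carrier : Type := SubOf { sub_val : M; _ : sb_pred sub_val }.
HB.instance Definition _ := [isSub for sub_val].
HB.instance Definition _ := [Choice of sub_carrier by <:].
HB.instance Definition _ := [SubChoice_isSubLmodule of sub_carrier by <:].

Lemma sub_valP (x : sub_carrier) : P (sub_val x).
Proof. by case: x => x /= /asboolP. Qed.

Definition sub_in (x : M) (hx : P x) : sub_carrier := SubOf (asboolT hx : sb_pred x).

Definition sub_rscale (x : sub_carrier) (a : S) : sub_carrier :=
  sub_in (sbZr a (sub_valP x)).

Local Lemma sub_rscaleA x a b : sub_rscale (sub_rscale x a) b = sub_rscale x (a * b).
Proof. by apply: val_inj; apply: rscaleA. Qed.
Local Lemma sub_rscale1 x : sub_rscale x 1 = x.
Proof. by apply: val_inj; apply: rscaler1. Qed.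
Local Lemma sub_rscaleDl (x y : sub_carrier) a :
  sub_rscale (x + y) a = sub_rscale x a + sub_rscale y a.
Proof. by apply: val_inj; apply: rscalerDl. Qed.
Local Lemma sub_rscaleDr x a b :
  sub_rscale x (a + b) = sub_rscale x a + sub_rscale x b.
Proof. by apply: val_inj; apply: rscalerDr. Qed.
Local Lemma sub_rscaleAl (a b : S) (x : sub_carrier) :
  sub_rscale (a *: x) b = a *: sub_rscale x b.
Proof. by apply: val_inj; apply: rscaleAl. Qed.
HB.instance Definition _ := Lmodule_hasRightScale.Build S sub_carrier
  sub_rscaleA sub_rscale1 sub_rscaleDl sub_rscaleDr sub_rscaleAl.

Definition sub_of : bimodType S := Bimodule.clone S sub_carrier _.

Definition sub_incl : bimodHom sub_of M :=
  @BimodHom S sub_of M sub_val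
    (fun _ _ => erefl) (fun _ _ => erefl) (fun _ _ => erefl).

Section Corestrict.
Variables (N : bimodType S) (f : bimodHom N M) (hf : forall x, P (f x)).
Local Lemma corestrict_subproof :
  [/\ {morph (fun x => sub_in (hf x) : sub_of) : x y / x + y},
      forall a, {morph (fun x => sub_in (hf x) : sub_of) : x / a *: x}
    & forall a, {morph (fun x => sub_in (hf x) : sub_of) : x / x *:r a}].
Proof.
by split=> [x y|a x|a x]; apply: val_inj => /=; rewrite ?bhomD ?bhomZ ?bhomZr.
Qed.
Definition corestrict : bimodHom N sub_of :=
  let: And3 pD pZ pR := corestrict_subproof in BimodHom pD pZ pR.
Lemma corestrictE x : sub_val (corestrict x) = f x.
Proof. by rewrite /corestrict; case: corestrict_subproof. Qed.
End Corestrict.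

Definition sb_zmod : zmodClosed M := sb_pred.
Definition quot_carrier : Type := Quotient.quot sb_zmod.
HB.instance Definition _ := GRing.Zmodule.on quot_carrier.
Local Notation Q := (Quotient.quot sb_zmod).
Definition quot_fun (x : M) : quot_carrier := \pi_Q x.

Lemma quot_funD : {morph quot_fun : x y / x + y}.
Proof. by move=> x y; rewrite /quot_fun !piE. Qed.
Lemma quot_eqP x y : quot_fun x = quot_fun y <-> P (x - y).
Proof.
split=> [/eqP|h]; last apply/eqP; rewrite /quot_fun -(Quotient.idealrBE sb_zmod).
  by move/asboolP.
exact/asboolP.
Qed.
Lemma quot_reprK (q : quot_carrier) : quot_fun (repr (q : Q)) = q.
Proof. exact: (@reprK _ Q). Qed.

Definition quot_scale (a : S) (q : quot_carrier) : quot_carrier := quot_fun (a *: repr (q : Q)).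
Definition quot_rscale (q : quot_carrier) (a : S) : quot_carrier := quot_fun (repr (q : Q) *:r a).
Lemma quot_scaleE a x : quot_scale a (quot_fun x) = quot_fun (a *: x).
Proof.
apply/quot_eqP; rewrite -scalerBr; apply: sbZ.
by apply/quot_eqP; rewrite quot_reprK.
Qed.
Lemma quot_rscaleE x a : quot_rscale (quot_fun x) a = quot_fun (x *:r a).
Proof.
apply/quot_eqP; rewrite -rscaleNr -rscalerDl; apply: sbZr.
by apply/quot_eqP; rewrite quot_reprK.
Qed.

Lemma quot_scaleA a b q : quot_scale a (quot_scale b q) = quot_scale (a * b) q.
Proof. by rewrite -[q]quot_reprK !quot_scaleE scalerA. Qed.
Lemma quot_scale1 : left_id 1 quot_scale.
Proof. by move=> q; rewrite -[q]quot_reprK !quot_scaleE scale1r. Qed.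
Lemma quot_scaleDr : right_distributive quot_scale +%R.
Proof.
move=> a p q; rewrite -[p]quot_reprK -[q]quot_reprK.
by rewrite !(quot_scaleE, =^~ quot_funD) scalerDr.
Qed.
Lemma quot_scaleDl q : {morph quot_scale^~ q : a b / a + b}.
Proof. by move=> a b; rewrite -[q]quot_reprK !quot_scaleE scalerDl quot_funD. Qed.
HB.instance Definition _ := GRing.Zmodule_isLmodule.Build S quot_carrier
  quot_scaleA quot_scale1 quot_scaleDr quot_scaleDl.

Lemma quot_rscaleA q a b : quot_rscale (quot_rscale q a) b = quot_rscale q (a * b).
Proof. by rewrite -[q]quot_reprK !quot_rscaleE rscaleA. Qed.
Lemma quot_rscale1 q : quot_rscale q 1 = q.
Proof. by rewrite -[q]quot_reprK !quot_rscaleE rscaler1. Qed.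
Lemma quot_rscaleDl p q a : quot_rscale (p + q) a = quot_rscale p a + quot_rscale q a.
Proof.
rewrite -[p]quot_reprK -[q]quot_reprK.
by rewrite !(quot_rscaleE, =^~ quot_funD) rscalerDl.
Qed.
Lemma quot_rscaleDr q a b : quot_rscale q (a + b) = quot_rscale q a + quot_rscale q b.
Proof. by rewrite -[q]quot_reprK !quot_rscaleE rscalerDr quot_funD. Qed.
Lemma quot_rscaleAl (a b : S) (q : quot_carrier) :
  quot_rscale (a *: q) b = a *: quot_rscale q b.
Proof.
rewrite -[q]quot_reprK -[a *: _]/(quot_scale a _) -[a *: quot_rscale _ _]/(quot_scale a _).
by rewrite !(quot_scaleE, quot_rscaleE) rscaleAl.
Qed.
HB.instance Definition _ := Lmodule_hasRightScale.Build S quot_carrier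
  quot_rscaleA quot_rscale1 quot_rscaleDl quot_rscaleDr quot_rscaleAl.

Definition quot_by : bimodType S := Bimodule.clone S quot_carrier _.

Definition quot_pi : bimodHom M quot_by :=
  @BimodHom S M quot_by quot_fun quot_funD
    (fun a x => esym (quot_scaleE a x)) (fun a x => esym (quot_rscaleE x a)).
End SubQuotient.

Section Associator.
Variables (S : pzRingType) (M N P : bimodType S).

Local Lemma assoc_in (z : P) :
  [/\ forall (x x' : M) (y : N), pure (x + x') (pure y z) = pure x (pure y z) + pure x' (pure y z),
      forall (x : M) (y y' : N), pure x (pure (y + y') z) = pure x (pure y z) + pure x (pure y' z)
    & forall (x : M) (a : S) (y : N), pure (x *:r a) (pure y z) = pure x (pure (a *: y) z)].
Proof.
split=> [x x' y|x y y'|x a y]; first exact: pureDl.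
- by rewrite pureDl pureDr.
- by rewrite pure_bal pureZ.
Qed.
Local Notation af := (fun (t : tensor M N) (z : P) => tlift (fun x y => pure x (pure y z)) t).
Local Lemma afD z : {morph af ^~ z : t u / t + u}.
Proof. by have [Dl Dr m] := assoc_in z; apply: tliftD. Qed.
Local Lemma afE z x y : af (pure x y) z = pure x (pure y z).
Proof. by have [Dl Dr m] := assoc_in z; rewrite tliftE. Qed.
Lemma assoc_subproof : balanced af.
Proof.
split=> [t t' z|t z z'|t a z|a t z|t z a].
- exact: afD.
- apply: (@tensor_ext _ _ _ _ (af^~ (z + z')) (fun t => af t z + af t z')) => /=.
  + exact: afD.
  + by move=> u v; rewrite !afD addrACA.
  + by move=> x y; rewrite !afE !pureDr.
- apply: (@tensor_ext _ _ _ _ (fun t => af (t *:r a) z) (af^~ (a *: z))) => /=.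
  + by move=> u v; rewrite rscalerDl afD.
  + exact: afD.
  + by move=> x y; rewrite pureZr !afE pure_bal.
- apply: (@tensor_ext _ _ _ _ (fun t => af (a *: t) z) (fun t => a *: af t z)) => /=.
  + by move=> u v; rewrite scalerDr afD.
  + by move=> u v; rewrite afD scalerDr.
  + by move=> x y; rewrite pureZ !afE pureZ.
- apply: (@tensor_ext _ _ _ _ (af^~ (z *:r a)) (fun t => af t z *:r a)) => /=.
  + exact: afD.
  + by move=> u v; rewrite afD rscalerDl.
  + by move=> x y; rewrite !afE !pureZr.
Qed.
Definition tassoc : bimodHom (tensor (tensor M N) P) (tensor M (tensor N P)) :=
  tensor_lift assoc_subproof.
Lemma tassocE x y z : tassoc (pure (pure x y) z) = pure x (pure y z).
Proof. by rewrite tensor_liftE afE. Qed.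

Local Lemma associ_in (x : M) :
  [/\ forall (y y' : N) (z : P), pure (pure x (y + y')) z = pure (pure x y) z + pure (pure x y') z,
      forall (y : N) (z z' : P), pure (pure x y) (z + z') = pure (pure x y) z + pure (pure x y) z'
    & forall (y : N) (a : S) (z : P), pure (pure x (y *:r a)) z = pure (pure x y) (a *: z)].
Proof.
split=> [y y' z|y z z'|y a z]; last by rewrite -pureZr pure_bal.
- by rewrite pureDr pureDl.
- exact: pureDr.
Qed.
Local Notation ag := (fun (x : M) (t : tensor N P) => tlift (fun y z => pure (pure x y) z) t).
Local Lemma agD x : {morph ag x : t u / t + u}.
Proof. by have [Dl Dr m] := associ_in x; apply: tliftD. Qed.
Local Lemma agE x y z : ag x (pure y z) = pure (pure x y) z.
Proof. by have [Dl Dr m] := associ_in x; rewrite tliftE. Qed.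
Lemma associ_subproof : balanced ag.
Proof.
split=> [x x' t|x t t'|x a t|a x t|x t a].
- apply: (@tensor_ext _ _ _ _ (ag (x + x')) (fun t => ag x t + ag x' t)) => /=.
  + exact: agD.
  + by move=> u v; rewrite !agD addrACA.
  + by move=> y z; rewrite !agE !pureDl.
- exact: agD.
- apply: (@tensor_ext _ _ _ _ (ag (x *:r a)) (fun t => ag x (a *: t))) => /=.
  + exact: agD.
  + by move=> u v; rewrite scalerDr agD.
  + by move=> y z; rewrite pureZ !agE pure_bal.
- apply: (@tensor_ext _ _ _ _ (ag (a *: x)) (fun t => a *: ag x t)) => /=.
  + exact: agD.
  + by move=> u v; rewrite agD scalerDr.
  + by move=> y z; rewrite !agE !pureZ.
- apply: (@tensor_ext _ _ _ _ (fun t => ag x (t *:r a)) (fun t => ag x t *:r a)) => /=.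
  + by move=> u v; rewrite rscalerDl agD.
  + by move=> u v; rewrite agD rscalerDl.
  + by move=> y z; rewrite pureZr !agE pureZr.
Qed.
Definition tassoc_inv : bimodHom (tensor M (tensor N P)) (tensor (tensor M N) P) :=
  tensor_lift associ_subproof.
Lemma tassoc_invE x y z : tassoc_inv (pure x (pure y z)) = pure (pure x y) z.
Proof. by rewrite tensor_liftE agE. Qed.
End Associator.

Section UnitR.
Variables (S : pzRingType) (M : bimodType S).
Lemma unitr_subproof : balanced (fun (x : M) (a : regular S) => x *:r (a : S)).
Proof.
split=> *; rewrite ?rscalerDl ?rscalerDr ?rscaleA //.
by rewrite rscaleAl.
Qed.
Definition unitr : bimodHom (tensor M (regular S)) M := tensor_lift unitr_subproof.
End UnitR.

Section TensorPower.
Variable S : pzRingType.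
Implicit Types M N : bimodType S.

(* M^n, with M^0 = S; so M^1 is M (x)_S S, identified with M by unitr_inv. *)
Fixpoint tpow M (n : nat) : bimodType S :=
  if n is n'.+1 then tensor M (tpow M n') else regular S.

Arguments tpow : simpl never.

Fixpoint tmerge M n m : bimodHom (tensor (tpow M n) (tpow M m)) (tpow M (n + m)) :=
  match n return bimodHom (tensor (tpow M n) (tpow M m)) (tpow M (n + m)) with
  | 0 => unitl (tpow M m)
  | n'.+1 => hcomp (tmap (hid M) (tmerge M n' m)) (tassoc M (tpow M n') (tpow M m))
  end.

Fixpoint tpow_map M N (f : bimodHom M N) n : bimodHom (tpow M n) (tpow N n) :=
  match n return bimodHom (tpow M n) (tpow N n) with
  | 0 => hid (regular S)
  | n'.+1 => tmap f (tpow_map f n')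
  end.

(* The component of index i of T^+(M) is M^(i+1). *)
Definition Tplus M : bimodType S := dsum (fun i => tpow M i.+1).

Definition Tplus_map M N (f : bimodHom M N) : bimodHom (Tplus M) (Tplus N) :=
  dcopair (fun i => hcomp (dinj (fun i => tpow N i.+1) i) (tpow_map f i.+1)).

Definition Tplus_gen M : bimodHom M (Tplus M) :=
  hcomp (dinj (fun i => tpow M i.+1) 0%N) (unitr_inv M).

Definition Tplus_mul M : bimodHom (tensor (Tplus M) (Tplus M)) (Tplus M) :=
  dcopairl (fun i => dcopairr (fun j =>
    hcomp (dinj (fun i => tpow M i.+1) (i + j.+1)%N) (tmerge M i.+1 j.+1))).

Definition Tplus_rmul M n : bimodHom (tensor (Tplus M) (tpow M n)) (Tplus M) :=
  dcopairl (fun i =>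
    hcomp (dinj (fun i => tpow M i.+1) (i + n)%N) (tmerge M i.+1 n)).
Definition Tplus_cons M : bimodHom (tensor M (Tplus M)) (Tplus M) :=
  dcopairr (fun i => dinj (fun i => tpow M i.+1) i.+1).

(* The map T^+(M) -> T^+(M) with restriction delta to M and
   d (x * t) = delta x * t + eps x * d t. *)
Section Leibniz.
Variables (M : bimodType S) (eps : bimodHom M M) (delta : bimodHom M (Tplus M)).
Fixpoint leibniz_pow n : bimodHom (tpow M n) (Tplus M) :=
  match n return bimodHom (tpow M n) (Tplus M) with
  | 0 => 0
  | n'.+1 => hcomp (Tplus_rmul M n') (tmap delta (hid (tpow M n')))
           + hcomp (Tplus_cons M) (tmap eps (leibniz_pow n'))
  end.
Definition leibniz_ext : bimodHom (Tplus M) (Tplus M) :=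
  dcopair (fun i => leibniz_pow i.+1).
End Leibniz.
End TensorPower.

Section Graded.
Variable S : pzRingType.
Implicit Types K : int -> bimodType S.

Definition total K : bimodType S := dsum K.

(* Multiplication by (-1)^(k d) on K_d: the Koszul sign for moving an operator of
   degree k (mod 2) past an element of K_d. *)
Definition koszul K (k : nat) : bimodHom (total K) (total K) :=
  dcopair (fun d : int => dinj K d *~ (-1) ^+ (k * `|d|%N)).

(* The degree d part of the n-th tensor power: the span of the tensors of
   homogeneous elements whose degrees add up to d. *)
Inductive homog K : forall n : nat, int -> tpow (total K) n -> Prop :=
| homog_unit (a : tpow (total K) 0) : homog (n := 0) 0 a
| homog_pure n (d e : int) (x : K d) (t : tpow (total K) n) :
    homog e t -> homog (n := n.+1) (d + e) (pure (dinj K d x) t)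
| homog_zero n d : homog (n := n) d 0
| homog_add n d (t u : tpow (total K) n) : homog d t -> homog d u -> homog d (t + u).

Definition shift K : int -> bimodType S := fun n => K (n + 1).

Lemma suspend_subproof K (x : total K) :
  finsupp (fun n : int => (dproj K (n + 1) x : shift K n)).
Proof.
have [s hs] := dsumP x; exists [seq m - 1 | m <- s] => n hn; apply: hs.
by apply: contra hn => hn; apply/mapP; exists (n + 1); rewrite ?addrK.
Qed.
(* suspend and desuspend are the identity maps [1] : K -> K[1] and [-1] : K[1] -> K. *)
Definition suspend K : bimodHom (total K) (total (shift K)) :=
  dpair (M := shift K) (f := fun n => dproj K (n + 1)) (@suspend_subproof K).
Definition desuspend K : bimodHom (total (shift K)) (total K) :=
  dcopair (M := shift K) (fun n => dinj K (n + 1)).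

(* The n-fold tensor power of [1] with Koszul signs: the degree -1 map [1] at a given
   factor crosses all the factors to its left, so that x_1 (x) ... (x) x_n gets the sign
   (-1)^(sum_i (n - i) deg x_i). *)
Fixpoint suspend_pow K n : bimodHom (tpow (total K) n) (tpow (total (shift K)) n) :=
  match n return bimodHom (tpow (total K) n) (tpow (total (shift K)) n) with
  | 0 => hid (regular S)
  | n'.+1 => tmap (hcomp (suspend K) (koszul K n')) (suspend_pow K n')
  end.

(* 1^r (x) f (x) 1^t for f : K -> K^s of degree s - 2, with the Koszul sign for moving f
   past the first r factors. *)
Fixpoint insert K s (f : bimodHom (total K) (tpow (total K) s)) r t :
    bimodHom (tpow (total K) (r + 1 + t)) (tpow (total K) (r + s + t)) :=
  match r return bimodHom (tpow (total K) (r + 1 + t)) (tpow (total K) (r + s + t)) with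
  | 0 => hcomp (tmerge (total K) s t) (tmap f (hid (tpow (total K) t)))
  | r'.+1 => tmap (koszul K s) (insert f r' t)
  end.
End Graded.

(* The data of an A-infinity coalgebra; the operation of arity 0 plays no role. *)
Record ainfData (S : pzRingType) := AinfData {
  ainf_bimod :> int -> bimodType S;
  ainf_Delta : forall k, bimodHom (total ainf_bimod) (tpow (total ainf_bimod) k);
  ainf_locfin : forall x : total ainf_bimod,
    exists N, forall k, (N < k)%N -> ainf_Delta k x = 0
}.

Section Ainf.
Variables (S : pzRingType) (K : ainfData S).
Local Notation D := (@ainf_Delta S K).

Record is_ainf_coalgebra : Prop := IsAinfCoalgebra {
  ainf_degree : forall k (d : int) (x : K d),
    (0 < k)%N -> homog (d + k%:Z - 2) (D k (dinj K d x));
  (* all summands lie in K^n; the equation is stated in the direct sum of the K^m *)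
  ainf_relation : forall (n : nat) (x : total K), (0 < n)%N ->
    \sum_(r < n.+1) \sum_(s < n.+1) \sum_(t < n.+1 | (0 < s)%N && (r + s + t == n)%N)
      dinj (tpow (total K)) (r + s + t)%N (insert (D s) r t (D (r + 1 + t)%N x))
        *~ (-1) ^+ (r + s * t) = 0
}.
End Ainf.

(* A differential graded non-unital S-algebra, with internal grading and differential
   of degree -1. *)
Record dgaData (S : pzRingType) := DgaData {
  dga_bimod :> bimodType S;
  dga_mul : bimodHom (tensor dga_bimod dga_bimod) dga_bimod;
  dga_homog : int -> dga_bimod -> Prop;
  dga_diff : bimodHom dga_bimod dga_bimod
}.

Section Dga.
Variable S : pzRingType.
Implicit Types X Y : dgaData S.
Local Notation "x *[ X ] y" := (dga_mul X (pure x y)) (at level 40, format "x  *[ X ]  y").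

Record is_dga X : Prop := IsDga {
  dga_mulA : forall x y z : X, x *[X] (y *[X] z) = (x *[X] y) *[X] z;
  dga_homog0 : forall n, dga_homog (d := X) n 0;
  dga_homogD : forall n (x y : X),
    dga_homog n x -> dga_homog n y -> dga_homog n (x + y);
  dga_homogZ : forall n a (x : X), dga_homog n x -> dga_homog n (a *: x);
  dga_homogZr : forall n a (x : X), dga_homog n x -> dga_homog n (x *:r a);
  dga_span : forall x : X, exists (s : seq int) (c : int -> X),
    (forall n, dga_homog n (c n)) /\ x = \sum_(n <- s) c n;
  dga_direct : forall (s : seq int) (c : int -> X), uniq s ->
    (forall n, dga_homog n (c n)) -> \sum_(n <- s) c n = 0 ->
    forall n, n \in s -> c n = 0;
  dga_homogM : forall m n (x y : X),
    dga_homog m x -> dga_homog n y -> dga_homog (m + n) (x *[X] y);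
  dga_homog_diff : forall n (x : X), dga_homog n x -> dga_homog (n - 1) (dga_diff X x);
  dga_diff2 : forall x : X, dga_diff X (dga_diff X x) = 0;
  dga_leibniz : forall n (x y : X), dga_homog n x ->
    dga_diff X (x *[X] y) = dga_diff X x *[X] y + (x *[X] dga_diff X y) *~ (-1) ^+ `|n|%N
}.

Record is_dga_morphism X Y (f : bimodHom X Y) : Prop := IsDgaMorphism {
  dgam_mul : forall x y : X, f (x *[X] y) = f x *[Y] f y;
  dgam_homog : forall n x, dga_homog n x -> dga_homog n (f x);
  dgam_diff : forall x, f (dga_diff X x) = dga_diff Y (f x)
}.

Definition is_cycle X n (x : X) := dga_homog n x /\ dga_diff X x = 0.
Definition is_boundary X n (x : X) :=
  exists y : X, dga_homog (n + 1) y /\ dga_diff X y = x.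

(* f induces an injection and a surjection on homology in every degree. *)
Definition quasi_isomorphism X Y (f : bimodHom X Y) : Prop :=
  forall n,
    (forall x, is_cycle n x -> is_boundary n (f x) -> is_boundary n x) /\
    (forall y, is_cycle n y -> exists2 x, is_cycle n x & is_boundary n (f x - y)).
End Dga.

Section Cobar.
Variables (S : pzRingType) (K : ainfData S).
Local Notation K1 := (total (shift K)).

Lemma cobar_gen_subproof (x : K1) :
  finsupp (fun i => (- hcomp (suspend_pow K i.+1)
                        (hcomp (ainf_Delta K i.+1) (desuspend K))) x).
Proof.
have [N hN] := ainf_locfin (desuspend K x); exists (iota 0 N) => i.
rewrite mem_iota add0n -leqNgt => Ni.
by rewrite hoppE !hcompE hN // raddf0 oppr0.
Qed.

(* The components -[1]^n Delta_n [-1], n = i + 1. *)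
Definition cobar_gen : bimodHom K1 (Tplus K1) := dpair cobar_gen_subproof.

Definition cobar : dgaData S := {|
  dga_bimod := Tplus K1;
  dga_mul := Tplus_mul K1;
  dga_homog := fun d x => forall i, homog (n := i.+1) d (x i);
  dga_diff := leibniz_ext (koszul (shift K) 1) cobar_gen
|}.
End Cobar.

Section HomogIdeal.
Variables (S : pzRingType) (V : bimodType S).
Local Notation T := (Tplus V).
Local Notation "x *[T] y" := (Tplus_mul V (pure x y)) (at level 40).
Local Notation inT := (dinj (fun i => tpow V i.+1)).

(* R n stands for R_(n+2), a sub-bimodule of V^(n+2). The set hset R is
   (+)_(n >= 2) R_n inside T^+(V). *)
Definition hset (R : forall n, subbimod (tpow V n.+2)) : T -> Prop :=
  fun x => x 0%N = 0 /\ forall n, R n (x n.+1).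

Record homogIdeal := HomogIdeal {
  hpart : forall n, subbimod (tpow V n.+2);
  hidealMl : forall a x : T, hset hpart x -> hset hpart (a *[T] x);
  hidealMr : forall a x : T, hset hpart x -> hset hpart (x *[T] a)
}.

Variable I : homogIdeal.
Definition hcomponent (n : nat) : bimodType S := sub_of (hpart I n).

Local Lemma hset0 : hset (hpart I) 0.
Proof. by split=> // n; apply: sb0. Qed.
Local Lemma hsetD (x y : T) : hset (hpart I) x -> hset (hpart I) y -> hset (hpart I) (x + y).
Proof.
by move=> [x0 hx] [y0 hy]; split=> [|n]; rewrite dsumDE ?x0 ?y0 ?addr0 //; apply: sbD.
Qed.
Local Lemma hsetZ (a : S) (x : T) : hset (hpart I) x -> hset (hpart I) (a *: x).
Proof.
move=> [x0 hx]; split=> [|n]; last exact: (sbZ a (hx n)).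
by rewrite -[LHS]/(a *: x 0%N) x0 scaler0.
Qed.
Local Lemma hsetZr (a : S) (x : T) : hset (hpart I) x -> hset (hpart I) (x *:r a).
Proof.
move=> [x0 hx]; split=> [|n]; last exact: (sbZr a (hx n)).
by rewrite -[LHS]/(x 0%N *:r a) x0 rscale0r.
Qed.
Definition hideal : subbimod T := SubBimod hset0 hsetD hsetZ hsetZr.

Definition qalg : bimodType S := quot_by hideal.
Definition qalg_pi : bimodHom T qalg := quot_pi hideal.

Local Notation rep a := (repr (a : Quotient.quot (sb_zmod hideal)) : T).

Local Lemma qalg_piP (x y : T) : hideal (x - y) -> qalg_pi x = qalg_pi y.
Proof. by move=> h; apply/quot_eqP. Qed.
Local Lemma rep_piP (x : T) : hideal (rep (qalg_pi x) - x).
Proof. by apply/quot_eqP; rewrite quot_reprK. Qed.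
Local Lemma qalg_piK (q : qalg) : qalg_pi (rep q) = q.
Proof. exact: quot_reprK. Qed.

Local Lemma qmul_pi (x x' y y' : T) : qalg_pi x = qalg_pi x' -> qalg_pi y = qalg_pi y' ->
  qalg_pi (x *[T] y) = qalg_pi (x' *[T] y').
Proof.
move=> /quot_eqP hx /quot_eqP hy; apply: qalg_piP.
have -> : x *[T] y - x' *[T] y' = (x - x') *[T] y + x' *[T] (y - y').
  by rewrite pureDl pureDr pureNl pureNr !bhomD !raddfN /= addrA subrK.
by apply: hsetD; [apply: hidealMr | apply: hidealMl].
Qed.

Lemma qalg_mul_subproof :
  balanced (fun a b : qalg => qalg_pi (rep a *[T] rep b)).
Proof.
split=> [x x' y|x y y'|x a y|a x y|x y a].
- by rewrite -bhomD -bhomD -pureDl; apply: qmul_pi; rewrite ?bhomD !qalg_piK.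
- by rewrite -bhomD -bhomD -pureDr; apply: qmul_pi; rewrite ?bhomD !qalg_piK.
- rewrite (@qmul_pi _ (rep x *:r a) _ (rep y)) ?bhomZr ?qalg_piK //.
  rewrite pure_bal.
  by apply: qmul_pi; rewrite ?bhomZ ?qalg_piK.
- by rewrite -bhomZ -bhomZ pureZ; apply: qmul_pi; rewrite ?bhomZ !qalg_piK.
- by rewrite -bhomZr -bhomZr pureZr; apply: qmul_pi; rewrite ?bhomZr !qalg_piK.
Qed.
Definition qalg_mul : bimodHom (tensor qalg qalg) qalg :=
  tensor_lift qalg_mul_subproof.

Lemma qalg_pi_mul (x y : T) : qalg_pi (x *[T] y) = qalg_mul (pure (qalg_pi x) (qalg_pi y)).
Proof. rewrite [RHS]tensor_liftE; exact: (qmul_pi (esym (qalg_piK _)) (esym (qalg_piK _))). Qed.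

(* A, concentrated in degree 0. *)
Definition qalg_dga : dgaData S := {|
  dga_bimod := qalg;
  dga_mul := qalg_mul;
  dga_homog := fun d x => d = 0 \/ x = 0;
  dga_diff := 0
|}.

Definition hideal_incl n : bimodHom (hcomponent n) T :=
  hcomp (inT n.+1) (sub_incl (hpart I n)).

Local Lemma hset_inj n (r : hcomponent n) : hset (hpart I) (hideal_incl n r).
Proof.
rewrite /hideal_incl hcompE; split=> [|m]; first by rewrite dinj_out.
have [<-|nm] := eqVneq n m; first by rewrite dinj_in; apply: sub_valP.
by rewrite dinj_out ?eqSS //; apply: sb0.
Qed.

Local Lemma sum_closed (A : bimodType S) (P : subbimod A) (J : Type) (r : seq J) (F : J -> A) :
  (forall j, P (F j)) -> P (\sum_(j <- r) F j).
Proof.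
move=> h; elim: r => [|j r IH]; first by rewrite big_nil; apply: sb0.
by rewrite big_cons; apply: sbD.
Qed.

(* The product of T^+(V), restricted to V (x) R_(n+2) -> R_(n+3) and, below, to
   R_(n+2) (x) V -> R_(n+3). Taking the component of index n + 2 loses nothing, as the
   product lies in V^(n+3). *)
Lemma hmull_subproof n (t : tensor V (hcomponent n)) :
  hpart I n.+1 (hcomp (dproj (fun i => tpow V i.+1) n.+2)
    (hcomp (Tplus_mul V) (tmap (Tplus_gen V) (hideal_incl n))) t).
Proof.
have [s ->] := tensorP t; rewrite raddf_sum; apply: sum_closed => p.
rewrite /= !hcompE [X in Tplus_mul _ X]tensor_liftE.
by have [_ h] := hidealMl (Tplus_gen V p.1) (hset_inj p.2); apply: h.
Qed.
Definition hmull n : bimodHom (tensor V (hcomponent n)) (hcomponent n.+1) :=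
  corestrict (@hmull_subproof n).

Lemma hmulr_subproof n (t : tensor (hcomponent n) V) :
  hpart I n.+1 (hcomp (dproj (fun i => tpow V i.+1) n.+2)
    (hcomp (Tplus_mul V) (tmap (hideal_incl n) (Tplus_gen V))) t).
Proof.
have [s ->] := tensorP t; rewrite raddf_sum; apply: sum_closed => p.
rewrite /= !hcompE [X in Tplus_mul _ X]tensor_liftE.
by have [_ h] := hidealMr (Tplus_gen V p.2) (hset_inj p.1); apply: h.
Qed.
Definition hmulr n : bimodHom (tensor (hcomponent n) V) (hcomponent n.+1) :=
  corestrict (@hmulr_subproof n).

(* The external direct sum of the R_n, with multiplication by V on either side. *)
Definition hsum : bimodType S := dsum hcomponent.
Definition hsum_mull : bimodHom (tensor V hsum) hsum :=
  dcopairr (fun n => hcomp (dinj hcomponent n.+1) (hmull n)).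
Definition hsum_mulr : bimodHom (tensor hsum V) hsum :=
  dcopairl (fun n => hcomp (dinj hcomponent n.+1) (hmulr n)).
End HomogIdeal.

(* brk b1 b2 bs is the bracketing [b1 b2 bs], with at least two branches. *)
Inductive bracketing : Type :=
| inp
| brk of bracketing & bracketing & seq bracketing.

HB.instance Definition _ := gen_eqMixin bracketing.
HB.instance Definition _ := gen_choiceMixin bracketing.

Definition is_inp b := if b is inp then true else false.

Fixpoint nbrk b : nat :=
  if b is brk b1 b2 bs then (sumn (map nbrk [:: b1, b2 & bs])).+1 else 0.

(* facR n stands for R_(n+2), the factor of an innermost bracket with n + 2 inputs. *)
Inductive factor : Type := facV | facR of nat.

Fixpoint factors b : seq factor :=
  match b with
  | inp => [:: facV]
  | brk b1 b2 bs =>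
      if all is_inp [:: b1, b2 & bs] then [:: facR (size bs)]
      else flatten (map factors [:: b1, b2 & bs])
  end.

(* The suffix F marks the extension to forests, i.e. to products of bracketings. *)
Definition factorsF (F : seq bracketing) : seq factor := flatten (map factors F).

Section BInfinity.
Variables (S : pzRingType) (V : bimodType S) (I : homogIdeal V).

Definition facobj (c : factor) : bimodType S :=
  match c with facV => V | facR n => hcomponent I n end.

Fixpoint word (l : seq factor) : bimodType S :=
  if l is c :: l' then tensor (facobj c) (word l') else regular S.

Arguments word : simpl never.

Fixpoint word_merge l1 l2 : bimodHom (tensor (word l1) (word l2)) (word (l1 ++ l2)) :=
  match l1 return bimodHom (tensor (word l1) (word l2)) (word (l1 ++ l2)) with
  | [::] => unitl (word l2)
  | c :: l => hcomp (tmap (hid (facobj c)) (word_merge l l2))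
                    (tassoc (facobj c) (word l) (word l2))
  end.
Fixpoint word_split l1 l2 : bimodHom (word (l1 ++ l2)) (tensor (word l1) (word l2)) :=
  match l1 return bimodHom (word (l1 ++ l2)) (tensor (word l1) (word l2)) with
  | [::] => unitl_inv (word l2)
  | c :: l => hcomp (tassoc_inv (facobj c) (word l) (word l2))
                    (tmap (hid (facobj c)) (word_split l l2))
  end.
Definition word_cast l1 l2 (e : l1 = l2) : bimodHom (word l1) (word l2) :=
  ecast l (bimodHom (word l1) (word l)) e (hid (word l1)).

(* (V,I)^b *)
Definition Bword b : bimodType S := word (factors b).
Definition BwordF F : bimodType S := word (factorsF F).

Definition bracketings_of (d : int) : choiceType :=
  {b : bracketing | (nbrk b).+1%:Z == d}.

Definition Binf_bimod (d : int) : bimodType S :=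
  dsum (fun b : bracketings_of d => Bword (sval b)).
Local Notation K := Binf_bimod.

Definition Binf_inj b : bimodHom (Bword b) (total K) :=
  hcomp (dinj K (nbrk b).+1%:Z)
    (dinj (fun b' : bracketings_of (nbrk b).+1%:Z => Bword (sval b'))
          (exist _ b (eqxx _))).

Definition Binf_copair N (f : forall b, bimodHom (Bword b) N) : bimodHom (total K) N :=
  dcopair (fun d => dcopair (fun b : bracketings_of d => f (sval b))).

(* The identification of V^n with n inputs; 0 on other forests, where it is not used. *)
Fixpoint inputs_word F : bimodHom (tpow V (size F)) (BwordF F) :=
  match F return bimodHom (tpow V (size F)) (BwordF F) with
  | [::] => hid (regular S)
  | inp :: F' => tmap (hid V) (inputs_word F')
  | brk _ _ _ :: F' => 0
  end.

(* Removal of the outer bracket: the inclusion of R_n in V^n if it is innermost, the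
   tautological identity otherwise. *)
Definition open_bracket b1 b2 bs :
    bimodHom (Bword (brk b1 b2 bs)) (BwordF [:: b1, b2 & bs]) :=
  match all is_inp [:: b1, b2 & bs] as i
    return bimodHom
      (word (if i then [:: facR (size bs)]
             else factorsF [:: b1, b2 & bs]))
      (BwordF [:: b1, b2 & bs])
  with
  | true => hcomp (inputs_word [:: b1, b2 & bs])
              (hcomp (sub_incl (hpart I (size bs))) (unitr (hcomponent I (size bs))))
  | false => hid _
  end.

(* For F = inp^a [inp^n] inp^b, absorb F is the multiplication
   V^a (x) R_n (x) V^b -> R_(n+a+b). It is not used on other forests. *)
Fixpoint absorb_right F : bimodHom (tensor (hsum I) (BwordF F)) (hsum I) :=
  match F return bimodHom (tensor (hsum I) (BwordF F)) (hsum I) with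
  | [::] => unitr (hsum I)
  | inp :: F' => hcomp (absorb_right F')
      (hcomp (tmap (hsum_mulr I) (hid (BwordF F')))
             (tassoc_inv (hsum I) V (BwordF F')))
  | brk _ _ _ :: F' => 0
  end.

Fixpoint absorb F : bimodHom (BwordF F) (hsum I) :=
  match F return bimodHom (BwordF F) (hsum I) with
  | [::] => 0
  | inp :: F' => hcomp (hsum_mull I) (tmap (hid V) (absorb F'))
  | brk b1 b2 bs :: F' =>
      match all is_inp [:: b1, b2 & bs] as i
        return bimodHom
          (word ((if i then [:: facR (size bs)]
                  else factorsF [:: b1, b2 & bs])
                 ++ factorsF F'))
          (hsum I)
      with
      | true => hcomp (absorb_right F')
                  (tmap (dinj (hcomponent I) (size bs)) (hid (BwordF F')))
      | false => 0
      end
  end.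

(* The results of removing one bracket pair from a bracketing or from a forest with
   factors l, each with the map that it induces. *)
Record bremoval (l : seq factor) := BRemoval {
  brem_to : bracketing;
  brem_map : bimodHom (word l) (Bword brem_to)
}.
Record fremoval (l : seq factor) := FRemoval {
  frem_to : seq bracketing;
  frem_map : bimodHom (word l) (BwordF frem_to)
}.

(* The removed pair lies in F, lies inside b, or is the outer pair of the first tree. *)
Definition frem_tail b F (r : fremoval (factorsF F)) : fremoval (factorsF (b :: F)) :=
  @FRemoval (factorsF (b :: F)) (b :: frem_to r)
    (hcomp (word_merge (factors b) (factorsF (frem_to r)))
       (hcomp (tmap (hid (Bword b)) (frem_map r)) (word_split (factors b) (factorsF F)))).

Definition frem_head b F (r : bremoval (factors b)) : fremoval (factorsF (b :: F)) :=
  @FRemoval (factorsF (b :: F)) (brem_to r :: F)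
    (hcomp (word_merge (factors (brem_to r)) (factorsF F))
       (hcomp (tmap (brem_map r) (hid (BwordF F))) (word_split (factors b) (factorsF F)))).

Lemma factorsF_cat F1 F2 : factorsF F1 ++ factorsF F2 = factorsF (F1 ++ F2).
Proof. by rewrite /factorsF map_cat flatten_cat. Qed.

Definition frem_open b1 b2 bs F : fremoval (factorsF (brk b1 b2 bs :: F)) :=
  @FRemoval (factorsF (brk b1 b2 bs :: F)) ([:: b1, b2 & bs] ++ F)
    (hcomp (word_cast (factorsF_cat [:: b1, b2 & bs] F))
    (hcomp (word_merge (factorsF [:: b1, b2 & bs]) (factorsF F))
    (hcomp (tmap (open_bracket b1 b2 bs) (hid (BwordF F)))
           (word_split (factors (brk b1 b2 bs)) (factorsF F))))).

(* g is induced by the removal of a pair of brackets from the content F of a bracket.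
   If only inputs remain, then F = inp^a [inp^n] inp^b and the multiplication into
   R_(n+a+b) replaces the inclusion of R_n in V^n. *)
Definition close_map F c1 c2 cs (g : bimodHom (BwordF F) (BwordF [:: c1, c2 & cs])) :
    bimodHom (BwordF F) (Bword (brk c1 c2 cs)) :=
  match all is_inp [:: c1, c2 & cs] as i
    return bimodHom (BwordF F)
      (word (if i then [:: facR (size cs)]
             else factorsF [:: c1, c2 & cs]))
  with
  | true => hcomp (unitr_inv (hcomponent I (size cs)))
              (hcomp (dproj (hcomponent I) (size cs)) (absorb F))
  | false => g
  end.

(* The content of a bracket keeps at least two branches (frem_size below), and there is
   no pair to remove in a content of inputs only, so the values 0 are never taken. *)
Definition brem_close b1 b2 bs (r : fremoval (factorsF [:: b1, b2 & bs])) :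
    bremoval (factors (brk b1 b2 bs)) :=
  let: FRemoval F' g := r in
  match F' return bimodHom (BwordF [:: b1, b2 & bs]) (BwordF F') ->
                  bremoval (factors (brk b1 b2 bs)) with
  | [:: c1, c2 & cs] => fun g =>
      @BRemoval (factors (brk b1 b2 bs)) (brk c1 c2 cs)
        (match all is_inp [:: b1, b2 & bs] as i
           return bimodHom
             (word (if i then [:: facR (size bs)]
                    else factorsF [:: b1, b2 & bs]))
             (Bword (brk c1 c2 cs))
         with
         | true => 0
         | false => close_map g
         end)
  | _ => fun _ => @BRemoval (factors (brk b1 b2 bs)) inp 0
  end g.

(* All removals, in the order of the left brackets. *)
Definition frem_with (brem : forall b, seq (bremoval (factors b))) :=
  fix frem F : seq (fremoval (factorsF F)) :=
    match F with
    | [::] => [::]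
    | b :: F' =>
        match b with inp => [::] | brk b1 b2 bs => [:: frem_open b1 b2 bs F'] end
        ++ [seq frem_head F' r | r <- brem b] ++ [seq frem_tail b r | r <- frem F']
    end.

(* The removals of the internal brackets of b, in the order of the left brackets. *)
Fixpoint brem b : seq (bremoval (factors b)) :=
  match b with
  | inp => [::]
  | brk b1 b2 bs => [seq brem_close r | r <- frem_with brem [:: b1, b2 & bs]]
  end.


Lemma frem_size (f : forall b, seq (bremoval (factors b))) F :
  all (fun r => size F <= size (frem_to r))%N (frem_with f F).
Proof.
elim: F => [|b F IH] //=; rewrite !all_cat; apply/and3P; split.
- case: b => [|b1 b2 bs] //=; rewrite andbT size_cat.
  by rewrite !ltnS (leq_trans (leq_addl (size bs) _)) // leqW.
- by rewrite all_map; elim: (f b) => //= r s ->; rewrite leqnn.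
- by rewrite all_map; apply: sub_all IH.
Qed.

(* (V,I)^[b_1 ... b_k] -> (V,I)^b_1 (x) ... (x) (V,I)^b_k *)
Fixpoint regroup F : bimodHom (BwordF F) (tpow (total K) (size F)) :=
  match F return bimodHom (BwordF F) (tpow (total K) (size F)) with
  | [::] => hid (regular S)
  | b :: F' => hcomp (tmap (Binf_inj b) (regroup F'))
                     (word_split (factors b) (factorsF F'))
  end.

(* sum_i (k - i) d_i *)
Fixpoint split_sign F : nat :=
  if F is b :: F' then (size F' * (nbrk b).+1 + split_sign F')%N else 0%N.

(* The list brem b is numbered from 0: its entry number m is the removal of the internal
   pair number m + 1. *)
Definition Binf_Delta1 b : bimodHom (Bword b) (total K) :=
  \sum_(p <- zip (iota 0 (size (brem b))) (brem b))
     hcomp (Binf_inj (brem_to p.2)) (brem_map p.2) *~ (-1) ^+ p.1.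

(* dproj k after dinj n is the identity if k = n, and 0 otherwise. *)
Definition Binf_split k b : bimodHom (Bword b) (tpow (total K) k) :=
  match b return bimodHom (Bword b) (tpow (total K) k) with
  | inp => 0
  | brk b1 b2 bs =>
      - hcomp (dproj (tpow (total K)) k)
          (hcomp (dinj (tpow (total K)) (size [:: b1, b2 & bs]))
             (hcomp (regroup [:: b1, b2 & bs]) (open_bracket b1 b2 bs)))
        *~ (-1) ^+ split_sign [:: b1, b2 & bs]
  end.

Definition Binf_Delta k : bimodHom (total K) (tpow (total K) k) :=
  match k return bimodHom (total K) (tpow (total K) k) with
  | 0 => 0
  | 1 => hcomp (unitr_inv (total K)) (Binf_copair Binf_Delta1)
  | k'.+2 => Binf_copair (Binf_split k'.+2)
  end.

Lemma hsgnE (M N : bimodType S) (f : bimodHom M N) (n : int) x : (f *~ n) x = f x *~ n.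
Proof.
have E k : (f *+ k) x = f x *+ k.
  by elim: k => [|k IH]; rewrite ?mulr0n ?hzeroE // !mulrS haddE IH.
by case: n => n; rewrite ?NegzE ?mulrNz ?hoppE /intmul E.
Qed.

Lemma Binf_copair_inj N (f : forall b, bimodHom (Bword b) N) b (w : Bword b) :
  Binf_copair f (Binf_inj b w) = f b w.
Proof.
rewrite /Binf_copair /Binf_inj hcompE.
rewrite dcopair_inj.
exact: (dcopair_inj (fun b' : bracketings_of (nbrk b).+1%:Z => f (sval b'))
          (i := exist _ b (eqxx _)) w).
Qed.

Lemma total_ind (P : total K -> Prop) :
  P 0 -> (forall x y, P x -> P y -> P (x + y)) ->
  (forall b (w : Bword b), P (Binf_inj b w)) -> forall x, P x.
Proof.
move=> P0 PD Pi x.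
have Psum (J : Type) (r : seq J) (F : J -> total K) :
    (forall j, P (F j)) -> P (\sum_(j <- r) F j).
  move=> h; elim: r => [|j r IH]; first by rewrite big_nil.
  by rewrite big_cons; apply: PD.
rewrite (dsum_recompose x); apply: (Psum) => d.
rewrite [x d](@dsum_recompose _ (bracketings_of d)) raddf_sum; apply: (Psum) => b.
case: b (dsum_fun _ _) => b db w; have e := eqP db; subst d.
have -> : db = eqxx _ by apply: bool_irrelevance.
by have := Pi b w; rewrite /Binf_inj hcompE.
Qed.

Lemma Binf_locfin (x : total K) :
  exists N, forall k, (N < k)%N -> Binf_Delta k x = 0.
Proof.
elim/total_ind: x => [|x y [m hm] [n hn]|b w].
- by exists 0%N => k _; rewrite raddf0.
- exists (maxn m n) => k; rewrite gtn_max => /andP[mk nk].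
  by rewrite bhomD hm // hn // addr0.
- exists (size (if b is brk b1 b2 bs then [:: b1, b2 & bs] else [::])).+1 => -[|[|k]] // hk.
  rewrite /Binf_Delta Binf_copair_inj; case: b w hk => [|b1 b2 bs] w hk; first by rewrite /= hzeroE.
  rewrite /Binf_split hsgnE hoppE !hcompE dproj_inj_out ?oppr0 ?mul0rz //.
  by rewrite neq_ltn (ltn_trans _ hk).
Qed.

Definition Binf : ainfData S := AinfData Binf_locfin.

(* V = (V,I)^inp as the degree 0 part of B[1]. *)
Definition deg0_incl : bimodHom V (total (shift K)) :=
  hcomp (suspend K) (hcomp (Binf_inj inp) (unitr_inv V)).
End BInfinity.

(* Main.v *)
(** The cobar construction is spanned by words indexed by non-empty forests of bracketings,
    and its differential is the alternating sum of the removals of one bracket pair. Let h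
    enclose a forest of at least two trees, not all of them inputs, in an outer bracket, and
    let h vanish on the other words. As d [F] = F - [d F], the map 1 - d h - h d kills every
    word except that it fixes inputs^n and the innermost bracket [inputs^n], and sends
    inputs^a [inputs^n] inputs^b to [inputs^(a+n+b)] by the multiplication of the ideal. What
    remains is R_n -> V^n, which is injective, so the homology is V^n / R_n in degree 0; no
    flatness is needed.

    That d squares to 0 follows by induction on forests from d [F] = F - [d F], again by
    the injectivity of R_n -> V^n when only inputs remain. For any coalgebra, the component n
    of d^2 on a generator is the suspension of the n-th A-infinity relation, so that the
    relations of B follow from d^2 = 0. *)

Require Import Defs.
From mathcomp Require Import all_boot all_order all_algebra.
From mathcomp Require Import boolp.

Set Implicit Arguments.
Unset Strict Implicit.
Unset Printing Implicit Defensive.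

Import GRing.Theory.
Local Open Scope ring_scope.

(** Two constraints shape the proof. The bimodules are arbitrary and tensoring does not preserve
    injections, so between tensor powers injectivity always comes from an explicit left inverse; the
    inclusion R_n -> V^n, which has none, is only ever used untensored.

    Moreover, enclosing a forest F does not quite commute with removing pairs. If F has a single
    pair, removing it inside [F] multiplies in the ideal, while removing it from F leaves inputs, on
    which h vanishes. So there are two enclosing maps: [cbr], which defines h, and [kmap], which
    describes the removals inside a bracket. They agree once F has two pairs, and their difference
    for one pair is what 1 - d h - h d leaves of such a forest. For a cycle this leaves v + [r] with
    v a word of inputs and r in the ideal; its differential is the image of r in V^n, so r = 0, and
    conversely every r is the boundary of [r]. *)

Arguments tpow : simpl never.
Arguments word : simpl never.

(** * Values of the basic bimodule maps on generators *)

Section Evaluation.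
Variable S : pzRingType.
Implicit Types M N P : bimodType S.

Lemma bhom0 M N (f : bimodHom M N) : f 0 = 0.
Proof. exact: raddf0. Qed.

Lemma bhomN M N (f : bimodHom M N) x : f (- x) = - f x.
Proof. exact: raddfN. Qed.

Lemma bhomB M N (f : bimodHom M N) x y : f (x - y) = f x - f y.
Proof. exact: raddfB. Qed.

Lemma bhomMz M N (f : bimodHom M N) x (z : int) : f (x *~ z) = f x *~ z.
Proof. exact: raddfMz. Qed.

Lemma bhom_sum M N (f : bimodHom M N) J (r : seq J) (P : pred J) (F : J -> M) :
  f (\sum_(j <- r | P j) F j) = \sum_(j <- r | P j) f (F j).
Proof. exact: raddf_sum. Qed.

Lemma tmapE M M' N N' (f : bimodHom M M') (g : bimodHom N N') x y :
  tmap f g (pure x y) = pure (f x) (g y).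
Proof. exact: tensor_liftE. Qed.

Lemma unitl_pure M (a : regular S) (x : M) : unitl M (pure a x) = (a : S) *: x.
Proof. exact: tensor_liftE. Qed.

Lemma unitr_pure M (x : M) (a : regular S) : unitr M (pure x a) = x *:r (a : S).
Proof. exact: tensor_liftE. Qed.

Lemma unitl_invE M (x : M) : unitl_inv M x = pure (1 : regular S) x.
Proof. by rewrite /unitl_inv; case: unitl_inv_subproof. Qed.

Lemma unitr_invE M (x : M) : unitr_inv M x = pure x (1 : regular S).
Proof. by rewrite /unitr_inv; case: unitr_inv_subproof. Qed.

Lemma pure_scalel M (a : regular S) (x : M) :
  pure a x = pure (1 : regular S) ((a : S) *: x).
Proof. by rewrite -pure_bal; congr pure; rewrite /rscale /= mul1r. Qed.

Lemma pure_scaler M (x : M) (a : regular S) :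
  pure x a = pure (x *:r (a : S)) (1 : regular S).
Proof. by rewrite pure_bal; congr pure; rewrite /GRing.scale /= mulr1. Qed.

Lemma tensor_ind M N (P : tensor M N -> Prop) :
  P 0 -> (forall t u, P t -> P u -> P (t + u)) -> (forall x y, P (pure x y)) ->
  forall t, P t.
Proof.
move=> P0 PD Pp t; have [s ->] := tensorP t.
elim: s => [|p s IH]; first by rewrite big_nil.
by rewrite big_cons; apply: PD.
Qed.

Lemma dsum_ind (J : choiceType) (M : J -> bimodType S) (P : dsum M -> Prop) :
  P 0 -> (forall t u, P t -> P u -> P (t + u)) -> (forall j x, P (dinj M j x)) ->
  forall t, P t.
Proof.
move=> P0 PD Pj t; rewrite (dsum_recompose t).
elim: (dsupp t) => [|j s IH]; first by rewrite big_nil.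
by rewrite big_cons; apply: PD.
Qed.

Lemma dcopairlE (J : choiceType) (M : J -> bimodType S) N P
    (f : forall j, bimodHom (tensor (M j) N) P) j x y :
  dcopairl f (pure (dinj M j x) y) = f j (pure x y).
Proof.
rewrite tensor_liftE; apply: (dlift_inj (f := fun j xj => f j (pure xj y))) => k u v.
by rewrite pureDl bhomD.
Qed.

Lemma dcopairrE (J : choiceType) (M : J -> bimodType S) N P
    (f : forall j, bimodHom (tensor N (M j)) P) j x y :
  dcopairr f (pure y (dinj M j x)) = f j (pure y x).
Proof.
rewrite tensor_liftE; apply: (dlift_inj (f := fun j xj => f j (pure y xj))) => k u v.
by rewrite pureDr bhomD.
Qed.

Lemma dcopair_comp (J : choiceType) (M M' : J -> bimodType S)
    (f : forall j, bimodHom (M j) (M' j)) x j :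
  dcopair (fun j => hcomp (dinj M' j) (f j)) x j = f j (x j).
Proof.
elim/dsum_ind: x => [|x y IHx IHy|k x].
- by rewrite bhom0 [RHS]bhom0.
- by rewrite bhomD !dsumDE IHx IHy raddfD.
- rewrite dcopair_inj hcompE; have [kj|kj] := eqVneq k j.
    by subst k; rewrite !dinj_in.
  by rewrite !dinj_out ?bhom0.
Qed.
End Evaluation.

(** * The unital tensor algebra and its twisted derivations *)

Section TensorAlgebra.
Variable S : pzRingType.
Implicit Types M N : bimodType S.

(* The unital tensor algebra: it makes the empty product available, which T^+ lacks. *)
Definition talg M : bimodType S := dsum (tpow M).

Definition tcons M : bimodHom (tensor M (talg M)) (talg M) :=
  dcopairr (fun n => dinj (tpow M) n.+1).

Definition tmul M : bimodHom (tensor (talg M) (talg M)) (talg M) :=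
  dcopairl (fun i => dcopairr (fun j => hcomp (dinj (tpow M) (i + j)%N) (tmerge M i j))).

Definition tinc M : bimodHom (Tplus M) (talg M) :=
  dcopair (fun i => dinj (tpow M) i.+1).

Definition tgen M : bimodHom M (talg M) := hcomp (dinj (tpow M) 1%N) (unitr_inv M).

Definition talg_map M N (f : bimodHom M N) : bimodHom (talg M) (talg N) :=
  dcopair (fun i => hcomp (dinj (tpow N) i) (tpow_map f i)).

Local Notation "x ** y" := (tmul _ (pure x y)) (at level 40, left associativity).

Lemma tconsE M n (x : M) (t : tpow M n) :
  tcons M (pure x (dinj (tpow M) n t)) = dinj (tpow M) n.+1 (pure x t).
Proof. exact: dcopairrE. Qed.

Lemma tmulE M i j (t : tpow M i) (u : tpow M j) :
  dinj (tpow M) i t ** dinj (tpow M) j u = dinj (tpow M) (i + j)%N (tmerge M i j (pure t u)).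
Proof. by rewrite /tmul dcopairlE dcopairrE hcompE. Qed.

Lemma tincE M i (t : tpow M i.+1) :
  tinc M (dinj (fun i => tpow M i.+1) i t) = dinj (tpow M) i.+1 t.
Proof. exact: dcopair_inj. Qed.

Lemma tgenE M (x : M) : tgen M x = tcons M (pure x (dinj (tpow M) 0%N (1 : regular S))).
Proof. by rewrite /tgen hcompE unitr_invE tconsE. Qed.

Lemma tinc_comp M (t : Tplus M) i : tinc M t i.+1 = t i.
Proof.
elim/dsum_ind: t => [|x y IHx IHy|k x].
- by rewrite bhom0.
- by rewrite bhomD !dsumDE IHx IHy.
- rewrite tincE; have [kj|kj] := eqVneq k i.
    by subst k; rewrite !dinj_in.
  by rewrite !dinj_out ?eqSS.
Qed.

Lemma tinc_comp0 M (t : Tplus M) : tinc M t 0%N = 0.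
Proof.
elim/dsum_ind: t => [|x y IHx IHy|k x].
- by rewrite bhom0.
- by rewrite bhomD !dsumDE IHx IHy addr0.
- by rewrite tincE dinj_out.
Qed.

(** Identities in [Tplus] are proved in [talg], where words are built from scalars by [tcons], and
    pulled back along this injection. *)
Lemma tinc_inj M : injective (tinc M).
Proof. by move=> x y exy; apply: dsum_ext => i; rewrite -!tinc_comp exy. Qed.

Lemma tinc_gen M (x : M) : tinc M (Tplus_gen M x) = tgen M x.
Proof. by rewrite /Tplus_gen /tgen !hcompE tincE. Qed.

Lemma talg_ind M (P : talg M -> Prop) :
  P 0 -> (forall t u, P t -> P u -> P (t + u)) ->
  (forall a, P (dinj (tpow M) 0%N a)) ->
  (forall x t, P t -> P (tcons M (pure x t))) -> forall t, P t.
Proof.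
move=> P0 PD Pa Pc; elim/dsum_ind => // n.
elim: n => [|n IH] // t; elim/tensor_ind: t => [|t u Pt Pu|x t].
- by rewrite bhom0.
- by rewrite raddfD; apply: PD.
- by rewrite -tconsE; apply: Pc.
Qed.

Lemma tmul_scal M (a : regular S) (t : talg M) : dinj (tpow M) 0%N a ** t = (a : S) *: t.
Proof.
elim/dsum_ind: t => [|t u Pt Pu|n t].
- by rewrite pure0r bhom0 scaler0.
- by rewrite pureDr bhomD Pt Pu scalerDr.
- by rewrite tmulE /= unitl_pure bhomZ.
Qed.

Lemma tmul_cons M (x : M) (t u : talg M) :
  tcons M (pure x t) ** u = tcons M (pure x (t ** u)).
Proof.
elim/dsum_ind: t => [|t t' Pt Pt'|n t].
- by rewrite !(pure0l, pure0r, bhom0).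
- by rewrite !(pureDl, pureDr, bhomD) Pt Pt'.
elim/dsum_ind: u => [|u u' Pu Pu'|m u].
- by rewrite !(pure0l, pure0r, bhom0).
- by rewrite !(pureDl, pureDr, bhomD) Pu Pu'.
- by rewrite tconsE !tmulE tconsE /= hcompE tassocE tmapE.
Qed.

Lemma tgen_mul M (x : M) (t : talg M) : tgen M x ** t = tcons M (pure x t).
Proof. by rewrite tgenE tmul_cons tmul_scal scale1r. Qed.

(** In the direct sum no cast between the powers (i + j) + k and i + (j + k) is needed. *)
Lemma tmulA M (x y z : talg M) : x ** (y ** z) = (x ** y) ** z.
Proof.
elim/talg_ind: x => [|x x' IH IH'|a|v x IH].
- by rewrite !(pure0l, bhom0).
- by rewrite !(pureDl, bhomD) IH IH'.
- by rewrite !tmul_scal -pureZ bhomZ.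
- by rewrite !tmul_cons IH.
Qed.

Lemma tmulr1 M (x : talg M) : x ** dinj (tpow M) 0%N (1 : regular S) = x.
Proof.
elim/talg_ind: x => [|x x' IH IH'|a|v x IH].
- by rewrite !(pure0l, bhom0).
- by rewrite !(pureDl, bhomD) IH IH'.
- by rewrite tmul_scal -bhomZ; congr (dinj _ _ _); rewrite /GRing.scale /= mulr1.
- by rewrite tmul_cons IH.
Qed.

Lemma tinc_mul M (x y : Tplus M) : tinc M (Tplus_mul M (pure x y)) = tinc M x ** tinc M y.
Proof.
elim/dsum_ind: x => [|x x' IH IH'|i x].
- by rewrite !(pure0l, bhom0).
- by rewrite !(pureDl, bhomD) IH IH'.
elim/dsum_ind: y => [|y y' IH IH'|j y].
- by rewrite !(pure0r, bhom0).
- by rewrite !(pureDr, bhomD) IH IH'.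
- by rewrite /Tplus_mul dcopairlE dcopairrE hcompE !tincE tmulE.
Qed.

Lemma tinc_rmul M n (x : Tplus M) (t : tpow M n) :
  tinc M (Tplus_rmul M n (pure x t)) = tinc M x ** dinj (tpow M) n t.
Proof.
elim/dsum_ind: x => [|x x' IH IH'|i x].
- by rewrite !(pure0l, bhom0).
- by rewrite !(pureDl, bhomD) IH IH'.
- by rewrite /Tplus_rmul dcopairlE hcompE !tincE tmulE.
Qed.

Lemma tinc_cons M (x : M) (t : Tplus M) :
  tinc M (Tplus_cons M (pure x t)) = tcons M (pure x (tinc M t)).
Proof.
elim/dsum_ind: t => [|t t' IH IH'|i t].
- by rewrite !(pure0r, bhom0).
- by rewrite !(pureDr, bhomD) IH IH'.
- by rewrite /Tplus_cons dcopairrE [in RHS]tincE tconsE (@tincE _ i.+1).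
Qed.

Lemma talg_map_scal M N (f : bimodHom M N) (a : regular S) :
  talg_map f (dinj (tpow M) 0%N a) = dinj (tpow N) 0%N a.
Proof. by rewrite /talg_map dcopair_inj hcompE. Qed.

Lemma talg_map_cons M N (f : bimodHom M N) x t :
  talg_map f (tcons M (pure x t)) = tcons N (pure (f x) (talg_map f t)).
Proof.
elim/dsum_ind: t => [|t t' IH IH'|i t].
- by rewrite !(pure0r, bhom0).
- by rewrite !(pureDr, bhomD) IH IH'.
- by rewrite tconsE /talg_map !dcopair_inj !hcompE tconsE /= tmapE.
Qed.

Lemma talg_map_gen M N (f : bimodHom M N) x : talg_map f (tgen M x) = tgen N (f x).
Proof. by rewrite !tgenE talg_map_cons talg_map_scal. Qed.

Lemma talg_map_mul M N (f : bimodHom M N) x y :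
  talg_map f (x ** y) = talg_map f x ** talg_map f y.
Proof.
elim/talg_ind: x => [|x x' IH IH'|a|v x IH].
- by rewrite pure0l !bhom0 pure0l bhom0.
- by rewrite !(pureDl, bhomD) IH IH'.
- by rewrite talg_map_scal !tmul_scal bhomZ.
- by rewrite tmul_cons !talg_map_cons tmul_cons IH.
Qed.

Lemma talg_map_comp M N P (f : bimodHom M N) (g : bimodHom N P) x :
  talg_map g (talg_map f x) = talg_map (hcomp g f) x.
Proof.
elim/talg_ind: x => [|x x' IH IH'|a|v x IH].
- by rewrite !bhom0.
- by rewrite !bhomD IH IH'.
- by rewrite !talg_map_scal.
- by rewrite !talg_map_cons IH hcompE.
Qed.

Lemma talg_map_id M (f : bimodHom M M) x : f =1 id -> talg_map f x = x.
Proof.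
move=> fid; elim/talg_ind: x => [|x x' IH IH'|a|v x IH].
- by rewrite !bhom0.
- by rewrite !bhomD IH IH'.
- by rewrite !talg_map_scal.
- by rewrite !talg_map_cons IH fid.
Qed.

Lemma tinc_map M N (f : bimodHom M N) t : tinc N (Tplus_map f t) = talg_map f (tinc M t).
Proof.
elim/dsum_ind: t => [|t t' IH IH'|i t].
- by rewrite !bhom0.
- by rewrite !bhomD IH IH'.
- by rewrite /Tplus_map dcopair_inj hcompE !tincE /talg_map dcopair_inj hcompE.
Qed.

Section Derivation.
Variables (M : bimodType S) (eps : bimodHom M M) (delta : bimodHom M (Tplus M)).

Fixpoint tder_pow n : bimodHom (tpow M n) (talg M) :=
  match n return bimodHom (tpow M n) (talg M) with
  | 0 => 0
  | n'.+1 => hcomp (tmul M) (tmap (hcomp (tinc M) delta) (dinj (tpow M) n'))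
           + hcomp (tcons M) (tmap eps (tder_pow n'))
  end.
Definition tder : bimodHom (talg M) (talg M) := dcopair tder_pow.

Lemma tder_scal a : tder (dinj (tpow M) 0%N a) = 0.
Proof. by rewrite /tder dcopair_inj /= hzeroE. Qed.

Lemma tder_cons x t :
  tder (tcons M (pure x t)) = tinc M (delta x) ** t + tcons M (pure (eps x) (tder t)).
Proof.
elim/dsum_ind: t => [|t t' IH IH'|i t].
- by rewrite !(pure0r, bhom0) addr0.
- by rewrite !(pureDr, bhomD) IH IH' addrACA.
- by rewrite tconsE /tder !dcopair_inj /= haddE !hcompE !tmapE !hcompE.
Qed.

Lemma tder_gen x : tder (tgen M x) = tinc M (delta x).
Proof. by rewrite tgenE tder_cons tder_scal !(pure0r, bhom0) addr0 tmulr1. Qed.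

(** The sign of the graded Leibniz rule is carried by the endomorphism [eps], so the rule holds for
    all x, homogeneous or not. On homogeneous x, [talg_koszul] turns it into the usual sign. *)
Lemma tder_mul x y : tder (x ** y) = tder x ** y + talg_map eps x ** tder y.
Proof.
elim/talg_ind: x => [|x x' IH IH'|a|v x IH].
- by rewrite !(pure0l, bhom0) addr0.
- by rewrite !(pureDl, bhomD) IH IH' addrACA.
- by rewrite tmul_scal bhomZ tder_scal talg_map_scal !(pure0l, bhom0) tmul_scal add0r.
- rewrite tmul_cons !tder_cons talg_map_cons !(pureDl, bhomD) -tmulA !tmul_cons IH.
  by rewrite pureDr bhomD addrA.
Qed.

Lemma tinc_leibniz t : tinc M (leibniz_ext eps delta t) = tder (tinc M t).
Proof.
have E n (u : tpow M n) : tinc M (leibniz_pow eps delta n u) = tder_pow n u.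
  elim: n u => [|n IH] u; first by rewrite /= !hzeroE bhom0.
  elim/tensor_ind: u => [|u v Pu Pv|x u]; first by rewrite !bhom0.
    by rewrite !bhomD Pu Pv.
  by rewrite /= !haddE !hcompE !tmapE bhomD tinc_rmul tinc_cons IH !hcompE.
elim/dsum_ind: t => [|t t' IH IH'|i t].
- by rewrite !bhom0.
- by rewrite !bhomD IH IH'.
- by rewrite /leibniz_ext dcopair_inj E tincE /tder dcopair_inj.
Qed.
End Derivation.
End TensorAlgebra.

Notation "x ** y" := (tmul _ (pure x y)) (at level 40, left associativity).

(** * Gradings and Koszul signs *)

Definition sg (d : int) : int := (-1) ^+ `|d|%N.

Lemma sgD (d e : int) : sg (d + e) = sg d * sg e.
Proof.
have E n : sg n = (-1 : int) ^ n.
  by case: n => n //; rewrite /sg NegzE abszN absz_nat -exprz_inv invrN1.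
by rewrite !E exprzDr // unitrN1.
Qed.

Lemma sgM (d : int) : sg d * sg d = 1.
Proof. by rewrite /sg -expr2 sqrr_sign. Qed.

Lemma sgB1 (d : int) : sg (d - 1) = - sg d.
Proof. by rewrite sgD {2}/sg /= mulrN1. Qed.

Lemma sg_nat (n : nat) : sg n = (-1) ^+ n.
Proof. by []. Qed.

Section PureMz.
Variables (S : pzRingType) (M N : bimodType S).
Implicit Types (x : M) (y : N).

Lemma pureMzl x y (z : int) : pure (x *~ z) y = pure x y *~ z.
Proof.
have E n : pure (x *+ n) y = pure x y *+ n.
  by elim: n => [|n IH]; rewrite ?mulr0n ?pure0l // !mulrS pureDl IH.
by case: z => n; rewrite ?NegzE ?mulrNz ?pureNl /intmul E.
Qed.

Lemma pureMzr x y (z : int) : pure x (y *~ z) = pure x y *~ z.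
Proof.
have E n : pure x (y *+ n) = pure x y *+ n.
  by elim: n => [|n IH]; rewrite ?mulr0n ?pure0r // !mulrS pureDr IH.
by case: z => n; rewrite ?NegzE ?mulrNz ?pureNr /intmul E.
Qed.
End PureMz.

Section Grading.
Variables (S : pzRingType) (K : int -> bimodType S).
Local Notation Kt := (Defs.total K).

Lemma koszulE k d (x : K d) : koszul K k (dinj K d x) = dinj K d x *~ sg d ^+ k.
Proof. by rewrite /koszul dcopair_inj hsgnE mulnC exprM. Qed.

Lemma homogN n d (t : tpow Kt n) : homog d t -> homog d (- t).
Proof.
elim=> {n d t} [a|n d e x t _ IH|n d|n d t u _ Ht _ Hu]; first exact: homog_unit.
- by rewrite -pureNr; apply: homog_pure.
- by rewrite oppr0; apply: homog_zero.
- by rewrite opprD; apply: homog_add.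
Qed.

Lemma homogMz n d (t : tpow Kt n) (z : int) : homog d t -> homog d (t *~ z).
Proof.
move=> h; have H k : homog d (t *+ k).
  by elim: k => [|k IH]; rewrite ?mulrS; [apply: homog_zero | apply: homog_add].
by case: z => k; rewrite ?NegzE ?mulrNz; [|apply: homogN]; apply: H.
Qed.

Lemma homogZ n d a (t : tpow Kt n) : homog d t -> homog d (a *: t).
Proof.
elim=> {n d t} [b|n d e x t ht IH|n d|n d t u _ Ht _ Hu]; first exact: homog_unit.
- by rewrite pureZ -bhomZ; apply: homog_pure.
- by rewrite scaler0; apply: homog_zero.
- by rewrite scalerDr; apply: homog_add.
Qed.

Lemma homogZr n d a (t : tpow Kt n) : homog d t -> homog d (t *:r a).
Proof.
elim=> {n d t} [b|n d e x t ht IH|n d|n d t u _ Ht _ Hu]; first exact: homog_unit.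
- by rewrite pureZr; apply: homog_pure.
- by rewrite rscale0r; apply: homog_zero.
- by rewrite rscalerDl; apply: homog_add.
Qed.

Lemma homog_sum n d (J : Type) (r : seq J) (F : J -> tpow Kt n) :
  (forall j, homog d (F j)) -> homog d (\sum_(j <- r) F j).
Proof.
move=> h; elim: r => [|j r IH]; first by rewrite big_nil; apply: homog_zero.
by rewrite big_cons; apply: homog_add.
Qed.

Lemma homog_tmerge n m d e (t : tpow Kt n) (u : tpow Kt m) :
  homog d t -> homog e u -> homog (d + e) (tmerge Kt n m (pure t u)).
Proof.
move=> ht hu; elim: ht => {n d t} [a|n d d' x t _ IH|n d|n d t t' _ Ht _ Ht'] /=.
- by rewrite unitl_pure add0r; apply: homogZ.
- by rewrite hcompE tassocE tmapE -addrA; apply: homog_pure.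
- by rewrite pure0l bhom0; apply: homog_zero.
- by rewrite pureDl bhomD; apply: homog_add.
Qed.

Lemma tpow_koszul n d (t : tpow Kt n) k :
  homog d t -> tpow_map (koszul K k) n t = t *~ sg d ^+ k.
Proof.
elim=> {n d t} [a|n d d' x t _ IH|n d|n d t t' _ Ht _ Ht'] /=.
- by rewrite expr1n mulr1z.
- by rewrite tmapE IH koszulE pureMzl pureMzr -mulrzA sgD mulrC exprMn.
- by rewrite mul0rz bhom0.
- by rewrite bhomD Ht Ht' mulrzDl.
Qed.

(* A tensor of homogeneous degree d is recorded in the component d: this separates the
   degrees, which homog alone does not make visible. *)
Fixpoint tdegs n : bimodHom (tpow Kt n) (dsum (fun _ : int => tpow Kt n)) :=
  match n return bimodHom (tpow Kt n) (dsum (fun _ : int => tpow Kt n)) with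
  | 0 => dinj (fun _ : int => tpow Kt 0) 0
  | n'.+1 =>
      hcomp (dcopairl (fun d => dcopairr (fun e =>
               hcomp (dinj (fun _ : int => tpow Kt n'.+1) (d + e))
                     (tmap (dinj K d) (hid (tpow Kt n'))))))
            (tmap (hid Kt) (tdegs n'))
  end.

Lemma tdegs_homog n d (t : tpow Kt n) :
  homog d t -> tdegs n t = dinj (fun _ : int => tpow Kt n) d t.
Proof.
elim=> {n d t} [a|n d d' x t _ IH|n d|n d t t' _ Ht _ Ht'] //=.
- by rewrite hcompE tmapE IH dcopairlE dcopairrE hcompE tmapE.
- by rewrite !bhom0.
- by rewrite !bhomD Ht Ht'.
Qed.

Lemma homog_span n (P : tpow Kt n -> Prop) :
  P 0 -> (forall t u, P t -> P u -> P (t + u)) -> (forall d t, homog d t -> P t) ->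
  forall t, P t.
Proof.
elim: n P => [|n IH] P P0 PD Ph; first by move=> t; apply: (Ph 0); apply: homog_unit.
elim/tensor_ind => // x; elim/dsum_ind: x => [|x x' Hx Hx' |d x] t.
- by rewrite pure0l.
- by rewrite pureDl; apply: PD.
move: t; apply: IH => [|t u|e t ht]; rewrite ?pure0r ?pureDr //; first exact: PD.
by apply: (Ph (d + e)); apply: homog_pure.
Qed.

Lemma homog_tdegs n (t : tpow Kt n) m : homog m (tdegs n t m).
Proof.
elim/homog_span: t => [|t u|d t ht].
- by rewrite bhom0; apply: homog_zero.
- by rewrite bhomD dsumDE; apply: homog_add.
rewrite (tdegs_homog ht); have [<-|dm] := eqVneq d m; first by rewrite dinj_in.
by rewrite dinj_out //; apply: homog_zero.
Qed.

Lemma tdegs_sum n (t : tpow Kt n) : dcopair (fun _ : int => hid (tpow Kt n)) (tdegs n t) = t.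
Proof.
elim/homog_span: t => [|t u Ht Hu|d t ht].
- by rewrite !bhom0.
- by rewrite !bhomD Ht Hu.
- by rewrite (tdegs_homog ht) dcopair_inj.
Qed.

Definition thomog d (x : talg Kt) := forall i, homog d (x i).

Lemma thomog0 d : thomog d 0.
Proof. by move=> i; apply: homog_zero. Qed.

Lemma thomogD d x y : thomog d x -> thomog d y -> thomog d (x + y).
Proof. by move=> hx hy i; rewrite dsumDE; apply: homog_add. Qed.

Lemma thomogN d x : thomog d x -> thomog d (- x).
Proof. by move=> hx i; rewrite dsumNE; apply: homogN. Qed.

Lemma thomogMz d x z : thomog d x -> thomog d (x *~ z).
Proof. by move=> hx i; have := homogMz z (hx i); rewrite -[x i]/(dproj _ i x) -bhomMz. Qed.

Lemma thomog_sum d (J : Type) (r : seq J) (F : J -> talg Kt) :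
  (forall j, thomog d (F j)) -> thomog d (\sum_(j <- r) F j).
Proof. by move=> h i; rewrite dsum_sumE; apply: homog_sum => j; apply: h. Qed.

Lemma thomog_inj d n (t : tpow Kt n) : homog d t -> thomog d (dinj (tpow Kt) n t).
Proof.
move=> h i; have [<-|ni] := eqVneq n i; first by rewrite dinj_in.
by rewrite dinj_out //; apply: homog_zero.
Qed.

Lemma thomog_mul d e x y : thomog d x -> thomog e y -> thomog (d + e) (x ** y).
Proof.
move=> hx hy; rewrite (dsum_recompose x) (dsum_recompose y).
pose f t := \sum_(i <- dsupp x) (dinj (tpow Kt) i (x i) ** t).
have -> t : (\sum_(i <- dsupp x) dinj (tpow Kt) i (x i)) ** t = f t.
  rewrite /f; elim: (dsupp x) => [|i r IH]; first by rewrite !big_nil pure0l bhom0.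
  by rewrite !big_cons pureDl bhomD IH.
apply: thomog_sum => i; set u := dinj _ _ _.
have -> : u ** (\sum_(j <- dsupp y) dinj (tpow Kt) j (y j)) =
          \sum_(j <- dsupp y) u ** dinj (tpow Kt) j (y j).
  elim: (dsupp y) => [|j r IH]; first by rewrite !big_nil pure0r bhom0.
  by rewrite !big_cons pureDr bhomD IH.
by apply: thomog_sum => j; rewrite tmulE; apply/thomog_inj/homog_tmerge.
Qed.

Lemma homog_dinj d (x : K d) : homog (n := 1) d (unitr_inv Kt (dinj K d x)).
Proof. by rewrite unitr_invE -[d in homog d]addr0; apply/homog_pure/homog_unit. Qed.

Lemma thomog_gen d (x : K d) : thomog d (tgen Kt (dinj K d x)).
Proof. by rewrite /tgen hcompE; apply/thomog_inj/homog_dinj. Qed.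

Lemma thomog_cons d e (x : K d) t :
  thomog e t -> thomog (d + e) (tcons Kt (pure (dinj K d x) t)).
Proof. by rewrite -tgen_mul; apply/thomog_mul/thomog_gen. Qed.

Lemma talg_koszul d x : thomog d x -> talg_map (koszul K 1) x = x *~ sg d.
Proof.
move=> h; apply: dsum_ext => i.
by rewrite /talg_map dcopair_comp (tpow_koszul _ (h i)) -[RHS]/(dproj _ i _) bhomMz.
Qed.

Lemma talg_homog_ind (P : talg Kt -> Prop) :
  P 0 -> (forall t u, P t -> P u -> P (t + u)) ->
  (forall a, P (dinj (tpow Kt) 0%N a)) ->
  (forall d e (x : K d) t, thomog e t -> P t -> P (tcons Kt (pure (dinj K d x) t))) ->
  forall t, P t.
Proof.
move=> P0 PD Pa Pc; suff H n (t : tpow Kt n) : P (dinj (tpow Kt) n t).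
  exact: dsum_ind.
have Hh d (u : tpow Kt n) : homog d u -> P (dinj (tpow Kt) n u).
  elim=> {n d u t} [a|n d d' x u hu IH|n d|n d u u' _ Hu _ Hu'] //.
  - by rewrite -tconsE; apply: Pc IH; apply: thomog_inj hu.
  - by rewrite bhom0.
  - by rewrite bhomD; apply: PD.
elim/homog_span: t => [|t u|d t]; last exact: Hh.
- by rewrite bhom0.
- by rewrite bhomD; apply: PD.
Qed.

Section DegreeMinusOne.
Variable delta : bimodHom Kt (Tplus Kt).
Hypothesis delta_homog : forall d (x : K d), thomog (d - 1) (tinc Kt (delta (dinj K d x))).
Local Notation D := (tder (koszul K 1) delta).

Lemma thomog_tder d x : thomog d x -> thomog (d - 1) (D x).
Proof.
move=> h; rewrite (dsum_recompose x) bhom_sum; apply: thomog_sum => n /=.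
elim: (h n) => {x h} [a|m e e' x t ht IH|m e|m e t u _ Ht _ Hu].
- by rewrite tder_scal; apply: thomog0.
- rewrite -tconsE tder_cons koszulE expr1 pureMzl bhomMz; apply: thomogD.
    by rewrite addrAC; apply: thomog_mul => //; apply: thomog_inj.
  by apply: thomogMz; rewrite -addrA; apply: thomog_cons.
- by rewrite !bhom0; apply: thomog0.
- by rewrite !bhomD; apply: thomogD.
Qed.

(** The two mixed terms cancel: [delta] lowers the degree of x by one, so D passes it with the sign
    opposite to that of [eps] on x. *)
Lemma tder2_cons d (x : K d) t :
  D (D (tcons Kt (pure (dinj K d x) t))) =
  D (tinc Kt (delta (dinj K d x))) ** t + tcons Kt (pure (dinj K d x) (D (D t))).
Proof.
rewrite tder_cons bhomD tder_mul (talg_koszul (@delta_homog d x)) tder_cons.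
rewrite !(koszulE, expr1, bhomMz, pureMzl) /= sgB1 mulrNz.
rewrite -mulrzA sgM mulr1z addrA.
by rewrite -[_ - _ + _]addrA addNr addr0.
Qed.

Lemma tder2_eq0 :
  (forall d (x : K d), D (tinc Kt (delta (dinj K d x))) = 0) -> forall t, D (D t) = 0.
Proof.
move=> D2; elim/talg_homog_ind => [|t u Ht Hu|a|d e x t _ IH].
- by rewrite !bhom0.
- by rewrite !bhomD Ht Hu addr0.
- by rewrite tder_scal bhom0.
- by rewrite tder2_cons D2 IH !(pure0l, pure0r, bhom0) addr0.
Qed.
End DegreeMinusOne.
End Grading.

(** * Suspension *)

Section Suspension.
Variables (S : pzRingType) (K : int -> bimodType S).
Local Notation Kt := (Defs.total K).
Local Notation K1 := (Defs.total (shift K)).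

Lemma suspend_dinj (n : int) (x : K (n + 1)) :
  suspend K (dinj K (n + 1) x) = dinj (shift K) n x.
Proof.
apply: dsum_ext => m; rewrite /suspend dpairE /=.
have [<-|nm] := eqVneq n m; first by rewrite !dinj_in.
by rewrite !dinj_out // (inj_eq (addIr 1)).
Qed.

Lemma desuspend_dinj (n : int) (x : shift K n) :
  desuspend K (dinj (shift K) n x) = dinj K (n + 1) x.
Proof. exact: (dcopair_inj (M := shift K)). Qed.

(** The degrees d and (d - 1) + 1 are equal but not convertible; a witness y replaces a transport of
    x. *)
Lemma suspend_ex d (x : K d) : exists y : shift K (d - 1),
  dinj K d x = dinj K (d - 1 + 1) y /\ suspend K (dinj K d x) = dinj (shift K) (d - 1) y.
Proof.
have [n e] : exists n, d = n + 1 by exists (d - 1); rewrite subrK.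
have -> : d - 1 = n by rewrite e addrK.
by subst d; exists x; rewrite suspend_dinj.
Qed.

Lemma suspendK : cancel (suspend K) (desuspend K).
Proof.
elim/dsum_ind => [|x y Hx Hy|d x]; first by rewrite !bhom0.
  by rewrite !bhomD Hx Hy.
by have [y [ex ->]] := suspend_ex x; rewrite desuspend_dinj ex.
Qed.

Lemma desuspendK : cancel (desuspend K) (suspend K).
Proof.
elim/dsum_ind => [|x y Hx Hy|d x]; first by rewrite !bhom0.
  by rewrite !bhomD Hx Hy.
by rewrite desuspend_dinj suspend_dinj.
Qed.

Lemma koszulK k : involutive (koszul K k).
Proof.
elim/dsum_ind => [|x y Hx Hy|d x]; first by rewrite !bhom0.
  by rewrite !bhomD Hx Hy.
by rewrite koszulE bhomMz koszulE -mulrzA -exprMn sgM expr1n.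
Qed.

Lemma koszul0 : koszul K 0 =1 id.
Proof.
elim/dsum_ind => [|x y Hx Hy|d x]; first by rewrite !bhom0.
  by rewrite !bhomD Hx Hy.
by rewrite koszulE expr0.
Qed.

(** A tensor product of injections need not be injective, hence the explicit left inverse; [koszul]
    is its own inverse. *)
Lemma suspend_pow_inj n : injective (suspend_pow K n).
Proof.
suff [g gK] : exists g : bimodHom (tpow K1 n) (tpow Kt n), cancel (suspend_pow K n) g.
  exact: can_inj gK.
elim: n => [|n [g gK]]; first by exists (hid (regular S)).
exists (tmap (hcomp (koszul K n) (desuspend K)) g).
elim/tensor_ind => [|t u Ht Hu|x t]; first by rewrite !bhom0.
  by rewrite !bhomD Ht Hu.
by rewrite /= !tmapE gK !hcompE suspendK koszulK.
Qed.

Lemma homog_suspend_pow n d (t : tpow Kt n) : homog d t -> homog (d - n%:Z) (suspend_pow K n t).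
Proof.
elim=> {n d t} [a|n d d' x t ht IH|n d|n d t u _ Ht _ Hu] /=.
- exact: homog_unit.
- rewrite tmapE hcompE koszulE bhomMz pureMzl.
  have [y [_ ->]] := suspend_ex x; apply: homogMz.
  have -> : d + d' - n.+1%:Z = (d - 1) + (d' - n%:Z).
    by rewrite intS opprD addrACA.
  exact: homog_pure.
- by rewrite bhom0; apply: homog_zero.
- by rewrite bhomD; apply: homog_add.
Qed.

(** Each factor of t has m more factors to its right than before, which contributes m times the
    total degree d of t. *)
Lemma suspend_pow_merge n m d (t : tpow Kt n) (u : tpow Kt m) :
  homog d t ->
  suspend_pow K (n + m) (tmerge Kt n m (pure t u)) =
  tmerge K1 n m (pure (suspend_pow K n t) (suspend_pow K m u)) *~ sg d ^+ m.
Proof.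
elim=> {n d t} [a|n d d' x t ht IH|n d|n d t t' _ Ht _ Ht'] /=.
- by rewrite !unitl_pure bhomZ expr1n.
- rewrite !tmapE !hcompE !tassocE !tmapE IH !hcompE !koszulE !bhomMz !pureMzl.
  rewrite pureMzr -!mulrzA; congr (_ *~ _).
  by rewrite sgD exprD exprMn [LHS]mulrC mulrA.
- by rewrite pure0l !bhom0 pure0l bhom0 mul0rz.
- by rewrite !pureDl !bhomD pureDl bhomD Ht Ht' mulrzDl.
Qed.
End Suspension.

(** * Components of products in the tensor algebra *)

Section TalgComponents.
Variables (S : pzRingType) (M : bimodType S).
Local Notation T := (talg M).

Lemma dinj_tcons (x : M) (t : T) n :
  dinj (tpow M) n.+1 (tcons M (pure x t) n.+1) = tcons M (pure x (dinj (tpow M) n (t n))).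
Proof.
elim/dsum_ind: t => [|t u Ht Hu|k t].
- by rewrite pure0r !bhom0 pure0r bhom0.
- by rewrite pureDr bhomD !dsumDE !bhomD /= pureDr bhomD -Ht -Hu.
rewrite !tconsE; have [<-|kn] := eqVneq k n; first by rewrite !dinj_in.
by rewrite !dinj_out ?eqSS // !bhom0 pure0r bhom0.
Qed.

Lemma tcons_comp0 (x : M) (t : T) : tcons M (pure x t) 0%N = 0.
Proof.
elim/dsum_ind: t => [|t u Ht Hu|k t].
- by rewrite pure0r bhom0.
- by rewrite pureDr bhomD dsumDE Ht Hu addr0.
- by rewrite tconsE dinj_out.
Qed.

(** The component is embedded back into [talg], where the summands, which live in the powers s + t,
    can be added without casts. *)
Lemma tmul_comp (x y : T) n N1 N2 : (n < N1)%N -> (n < N2)%N ->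
  dinj (tpow M) n ((x ** y) n) =
  \sum_(s < N1) \sum_(t < N2 | (s + t == n)%N)
    dinj (tpow M) s (x s) ** dinj (tpow M) t (y t).
Proof.
move=> nN1 nN2.
elim/dsum_ind: x => [|x x' Hx Hx'|i x].
- rewrite pure0l bhom0 bhom0 big1 // => s _; rewrite big1 // => t _.
  by rewrite bhom0 pure0l bhom0.
- rewrite pureDl bhomD dsumDE bhomD /= Hx Hx' -big_split; apply: eq_bigr => s _.
  by rewrite -big_split; apply: eq_bigr => t _; rewrite /= ?dsumDE bhomD pureDl bhomD.
elim/dsum_ind: y => [|y y' Hy Hy'|j y].
- rewrite pure0r bhom0 bhom0 big1 // => s _; rewrite big1 // => t _.
  by rewrite bhom0 pure0r bhom0.
- rewrite pureDr bhomD dsumDE bhomD /= Hy Hy' -big_split; apply: eq_bigr => s _.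
  by rewrite -big_split; apply: eq_bigr => t _; rewrite /= ?dsumDE bhomD pureDr bhomD.
have E s t : (s != i) || (t != j) ->
    dinj (tpow M) s (dinj (tpow M) i x s) ** dinj (tpow M) t (dinj (tpow M) j y t) = 0.
  case/orP=> h; first by rewrite dinj_out 1?eq_sym // bhom0 pure0l bhom0.
  by rewrite [X in pure _ X](_ : _ = 0) ?pure0r ?bhom0 // dinj_out 1?eq_sym // bhom0.
rewrite tmulE; have [ijn|ijn] := eqVneq (i + j)%N n; last first.
  rewrite dinj_out // bhom0 big1 // => s _; rewrite big1 // => t /eqP st; apply: E.
  by rewrite -negb_and; apply: contra ijn => /andP[/eqP <- /eqP <-]; rewrite st.
subst n; rewrite dinj_in.
have iN : (i < N1)%N by apply: leq_ltn_trans nN1; apply: leq_addr.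
have jN : (j < N2)%N by apply: leq_ltn_trans nN2; apply: leq_addl.
rewrite (bigD1 (Ordinal iN)) //= (bigD1 (Ordinal jN)) //= [X in _ + X + _]big1; last first.
  by move=> t /andP[_ h]; apply: E; apply/orP; right; exact: h.
rewrite addr0 [X in _ + X]big1 ?addr0; last first.
  by move=> s h; apply: big1 => t _; apply: E; apply/orP; left; exact: h.
by rewrite !dinj_in tmulE.
Qed.
End TalgComponents.

(** * The cobar construction *)

Section CobarTheory.
Variables (S : pzRingType) (K : ainfData S).
Local Notation Kt := (Defs.total K).
Local Notation K1 := (Defs.total (shift K)).
Local Notation delta := (cobar_gen K).
Local Notation eps := (koszul (shift K) 1).
Local Notation D := (tder eps delta).
Local Notation sp := (suspend_pow K).

Lemma cobar_gen_comp x k : (0 < k)%N ->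
  tinc K1 (delta x) k = - sp k (ainf_Delta K k (desuspend K x)).
Proof.
by case: k => // k _; rewrite tinc_comp /cobar_gen dpairE hoppE !hcompE.
Qed.

Lemma cobar_homogE d (x : cobar K) : dga_homog d x <-> thomog d (tinc K1 x).
Proof.
split=> h i; last by rewrite -tinc_comp.
by case: i => [|i]; rewrite ?tinc_comp0 ?tinc_comp; [apply: homog_zero | apply: h].
Qed.

Section Insert.
Variables (s : nat) (f : bimodHom K1 (tpow K1 s)).
(** After suspension every operation has degree -1, so that crossing a factor costs one [eps] for
    every arity s, in contrast to [insert]. *)
Fixpoint sinsert r t : bimodHom (tpow K1 (r + 1 + t)) (tpow K1 (r + s + t)) :=
  match r return bimodHom (tpow K1 (r + 1 + t)) (tpow K1 (r + s + t)) with
  | 0 => hcomp (tmerge K1 s t) (tmap f (hid (tpow K1 t)))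
  | r'.+1 => tmap eps (sinsert r' t)
  end.
End Insert.

Definition sDelta s : bimodHom K1 (tpow K1 s) :=
  hcomp (sp s) (hcomp (ainf_Delta K s) (desuspend K)).

Definition sterm r s t (w : talg K1) : talg K1 :=
  dinj (tpow K1) (r + s + t)%N (sinsert (sDelta s) r t (w (r + 1 + t)%N)).

Lemma stermD r s t w w' : sterm r s t (w + w') = sterm r s t w + sterm r s t w'.
Proof. by rewrite /sterm dsumDE !bhomD. Qed.
Lemma sterm0 r s t : sterm r s t 0 = 0.
Proof. by rewrite /sterm !bhom0. Qed.
Lemma sterm_scal r s t a : sterm r s t (dinj (tpow K1) 0%N a) = 0.
Proof. by rewrite /sterm dinj_out ?bhom0 // addn1 addSn. Qed.
Lemma sterm_cons0 s t x w :
  sterm 0 s t (tcons K1 (pure x w)) =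
  dinj (tpow K1) s (sDelta s x) ** dinj (tpow K1) t (w t).
Proof.
rewrite tmulE /sterm /= hcompE; congr (dinj _ _ (tmerge _ _ _ _)).
elim/dsum_ind: w => [|w w' Hw Hw'|k w].
- by rewrite pure0r !bhom0 pure0r.
- by rewrite pureDr bhomD !dsumDE bhomD pureDr Hw Hw'.
rewrite tconsE; have [<-|kt] := eqVneq k t; first by rewrite !dinj_in tmapE.
by rewrite !dinj_out ?eqSS // !bhom0 pure0r.
Qed.
Lemma sterm_consS r s t x w :
  sterm r.+1 s t (tcons K1 (pure x w)) = tcons K1 (pure (eps x) (sterm r s t w)).
Proof.
rewrite /sterm; elim/dsum_ind: w => [|w w' Hw Hw'|k w].
- by rewrite pure0r !bhom0 pure0r bhom0.
- by rewrite pureDr bhomD !dsumDE !bhomD pureDr bhomD Hw Hw'.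
rewrite !tconsE; have [kt|kt] := eqVneq k (r + 1 + t)%N.
  by subst k; rewrite !dinj_in /= tmapE.
have kt' : k.+1 != (r.+1 + 1 + t)%N by [].
by rewrite (dinj_out _ kt) (dinj_out _ kt') !bhom0 pure0r bhom0.
Qed.

(** The bounds are separate and only assumed to exceed n, because the induction on the word lowers n
    and the range of r but not the ranges of s and t. The minus sign is that of [cobar_gen], whose
    components are the negatives of [sDelta]. *)
Lemma cobar_diff_comp w n N1 N2 N3 : (n < N1)%N -> (n < N2)%N -> (n < N3)%N ->
  \sum_(r < N1) \sum_(s < N2) \sum_(t < N3 | (0 < s)%N && (r + s + t == n)%N)
    sterm r s t w = - dinj (tpow K1) n (D w n).
Proof.
elim/talg_ind: w n N1 => [|w w' Hw Hw'|a|x w IH] n N1 n1 n2 n3.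
- rewrite !bhom0 oppr0 big1 // => r _; rewrite big1 // => s _; rewrite big1 // => t _.
  exact: sterm0.
- rewrite bhomD dsumDE bhomD opprD -(Hw n N1) // -(Hw' n N1) // -big_split; apply: eq_bigr => r _.
  rewrite -big_split; apply: eq_bigr => s _; rewrite -big_split; apply: eq_bigr => t _.
  exact: stermD.
- rewrite tder_scal bhom0 oppr0 big1 // => r _; rewrite big1 // => s _.
  by rewrite big1 // => t _; apply: sterm_scal.
case: N1 n1 => // N1 n1; rewrite tder_cons dsumDE bhomD opprD big_ord_recl; congr (_ + _).
  rewrite (tmul_comp _ _ n2 n3) -sumrN; apply: eq_bigr => s _.
  case: (posnP s) => [s0|s0].
    rewrite big_pred0 // big1 ?oppr0 // => t _.
    by rewrite s0 tinc_comp0 bhom0 pure0l bhom0.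
  rewrite -sumrN; apply: eq_big => [t|t _] //.
  by rewrite sterm_cons0 cobar_gen_comp // bhomN pureNl bhomN opprK /sDelta !hcompE.
case: n n1 n2 n3 => [|n] n1 n2 n3.
  rewrite tcons_comp0 bhom0 oppr0 big1 // => r _; rewrite big1 // => s _.
  by rewrite big_pred0 // => t; rewrite lift0 !addSn andbF.
rewrite dinj_tcons -bhomN -pureNr -(IH n N1) ?(ltnW n2) ?(ltnW n3) //.
have E J (l : seq J) (P : pred J) (F : J -> talg K1) y :
    \sum_(i <- l | P i) tcons K1 (pure y (F i)) = tcons K1 (pure y (\sum_(i <- l | P i) F i)).
  elim: l => [|i l Hl]; first by rewrite !big_nil pure0r bhom0.
  by rewrite !big_cons; case: ifP => // _; rewrite pureDr bhomD Hl.
rewrite -E; apply: eq_bigr => r _; rewrite -E; apply: eq_bigr => s _; rewrite -E.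
by apply: eq_big => [t|t _]; rewrite lift0 ?addSn // sterm_consS.
Qed.

Hypothesis Delta_homog : forall k (d : int) (x : K d),
  (0 < k)%N -> homog (d + k%:Z - 2) (ainf_Delta K k (dinj K d x)).

Lemma cobar_gen_homog d (x : shift K d) : thomog (d - 1) (tinc K1 (delta (dinj (shift K) d x))).
Proof.
case=> [|i]; first by rewrite tinc_comp0; apply: homog_zero.
rewrite cobar_gen_comp // desuspend_dinj; apply: homogN.
have := homog_suspend_pow (Delta_homog x (isT : (0 < i.+1)%N)).
suff -> : d + 1 + i.+1%:Z - 2 - i.+1%:Z = d - 1 by [].
by rewrite addrAC addrK -addrA.
Qed.

(** The origin of the sign (-1)^(r + s t) of the relations. Suspension lowers the degree of each of
    the r factors on the left by one, which flips the sign of [eps]; and the operation changes the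
    degree of its factor by s modulo 2, which counts once for each of the t factors on the right. *)
Lemma sterm_suspend r s t (u : tpow Kt (r + 1 + t)) : (0 < s)%N ->
  sinsert (sDelta s) r t (sp (r + 1 + t) u) =
  sp (r + s + t) (insert (ainf_Delta K s) r t u) *~ (-1) ^+ (r + s * t).
Proof.
move=> s0; elim: r u => [|r IH] u.
  elim/tensor_ind: u => [|u v Hu Hv|x u]; first by rewrite !bhom0 mul0rz.
    by rewrite !bhomD mulrzDl Hu Hv.
  elim/dsum_ind: x => [|x x' Hx Hx'|d x]; first by rewrite pure0l !bhom0 mul0rz.
    by rewrite pureDl !bhomD mulrzDl Hx Hx'.
  rewrite /= !hcompE !tmapE (suspend_pow_merge _ (Delta_homog x s0)) !hcompE suspendK.
  rewrite koszulE !bhomMz pureMzl bhomMz -mulrzA; congr (_ *~ _).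
  have b2 : ((-1 : int) ^+ s) ^+ t * (-1) ^+ (s * t) = 1 by rewrite -exprM -expr2 sqrr_sign.
  by rewrite !sgD sg_nat mulr1 exprMn -mulrA b2 mulr1.
elim/tensor_ind: u => [|u v Hu Hv|x u]; first by rewrite !bhom0 mul0rz.
  by rewrite !bhomD mulrzDl Hu Hv.
elim/dsum_ind: x => [|x x' Hx Hx'|d x]; first by rewrite pure0l !bhom0 mul0rz.
  by rewrite pureDl !bhomD mulrzDl Hx Hx'.
rewrite /= !tmapE IH !hcompE !koszulE !bhomMz.
have [y [_ ey]] := suspend_ex x.
rewrite [koszul K _ _]koszulE bhomMz !ey koszulE !pureMzl pureMzr -!mulrzA; congr (_ *~ _).
set a := sg d; have aa : a ^+ s * a ^+ s = 1 by rewrite -exprMn sgM expr1n.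
have -> : (-1 : int) ^+ (r.+1 + s * t) = - (-1) ^+ (r + s * t).
  by rewrite addSn exprS mulN1r.
rewrite sgB1 -/a expr1 mulNr !mulrN [in LHS]mulrC; congr (- (_ * _)).
transitivity (a ^+ r * a ^+ t).
  by rewrite !exprD expr1 -[X in _ * X]mulrA mulrCA [a * (a * _)]mulrA sgM mul1r.
by rewrite !exprD [RHS]mulrAC -[a ^+ r * _ * _]mulrA aa mulr1.
Qed.

(** The device of [tdegs] on the whole of [Tplus]: it yields the homogeneous parts of an element,
    and [tdec_homog] makes parts of distinct degrees independent. *)
Definition tdec : bimodHom (Tplus K1) (dsum (fun _ : int => Tplus K1)) :=
  dcopair (fun i => hcomp
    (dcopair (fun m => hcomp (dinj (fun _ : int => Tplus K1) m)
                             (dinj (fun i => tpow K1 i.+1) i)))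
    (tdegs (shift K) i.+1)).

Lemma tdec_comp x m i : tdec x m i = tdegs (shift K) i.+1 (x i) m.
Proof.
elim/dsum_ind: x => [|x y Hx Hy|k x]; first by rewrite !bhom0.
  by rewrite bhomD !dsumDE bhomD Hx Hy.
rewrite /tdec dcopair_inj hcompE dcopair_comp.
have [<-|ki] := eqVneq k i; first by rewrite !dinj_in.
by rewrite !dinj_out // bhom0.
Qed.

Lemma tdec_sum x : dcopair (fun _ : int => hid (Tplus K1)) (tdec x) = x.
Proof.
elim/dsum_ind: x => [|x y Hx Hy|k x]; first by rewrite !bhom0.
  by rewrite !bhomD Hx Hy.
rewrite /tdec dcopair_inj hcompE -{2}(tdegs_sum x).
elim/dsum_ind: (tdegs _ _ x) => [|u v Hu Hv|d u]; first by rewrite !bhom0.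
  by rewrite !bhomD Hu Hv.
by rewrite !dcopair_inj hcompE dcopair_inj.
Qed.

Lemma tdec_homog d (x : cobar K) :
  dga_homog d x -> tdec x = dinj (fun _ : int => Tplus K1) d x.
Proof.
move=> h; apply: dsum_ext => m; apply: dsum_ext => i; rewrite tdec_comp (tdegs_homog (h i)).
have [<-|dm] := eqVneq d m; first by rewrite !dinj_in.
by rewrite !dinj_out.
Qed.

Hypothesis D2 : forall x, D (tinc K1 (delta x)) = 0.

Lemma cobar_dga : is_dga (cobar K).
Proof.
split=> /=.
- by move=> x y z; apply: tinc_inj; rewrite !tinc_mul tmulA.
- by move=> n i; apply: homog_zero.
- by move=> n x y hx hy i; apply: homog_add; [apply: hx | apply: hy].
- by move=> n a x hx i; apply: homogZ (hx i).
- by move=> n a x hx i; apply: homogZr (hx i).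
- move=> x; exists (dsupp (tdec x)), (fun m => tdec x m); split.
    by move=> n i; rewrite tdec_comp; apply: homog_tdegs.
  by rewrite -{1}(tdec_sum x) dcopairE.
- move=> s c us hc /(congr1 tdec); rewrite bhom_sum bhom0.
  rewrite (eq_bigr (fun n => dinj (fun _ : int => Tplus K1) n (c n))); last first.
    by move=> n _; apply: tdec_homog.
  move=> e n ns; move/(congr1 (fun z : dsum _ => z n)): e.
  rewrite dsum_sumE (bigD1_seq n) //= dinj_in big1 ?addr0 // => m mn.
  by rewrite dinj_out.
- move=> m n x y /cobar_homogE hx /cobar_homogE hy; apply/cobar_homogE.
  by rewrite tinc_mul; apply: thomog_mul.
- move=> n x /cobar_homogE hx; apply/cobar_homogE.
  by rewrite tinc_leibniz; apply: thomog_tder => //; apply: cobar_gen_homog.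
- move=> x; apply: tinc_inj; rewrite !tinc_leibniz bhom0.
  by apply: tder2_eq0 => [|d y]; [apply: cobar_gen_homog | apply: D2].
- move=> n x y /cobar_homogE hx; apply: tinc_inj.
  rewrite tinc_leibniz tinc_mul tder_mul (talg_koszul hx) bhomD bhomMz !tinc_mul.
  by rewrite !tinc_leibniz pureMzl bhomMz.
Qed.

Lemma cobar_ainf : is_ainf_coalgebra K.
Proof.
split=> [|n x n0]; first exact: Delta_homog.
set Z := (X in X = 0); pose Y := tinc K1 (delta (suspend K x)).
(* Suspending all arities at once turns the left side Z of the relation into component n of D
   ([delta] x); injectivity of the suspension in each arity then gives Z = 0. *)
have SZ : dcopair (fun k => hcomp (dinj (tpow K1) k) (sp k)) Z =
    - \sum_(r < n.+1) \sum_(s < n.+1) \sum_(t < n.+1 | (0 < s)%N && (r + s + t == n)%N)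
        sterm r s t Y.
  rewrite /Z bhom_sum -sumrN; apply: eq_bigr => r _; rewrite bhom_sum -sumrN.
  apply: eq_bigr => s _; rewrite bhom_sum -sumrN; apply: eq_bigr => t /andP[s0 _].
  rewrite bhomMz dcopair_inj hcompE /sterm cobar_gen_comp ?addn1 // suspendK !bhomN opprK.
  by rewrite sterm_suspend // bhomMz.
apply: (dsum_ext (x := Z) (y := 0)) => k; apply: (@suspend_pow_inj _ K k).
rewrite bhom0 -dcopair_comp SZ.
by rewrite (cobar_diff_comp _ (ltnSn n) (ltnSn n) (ltnSn n)) opprK /Y D2 bhom0.
Qed.
End CobarTheory.

(** * Bracketings and forests *)

Section Alternating.
Variables (M : zmodType) (A : Type).
Implicit Types (s t : seq A) (f g : A -> M).

Fixpoint altsum s f : M := if s is x :: s' then f x - altsum s' f else 0.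

(** The list of all removals in a tree, the outer pair included, has the degree of the suspended
    generator as its length. So this sign is the Leibniz sign for passing the tree. *)
Lemma altsum_cat s t f : altsum (s ++ t) f = altsum s f + altsum t f *~ (-1) ^+ size s.
Proof.
elim: s => [|x s IH] /=; first by rewrite add0r.
by rewrite IH exprS mulN1r mulrNz opprD addrA.
Qed.

Lemma eq_altsum (p : pred A) s f g :
  all p s -> (forall x, p x -> f x = g x) -> altsum s f = altsum s g.
Proof. by move=> ps fg; elim: s ps => //= x s IH /andP[/fg -> /IH ->]. Qed.

Lemma eq_altsumT s f g : f =1 g -> altsum s f = altsum s g.
Proof. by move=> fg; elim: s => //= x s ->; rewrite fg. Qed.

Lemma altsum0 s : altsum s (fun _ => 0) = 0.
Proof. by elim: s => //= x s ->; rewrite subr0. Qed.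

Lemma altsumD s f g : altsum s (fun x => f x + g x) = altsum s f + altsum s g.
Proof. by elim: s => [|x s IH] /=; rewrite ?addr0 // IH opprD addrACA. Qed.

Lemma altsumN s f : altsum s (fun x => - f x) = - altsum s f.
Proof. by elim: s => [|x s IH] /=; rewrite ?oppr0 // IH opprD. Qed.

Lemma altsum_iota s f k :
  \sum_(p <- zip (iota k (size s)) s) f p.2 *~ (-1) ^+ p.1 = altsum s f *~ (-1) ^+ k.
Proof.
elim: s k => [|x s IH] k; first by rewrite /= big_nil mul0rz.
by rewrite /= big_cons IH /= exprS mulN1r mulrNz mulrzBl.
Qed.
End Alternating.

Lemma altsum_map (M : zmodType) (A B : Type) (h : B -> A) (s : seq B) (f : A -> M) :
  altsum (map h s) f = altsum s (fun x => f (h x)).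
Proof. by elim: s => //= x s ->. Qed.

Section AltsumLinear.
Variables (S : pzRingType) (M N P : bimodType S) (A : Type) (s : seq A).

Lemma bhom_altsum (phi : bimodHom M N) (f : A -> M) :
  phi (altsum s f) = altsum s (fun x => phi (f x)).
Proof. by elim: s => [|x l IH] /=; rewrite ?bhom0 // bhomB IH. Qed.

Lemma pure_altsuml (f : A -> M) (y : N) :
  pure (altsum s f) y = altsum s (fun x => pure (f x) y).
Proof. by elim: s => [|x l IH] /=; rewrite ?pure0l // pureDl pureNl IH. Qed.

Lemma pure_altsumr (f : A -> N) (y : M) :
  pure y (altsum s f) = altsum s (fun x => pure y (f x)).
Proof. by elim: s => [|x l IH] /=; rewrite ?pure0r // pureDr pureNr IH. Qed.
End AltsumLinear.

(** [bracketing] is nested in [seq], so trees and forests need one simultaneous induction; the inner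
    [elim] on bs keeps the recursive calls structural. *)
Lemma bracketing_forest_ind (P : bracketing -> Prop) (Q : seq bracketing -> Prop) :
  P inp -> (forall b1 b2 bs, Q [:: b1, b2 & bs] -> P (brk b1 b2 bs)) ->
  Q [::] -> (forall b F, P b -> Q F -> Q (b :: F)) -> (forall b, P b) /\ (forall F, Q F).
Proof.
move=> Pi Pb Q0 Qc; suff H : forall b, P b by split=> //; elim=> // b F; apply: Qc.
fix rec 1; case=> [|b1 b2 bs]; [exact: Pi | apply: (Pb)].
apply: (Qc) (rec b1) _; apply: (Qc) (rec b2) _.
elim: bs => [|b bs IH]; [exact: Q0 | exact: (Qc) (rec b) IH].
Qed.

Definition nbrkF F := sumn (map nbrk F).

Lemma nbrk_brk b1 b2 bs : nbrk (brk b1 b2 bs) = (nbrkF [:: b1, b2 & bs]).+1.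
Proof. by []. Qed.

Lemma nbrkF_eq0 F : (nbrkF F == 0)%N = all is_inp F.
Proof. by elim: F => // b F IH; rewrite /nbrkF /= addn_eq0 -IH; case: b. Qed.

(** * Words over lists of factors, cut and merged *)

Section Words.
Variables (S : pzRingType) (V : bimodType S) (I : homogIdeal V).
Local Notation W := (word I).

Lemma word_castE l (e : l = l) w : word_cast I e w = w.
Proof. by rewrite (Prop_irrelevance e erefl). Qed.

Lemma word_cast_trans l1 l2 l3 (e : l1 = l2) (e' : l2 = l3) (e'' : l1 = l3) w :
  word_cast I e' (word_cast I e w) = word_cast I e'' w.
Proof. by subst l2 l3; rewrite !word_castE. Qed.

Lemma word_ind c l (P : W (c :: l) -> Prop) :
  P 0 -> (forall t u, P t -> P u -> P (t + u)) ->
  (forall (x : facobj I c) (w : W l), P (pure x w)) -> forall w, P w.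
Proof. exact: tensor_ind. Qed.

Lemma word_merge_cons c l1 l2 (x : facobj I c) (w : W l1) (u : W l2) :
  word_merge I (c :: l1) l2 (pure (pure x w) u) = pure x (word_merge I l1 l2 (pure w u)).
Proof. by rewrite /= hcompE tassocE tmapE. Qed.

Lemma word_split_cons c l1 l2 (x : facobj I c) (w : W (l1 ++ l2)) :
  word_split I (c :: l1) l2 (pure x w) = tassoc_inv _ _ _ (pure x (word_split I l1 l2 w)).
Proof. by rewrite /= hcompE tmapE. Qed.

Lemma word_mergeK l1 l2 : cancel (word_merge I l1 l2) (word_split I l1 l2).
Proof.
elim/tensor_ind => [|t u Ht Hu|w u]; first by rewrite !bhom0.
  by rewrite !bhomD Ht Hu.
elim: l1 w => [|c l1 IH] w.
  by rewrite /= unitl_pure unitl_invE [RHS]pure_scalel.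
elim/word_ind: w => [|w w' Hw Hw'|x w]; first by rewrite pure0l !bhom0.
  by rewrite pureDl !bhomD Hw Hw'.
by rewrite word_merge_cons word_split_cons IH tassoc_invE.
Qed.

Lemma word_splitK l1 l2 : cancel (word_split I l1 l2) (word_merge I l1 l2).
Proof.
elim: l1 => [|c l1 IH] w; first by rewrite /= unitl_invE unitl_pure scale1r.
elim/word_ind: w => [|w w' Hw Hw'|x w]; first by rewrite !bhom0.
  by rewrite !bhomD Hw Hw'.
rewrite word_split_cons -[in RHS](IH w).
elim/tensor_ind: (word_split I l1 l2 w) => [|t u Ht Hu|y u].
- by rewrite pure0r !bhom0 pure0r.
- by rewrite pureDr !bhomD pureDr Ht Hu.
- by rewrite tassoc_invE word_merge_cons.
Qed.

Lemma word_merge_ind l1 l2 (P : W (l1 ++ l2) -> Prop) :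
  P 0 -> (forall t u, P t -> P u -> P (t + u)) ->
  (forall (w : W l1) (u : W l2), P (word_merge I l1 l2 (pure w u))) -> forall w, P w.
Proof.
move=> P0 PD Pm w; rewrite -(word_splitK w).
elim/tensor_ind: (word_split _ _ _ _) => [|t u|x y]; rewrite ?bhom0 ?bhomD //.
exact: PD.
Qed.

Lemma BwordF_ind b F (P : BwordF I (b :: F) -> Prop) :
  P 0 -> (forall t u, P t -> P u -> P (t + u)) ->
  (forall (w : Bword I b) (u : BwordF I F), P (word_merge I (factors b) (factorsF F) (pure w u))) ->
  forall w, P w.
Proof. exact: word_merge_ind. Qed.

Lemma word_cast_cons c l l' (e' : l = l') (e : c :: l = c :: l') (x : facobj I c) (w : W l) :
  word_cast I e (pure x w) = pure x (word_cast I e' w).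
Proof. by subst l'; rewrite !word_castE. Qed.

Lemma word_cast_merge l l1 l2 (e' : l1 = l2) (e : l ++ l1 = l ++ l2) (w : W l) (u : W l1) :
  word_cast I e (word_merge I l l1 (pure w u)) = word_merge I l l2 (pure w (word_cast I e' u)).
Proof. by subst l2; rewrite !word_castE. Qed.

Lemma word_merge_assoc l1 l2 l3 (e : (l1 ++ l2) ++ l3 = l1 ++ (l2 ++ l3))
    (x : W l1) (y : W l2) (z : W l3) :
  word_cast I e (word_merge I (l1 ++ l2) l3 (pure (word_merge I l1 l2 (pure x y)) z)) =
  word_merge I l1 (l2 ++ l3) (pure x (word_merge I l2 l3 (pure y z))).
Proof.
elim: l1 e x => [|c l1 IH] e x.
  by rewrite word_castE /= !unitl_pure -pureZ bhomZ.
elim/word_ind: x => [|x x' Hx Hx'|x w]; first by rewrite !(pure0l, bhom0).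
  by rewrite !(pureDl, bhomD) Hx Hx'.
rewrite !word_merge_cons (word_cast_cons (esym (catA l1 l2 l3))).
by congr pure; apply: IH.
Qed.
End Words.

(** * Forests as products of generators, and the differential on them *)

Section Forests.
Variables (S : pzRingType) (V : bimodType S) (I : homogIdeal V).
Local Notation K := (Binf_bimod I).
Local Notation K1 := (Defs.total (shift K)).
Local Notation delta := (cobar_gen (Binf I)).
Local Notation eps := (koszul (shift K) 1).
Local Notation D := (tder eps delta).
Local Notation merge b F := (word_merge I (factors b) (factorsF F)).

Definition frem F := frem_with (@brem S V I) F.

Definition bgen b : bimodHom (Bword I b) K1 :=
  locked (hcomp (suspend K) (Binf_inj I b)).

Lemma bgenE b w : bgen b w = suspend K (Binf_inj I b w).
Proof. by rewrite /bgen -lock hcompE. Qed.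

(** The counterpart of [regroup] for the suspended generators, without any sign. *)
Fixpoint fpow F : bimodHom (BwordF I F) (tpow K1 (size F)) :=
  match F return bimodHom (BwordF I F) (tpow K1 (size F)) with
  | [::] => hid (regular S)
  | b :: F' => hcomp (tmap (bgen b) (fpow F')) (word_split I (factors b) (factorsF F'))
  end.

Definition fgen F : bimodHom (BwordF I F) (talg K1) :=
  locked (hcomp (dinj (tpow K1) (size F)) (fpow F)).

Lemma fgenE F w : fgen F w = dinj (tpow K1) (size F) (fpow F w).
Proof. by rewrite /fgen -lock hcompE. Qed.

Lemma fgen_nil a : fgen [::] a = dinj (tpow K1) 0%N a.
Proof. by rewrite fgenE. Qed.

Lemma fpow_cons b F w u : fpow (b :: F) (merge b F (pure w u)) = pure (bgen b w) (fpow F u).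
Proof. by rewrite [LHS]hcompE [word_split _ _ _ _]word_mergeK tmapE. Qed.

Lemma fgen_cons b F w u :
  fgen (b :: F) (merge b F (pure w u)) = tcons K1 (pure (bgen b w) (fgen F u)).
Proof. by rewrite !fgenE tconsE fpow_cons. Qed.

(** Needed when the outer pair of a first tree is opened: its content is spliced in front of the
    remaining trees. *)
Lemma fgen_cat F1 F2 w u :
  fgen (F1 ++ F2) (word_cast I (factorsF_cat F1 F2)
    (word_merge I (factorsF F1) (factorsF F2) (pure w u))) = fgen F1 w ** fgen F2 u.
Proof.
move: (factorsF_cat F1 F2); elim: F1 w => [|b F1 IH] w e.
  by rewrite word_castE /= unitl_pure fgen_nil tmul_scal bhomZ.
elim/BwordF_ind: w => [|w w' Hw Hw'|w w'].
- by rewrite pure0l !bhom0 pure0l bhom0.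
- by rewrite pureDl !bhomD pureDl bhomD Hw Hw'.
rewrite fgen_cons tmul_cons -(IH _ (factorsF_cat F1 F2)) -fgen_cons.
congr (fgen _ _).
have e1 : factors b ++ (factorsF F1 ++ factorsF F2) = factors b ++ factorsF (F1 ++ F2).
  by rewrite factorsF_cat.
rewrite -(word_cast_merge (factorsF_cat F1 F2) e1) -(word_merge_assoc (esym (catA _ _ _))).
by rewrite (word_cast_trans _ _ e).
Qed.

Lemma bgen_homog b w : exists y : shift K (nbrk b)%:Z, bgen b w = dinj (shift K) (nbrk b)%:Z y.
Proof.
have [y [_ e]] := suspend_ex (dinj (fun b' : bracketings_of (nbrk b).+1%:Z => Bword I (sval b'))
          (exist _ b (eqxx _)) w : K (nbrk b).+1%:Z).
have eb : (nbrk b).+1%:Z - 1 = (nbrk b)%:Z by rewrite intS addrC addKr.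
by move: y e; rewrite eb => y e; exists y; rewrite bgenE -e /Binf_inj hcompE.
Qed.

Lemma bgen_eps b w : eps (bgen b w) = bgen b w *~ (-1) ^+ nbrk b.
Proof. by have [y ->] := bgen_homog w; rewrite koszulE expr1. Qed.

Lemma frem_ge F : all (fun r => size F <= size (frem_to r))%N (frem F).
Proof. exact: frem_size. Qed.

Lemma frem_cons b F : frem (b :: F) =
  match b with inp => [::] | brk b1 b2 bs => [:: frem_open I b1 b2 bs F] end
  ++ [seq frem_head F r | r <- brem I b] ++ [seq frem_tail b r | r <- frem F].
Proof. by []. Qed.

Lemma brem_brk b1 b2 bs :
  brem I (brk b1 b2 bs) = [seq brem_close r | r <- frem [:: b1, b2 & bs]].
Proof. by []. Qed.

Lemma size_brem : (forall b, size (brem I b) = (nbrk b).-1) /\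
  (forall F, size (frem F) = nbrkF F).
Proof.
apply: bracketing_forest_ind => [|b1 b2 bs|//|b F Hb HF] //.
  by rewrite brem_brk size_map nbrk_brk.
rewrite frem_cons !size_cat !size_map Hb HF addnA; congr addn.
by case: (b).
Qed.

Lemma size_frem F : size (frem F) = nbrkF F.
Proof. exact: size_brem.2. Qed.

Lemma nbrk_brem : (forall b, all (fun r => (nbrk (brem_to r)).+1 == nbrk b) (brem I b)) /\
  (forall F, all (fun r => (nbrkF (frem_to r)).+1 == nbrkF F) (frem F)).
Proof.
apply: bracketing_forest_ind => [|b1 b2 bs|//|b F Hb HF] //.
  (* A content keeps at least two trees, so the default values of [brem_close] are not met. *)
  rewrite brem_brk all_map; have := frem_ge [:: b1, b2 & bs].
  elim: (frem _) => //= -[G w] s IH /andP[hG /IH {}IH] /andP[nG /IH ->]; rewrite andbT.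
  by case: G w hG nG => [|c1 [|c2 cs]].
rewrite frem_cons !all_cat !all_map; apply/and3P; split.
- case: b {Hb} => //= b1 b2 bs; rewrite andbT; apply/eqP.
  by rewrite /nbrkF /= map_cat sumn_cat !addSn !addnA.
- by apply: sub_all Hb => r /eqP rb; apply/eqP; rewrite -[RHS]/(nbrk b + _)%N -rb.
- by apply: sub_all HF => r /eqP rF; apply/eqP; rewrite /nbrkF /= -addnS; congr addn.
Qed.

Lemma nbrkF_frem F : all (fun r => (nbrkF (frem_to r)).+1 == nbrkF F) (frem F).
Proof. exact: nbrk_brem.2. Qed.

(** The sign in the higher coproducts is the Koszul sign of the n-fold suspension. The two cancel in
    the cobar differential, where opening a bracket carries no sign. *)
Lemma suspend_regroup F w : suspend_pow K (size F) (regroup I F w) =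
  fpow F w *~ (-1) ^+ split_sign F.
Proof.
elim: F w => [|b F IH] w //.
elim/BwordF_ind: w => [|t u Ht Hu|w u]; first by rewrite !bhom0 mul0rz.
  by rewrite !bhomD Ht Hu mulrzDl.
rewrite fpow_cons [regroup _ _ _]hcompE [word_split _ _ _ _]word_mergeK tmapE /= tmapE IH.
rewrite hcompE bgenE {2}/Binf_inj hcompE koszulE bhomMz pureMzl pureMzr -mulrzA.
by congr (_ *~ _); rewrite sg_nat -exprM mulnC -exprD addnC.
Qed.

Definition bopen b : bimodHom (Bword I b) (talg K1) :=
  match b with
  | inp => 0
  | brk b1 b2 bs => hcomp (fgen [:: b1, b2 & bs]) (open_bracket I b1 b2 bs)
  end.

(** Component 1 comes from the internal removals; among the components k at least 2, only the one
    with k the number of branches survives, and it opens the outer bracket. *)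
Lemma cobar_gen_bgen b w : tinc K1 (delta (bgen b w)) =
  bopen b w - tgen K1 (altsum (brem I b) (fun r => bgen (brem_to r) (brem_map r w))).
Proof.
apply: (dsum_ext (x := tinc K1 (delta (bgen b w)))) => k.
rewrite dsumDE dsumNE; case: k => [|[|k]].
- rewrite tinc_comp0 /tgen hcompE dinj_out // subr0; case: b w => [|b1 b2 bs] w /=.
    by rewrite hzeroE.
  by rewrite hcompE fgenE dinj_out.
- have -> : bopen b w 1%N = 0.
    case: b w => [|b1 b2 bs] w /=; first by rewrite hzeroE.
    by rewrite hcompE fgenE dinj_out.
  rewrite sub0r cobar_gen_comp // bgenE suspendK [ainf_Delta _ _ _]hcompE Binf_copair_inj.
  rewrite unitr_invE /= tmapE hcompE koszul0 /tgen hcompE dinj_in unitr_invE.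
  congr (- pure _ _); rewrite /Binf_Delta1 hsumE.
  rewrite (eq_bigr (fun p => Binf_inj I (brem_to p.2) (brem_map p.2 w) *~ (-1) ^+ p.1)); last first.
    by move=> p _; rewrite hsgnE hcompE.
  rewrite (altsum_iota _ (fun r => Binf_inj I (brem_to r) (brem_map r w))) mulr1z.
  by rewrite bhom_altsum; apply: eq_altsumT => r; rewrite bgenE.
rewrite cobar_gen_comp // bgenE suspendK [ainf_Delta _ _]/(Binf_Delta I k.+2).
rewrite /Binf_Delta Binf_copair_inj /tgen hcompE dinj_out // subr0.
case: b w => [|b1 b2 bs] w; first by rewrite /= !hzeroE bhom0 oppr0.
rewrite /Binf_split hsgnE hoppE 3!hcompE [bopen _ _]hcompE fgenE.
set F := [:: b1, b2 & bs].
have -> (n : nat) r : dproj (tpow (Defs.total K)) k.+2 (dinj (tpow (Defs.total K)) n r) =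
    dinj (tpow (Defs.total K)) n r k.+2 by [].
(* Projecting from arity n to arity m is the identity or 0, and commutes with the suspension in
   either case. *)
have E n r m : suspend_pow K m (dinj (tpow (Defs.total K)) n r m) =
    dinj (tpow K1) n (suspend_pow K n r) m.
  have [<-|nm] := eqVneq n m; first by rewrite !dinj_in.
  by rewrite !dinj_out // bhom0.
rewrite mulNrz bhomN opprK bhomMz E (suspend_regroup (F := F)) bhomMz.
rewrite -[dsum_fun _ _]/(dproj _ _ _) bhomMz -mulrzA.
by rewrite -expr2 sqrr_sign mulr1z.
Qed.

(** By left brackets, the removals are that of the outer pair of the first tree b, then those inside
    b, then those in the other trees. The second group starts at position 1, which is the minus sign
    of [cobar_gen_bgen], and the third at position [nbrk b], which is the Leibniz sign. *)
Lemma tder_fgen F w : D (fgen F w) = altsum (frem F) (fun r => fgen (frem_to r) (frem_map r w)).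
Proof.
elim: F w => [|b F IH] w; first by rewrite fgen_nil tder_scal.
elim/BwordF_ind: w => [|t u Ht Hu|w u].
- by rewrite !bhom0 -[LHS](altsum0 _ (frem (b :: F))); apply: eq_altsumT => r; rewrite !bhom0.
- by rewrite !bhomD Ht Hu -altsumD; apply: eq_altsumT => r; rewrite !bhomD.
rewrite fgen_cons tder_cons cobar_gen_bgen bgen_eps IH frem_cons !altsum_cat.
rewrite !altsum_map size_map size_brem.1.
have -> : altsum (brem I b) (fun r => fgen (frem_to (frem_head F r))
      (frem_map (frem_head F r) (merge b F (pure w u)))) =
    tgen K1 (altsum (brem I b) (fun r => bgen (brem_to r) (brem_map r w))) ** fgen F u.
  rewrite bhom_altsum pure_altsuml bhom_altsum; apply: eq_altsumT => r.
  by rewrite 2!hcompE [word_split _ _ _ _]word_mergeK tmapE fgen_cons tgen_mul.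
have -> : altsum (frem F) (fun r => fgen (frem_to (frem_tail b r))
      (frem_map (frem_tail b r) (merge b F (pure w u)))) =
    tcons K1 (pure (bgen b w) (altsum (frem F) (fun r => fgen (frem_to r) (frem_map r u)))).
  rewrite pure_altsumr bhom_altsum; apply: eq_altsumT => r.
  by rewrite 2!hcompE [word_split _ _ _ _]word_mergeK tmapE fgen_cons.
rewrite pureDl pureNl bhomB pureMzl bhomMz.
set X := tgen K1 _ ** _; set Y := tcons K1 _.
have X0 : b = inp -> X = 0 by move=> b0; subst b; rewrite /X /= bhom0 pure0l bhom0.
clearbody X Y; case: b w X0 => [|b1 b2 bs] w X0.
  by rewrite /= hzeroE X0 // pure0l bhom0 !expr0 !mulr1z subr0 !add0r.
rewrite /= subr0 expr1 mulrN1z opprD addrA; congr (_ - _ + _).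
  rewrite 4!hcompE [word_split _ _ _ _]word_mergeK tmapE.
  exact/esym/(@fgen_cat [:: b1, b2 & bs]).
by rewrite exprS mulN1r mulrNz.
Qed.
End Forests.

(** * Degrees of the coproducts *)

Section BinfDegree.
Variables (S : pzRingType) (V : bimodType S) (I : homogIdeal V).
Local Notation K := (Binf_bimod I).
Local Notation Kt := (Defs.total K).
Local Notation K1 := (Defs.total (shift K)).

Lemma Binf_homog_ind d (P : Kt -> Prop) :
  P 0 -> (forall x y, P x -> P y -> P (x + y)) ->
  (forall b w, (nbrk b).+1%:Z = d -> P (Binf_inj I b w)) -> forall x : K d, P (dinj K d x).
Proof.
move=> P0 PD Pb; elim/dsum_ind => [|x y|[b eb] w]; rewrite ?bhom0 ?bhomD //; first exact: PD.
have e := eqP eb; subst d; have := Pb b w erefl; rewrite /Binf_inj hcompE.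
by have -> : eb = eqxx _ by apply: bool_irrelevance.
Qed.

Lemma shift_homog_ind d (P : K1 -> Prop) :
  P 0 -> (forall x y, P x -> P y -> P (x + y)) ->
  (forall b w, (nbrk b)%:Z = d -> P (bgen I b w)) -> forall x : shift K d, P (dinj (shift K) d x).
Proof.
move=> P0 PD Pb x; rewrite -suspend_dinj.
apply: (@Binf_homog_ind (d + 1) (fun y => P (suspend K y))) => [|y z|b w e].
- by rewrite bhom0.
- by rewrite bhomD; apply: PD.
- by rewrite -bgenE; apply: Pb; apply: (addIr 1); rewrite -e intS addrC.
Qed.

Lemma homog_regroup F w : homog (nbrkF F + size F)%N%:Z (regroup I F w).
Proof.
elim: F w => [|b F IH] w; first exact: homog_unit.
elim/BwordF_ind: w => [|t u|w u]; first by rewrite bhom0; apply: homog_zero.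
  by rewrite bhomD; apply: homog_add.
rewrite [regroup _ _ _]hcompE [word_split _ _ _ _]word_mergeK tmapE {1}/Binf_inj hcompE.
have -> : (nbrkF (b :: F) + size (b :: F))%N%:Z = (nbrk b).+1%:Z + (nbrkF F + size F)%N%:Z.
  by rewrite -PoszD /nbrkF /= addnS addSn addnA.
by apply: homog_pure.
Qed.

Lemma Binf_Delta_homog k (d : int) (x : K d) :
  (0 < k)%N -> homog (d + k%:Z - 2) (ainf_Delta (Binf I) k (dinj K d x)).
Proof.
move=> k0; move: x.
apply: (@Binf_homog_ind d (fun x => homog (d + k%:Z - 2) (ainf_Delta (Binf I) k x)))
  => [|x y hx hy|b w <- {d}].
- by rewrite bhom0; apply: homog_zero.
- by rewrite bhomD; apply: homog_add.
case: k k0 => // -[_|k _].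
  rewrite [ainf_Delta _ _ _]hcompE Binf_copair_inj /Binf_Delta1 hsumE.
  rewrite (eq_bigr (fun p => Binf_inj I (brem_to p.2) (brem_map p.2 w) *~ (-1) ^+ p.1)); last first.
    by move=> p _; rewrite hsgnE hcompE.
  rewrite (altsum_iota _ (fun r => Binf_inj I (brem_to r) (brem_map r w))) mulr1z bhom_altsum.
  have := (nbrk_brem I).1 b; elim: (brem I b) => [|r s IH] /=; first by move=> _; apply: homog_zero.
  case/andP=> /eqP e /IH hs; apply: homog_add; last exact: homogN.
  rewrite -e /Binf_inj hcompE.
  have -> : (nbrk (brem_to r)).+2%:Z + 1 - 2 = (nbrk (brem_to r)).+1%:Z.
    by rewrite intS -addrA addrC addrA.
  exact: homog_dinj.
rewrite [ainf_Delta _ _]/(Binf_Delta I k.+2) /Binf_Delta Binf_copair_inj.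
case: b w => [|b1 b2 bs] w; first by rewrite /= hzeroE; apply: homog_zero.
rewrite /Binf_split hsgnE hoppE 3!hcompE; apply: homogMz; apply: homogN.
have [e|ne] := eqVneq (size bs).+2 k.+2; last first.
  by rewrite dproj_inj_out //; apply: homog_zero.
apply: (@thomog_inj _ K); rewrite -e nbrk_brk.
suff -> : (nbrkF [:: b1, b2 & bs]).+2%:Z + (size bs).+2%:Z - 2 =
    (nbrkF [:: b1, b2 & bs] + size [:: b1, b2 & bs])%N%:Z by exact: homog_regroup.
by rewrite -PoszD !addSn -[X in Posz X]add2n PoszD addrAC subrr add0r.
Qed.
End BinfDegree.

(** * Words of inputs and the ideal *)

Section Inputs.
Variables (S : pzRingType) (V : bimodType S) (I : homogIdeal V).
Local Notation K := (Binf_bimod I).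
Local Notation K1 := (Defs.total (shift K)).
Local Notation delta := (cobar_gen (Binf I)).
Local Notation eps := (koszul (shift K) 1).
Local Notation D := (tder eps delta).
Local Notation merge b F := (word_merge I (factors b) (factorsF F)).
Local Notation bgen := (bgen I).
Local Notation fgen := (fgen I).

Definition embV : bimodHom (talg V) (talg K1) := talg_map (deg0_incl I).

Definition hincl : bimodHom (hsum I) (talg V) :=
  dcopair (fun n => hcomp (dinj (tpow V) n.+2) (sub_incl (hpart I n))).

Lemma hinclE n x : hincl (dinj (hcomponent I) n x) = dinj (tpow V) n.+2 (sub_incl (hpart I n) x).
Proof. by rewrite /hincl dcopair_inj hcompE. Qed.

Lemma hincl_comp r n : hincl r n.+2 = sub_incl (hpart I n) (r n).
Proof.
elim/dsum_ind: r => [|x y Hx Hy|m x]; first by rewrite !bhom0.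
  by rewrite bhomD !dsumDE bhomD Hx Hy.
rewrite /hincl dcopair_inj hcompE; have [<-|mn] := eqVneq m n; first by rewrite !dinj_in.
by rewrite !dinj_out ?bhom0 ?eqSS.
Qed.

Lemma sub_incl_inj (M : bimodType S) (P : subbimod M) : injective (sub_incl P).
Proof. exact: val_inj. Qed.

(** Equalities in the ideal are tested after this map: the differential only shows the image of an
    element of R_n in V^n. *)
Lemma hincl_inj : injective hincl.
Proof.
move=> x y exy; apply: dsum_ext => n; apply: (@sub_incl_inj _ (hpart I n)).
by rewrite -!hincl_comp exy.
Qed.

Lemma deg0_inclE v : deg0_incl I v = bgen inp (pure v (1 : regular S)).
Proof. by rewrite /deg0_incl 2!hcompE unitr_invE bgenE. Qed.

Lemma eps_deg0 v : eps (deg0_incl I v) = deg0_incl I v.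
Proof. by rewrite deg0_inclE bgen_eps expr0 mulr1z. Qed.

(** A left inverse of [deg0_incl], killing all other generators. It gives [embV] a left inverse, and
    it induces the morphism of the theorem. *)
Definition projV : bimodHom K1 V :=
  hcomp (Binf_copair (fun b => match b return bimodHom (Bword I b) V with
                               | inp => unitr V | brk _ _ _ => 0 end)) (desuspend K).

Lemma projV_bgen b w : projV (bgen b w) =
  match b return Bword I b -> V with inp => unitr V | brk _ _ _ => fun _ => 0 end w.
Proof.
rewrite /projV hcompE bgenE suspendK Binf_copair_inj.
by case: b w => // b1 b2 bs w; rewrite hzeroE.
Qed.

Lemma projV_deg0 v : projV (deg0_incl I v) = v.
Proof. by rewrite deg0_inclE projV_bgen unitr_pure rscaler1. Qed.

Lemma embVK : cancel embV (talg_map projV).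
Proof.
by move=> t; rewrite /embV talg_map_comp talg_map_id // => v; rewrite hcompE projV_deg0.
Qed.

Lemma embV_comp0 t n : embV t n = 0 -> t n = 0.
Proof.
move=> e; rewrite -(embVK t) /talg_map dcopair_comp.
by rewrite -/(talg_map _) -/embV e bhom0.
Qed.

Lemma fgen_inp F v w : fgen (inp :: F) (pure v w : BwordF I (inp :: F)) =
  tcons K1 (pure (deg0_incl I v) (fgen F w)).
Proof.
rewrite deg0_inclE -(fgen_cons (b := inp)); congr (fgen _ _).
by rewrite [RHS]word_merge_cons /= unitl_pure scale1r.
Qed.

Lemma fgen_inputs F v : all is_inp F ->
  fgen F (inputs_word I F v) = embV (dinj (tpow V) (size F) v).
Proof.
elim: F v => [|[|//] F IH] v hF; first by rewrite /embV /= fgen_nil talg_map_scal.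
elim/tensor_ind: v => [|x y Hx Hy|x v]; first by rewrite !bhom0.
  by rewrite !bhomD Hx Hy.
by rewrite -tconsE /embV talg_map_cons -IH // -fgen_inp /= tmapE.
Qed.

Lemma fgen_inputs_ex F w : all is_inp F -> exists v, fgen F w = embV v.
Proof.
elim: F w => [|[|//] F IH] w hF.
  by exists (dinj (tpow V) 0%N w); rewrite /embV talg_map_scal fgen_nil.
elim/tensor_ind: w => [|x y [u Hx] [v Hy]|x w]; first by exists 0; rewrite !bhom0.
  by exists (u + v); rewrite !bhomD Hx Hy.
have [v ev] := IH w hF; exists (tcons V (pure x v)).
by rewrite fgen_inp ev /embV talg_map_cons.
Qed.

Lemma tder_embV t : D (embV t) = 0.
Proof.
elim/talg_ind: t => [|x y Hx Hy|a|v t IH]; first by rewrite !bhom0.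
- by rewrite !bhomD Hx Hy addr0.
- by rewrite /embV talg_map_scal tder_scal.
rewrite /embV talg_map_cons tder_cons -/embV IH pure0r bhom0 addr0 deg0_inclE.
by rewrite cobar_gen_bgen /= hzeroE bhom0 subr0 pure0l bhom0.
Qed.

Lemma embV_homog t : thomog 0 (embV t).
Proof.
elim/talg_ind: t => [|x y Hx Hy|a|v t IH].
- by rewrite bhom0; apply: thomog0.
- by rewrite bhomD; apply: thomogD.
- by rewrite /embV talg_map_scal; apply/thomog_inj/homog_unit.
rewrite /embV talg_map_cons deg0_inclE.
have [y ->] := bgen_homog (pure v (1 : regular S) : Bword I inp).
by rewrite -[0]addr0; apply: thomog_cons.
Qed.

Lemma tmul_scalr M (x : talg M) (a : regular S) : x ** dinj (tpow M) 0%N a = x *:r (a : S).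
Proof.
rewrite -[in RHS](tmulr1 x) -bhomZr pureZr -bhomZr; congr (_ ** dinj _ _ _).
by rewrite /rscale /= mul1r.
Qed.

Lemma dinj_at i j (x : tpow V i) :
  i = j -> dinj (tpow V) j (dinj (tpow V) i x j) = dinj (tpow V) i x.
Proof. by move=> ij; subst j; rewrite dinj_in. Qed.

Lemma tinc_hideal_incl n x :
  tinc V (hideal_incl I n x) = dinj (tpow V) n.+2 (sub_incl (hpart I n) x).
Proof. by rewrite /hideal_incl hcompE tincE. Qed.

Lemma hincl_mulr r v : hincl (hsum_mulr I (pure r v)) = hincl r ** tgen V v.
Proof.
elim/dsum_ind: r => [|x y Hx Hy|n x]; first by rewrite bhom0 !(pure0l, bhom0).
  by rewrite bhomD !(pureDl, bhomD) Hx Hy.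
rewrite /hsum_mulr dcopairlE hcompE /hincl !dcopair_inj !hcompE.
rewrite [sub_incl _ (hmulr _ _ _)]corestrictE !hcompE tmapE [dproj _ _ _]/= -tinc_comp tinc_mul.
rewrite tinc_hideal_incl tinc_gen /tgen hcompE tmulE.
by apply: dinj_at; rewrite addn1.
Qed.

Lemma hincl_mull r v : hincl (hsum_mull I (pure v r)) = tgen V v ** hincl r.
Proof.
elim/dsum_ind: r => [|x y Hx Hy|n x]; first by rewrite bhom0 !(pure0r, bhom0).
  by rewrite bhomD !(pureDr, bhomD) Hx Hy.
rewrite /hsum_mull dcopairrE hcompE /hincl !dcopair_inj !hcompE.
rewrite [sub_incl _ (hmull _ _ _)]corestrictE !hcompE tmapE [dproj _ _ _]/= -tinc_comp tinc_mul.
rewrite tinc_hideal_incl tinc_gen /tgen hcompE tmulE.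
exact: dinj_at.
Qed.

Section Conditional.
Variables (n : nat) (l : seq factor).

(* The factors of a bracket with n + 2 branches and content l. The maps open_bracket,
   close_map, absorb are matches on the boolean all is_inp _, on which their types depend:
   proving their properties for an arbitrary boolean i makes the case analysis possible. *)
Definition cfactors (i : bool) := if i then [:: facR n] else l.

(** For an innermost bracket, [cpart] and [csec] identify its word, R_(n+2) tensored with S, with
    the summand R_(n+2) of the ideal. *)
Definition cpart (i : bool) : bimodHom (word I (cfactors i)) (hsum I) :=
  match i return bimodHom (word I (cfactors i)) (hsum I) with
  | true => hcomp (dinj (hcomponent I) n) (unitr _)
  | false => 0
  end.

Definition csec (i : bool) : bimodHom (hsum I) (word I (cfactors i)) :=
  match i return bimodHom (hsum I) (word I (cfactors i)) with
  | true => hcomp (unitr_inv _) (dproj (hcomponent I) n)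
  | false => 0
  end.

Lemma csecK (i : bool) w : i -> csec i (cpart i w) = w.
Proof.
case: i w => // w _; rewrite /= !hcompE dproj_inj.
elim/tensor_ind: w => [|x y Hx Hy|x a]; first by rewrite !bhom0.
  by rewrite !bhomD Hx Hy.
by rewrite unitr_pure unitr_invE -pure_scaler.
Qed.

Lemma cpartK (i : bool) r : i -> cpart i (csec i r) = dinj (hcomponent I) n (r n).
Proof. by case: i => // _; rewrite /= !hcompE unitr_invE unitr_pure rscaler1. Qed.

Lemma copenE (i : bool) X (f : bimodHom X (word I l)) (g : bimodHom (hcomponent I n) X) w : i ->
  exists2 x, cpart i w = dinj (hcomponent I) n x &
    match i as i' return bimodHom (word I (cfactors i')) (word I l) with
    | true => hcomp f (hcomp g (unitr _))
    | false => hid _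
    end w = f (g x).
Proof. by case: i w => // w _; exists (unitr _ w); rewrite /= !hcompE. Qed.

Lemma cabsorbE (i : bool) F w u :
  match i as i' return bimodHom (word I (cfactors i' ++ factorsF F)) (hsum I) with
  | true => hcomp (absorb_right I F) (tmap (dinj (hcomponent I) n) (hid (BwordF I F)))
  | false => 0
  end (word_merge I (cfactors i) (factorsF F) (pure w u)) =
  absorb_right I F (pure (cpart i w) u).
Proof.
case: i w => w; last by rewrite !hzeroE pure0l bhom0.
elim/tensor_ind: w => [|x y Hx Hy|x a]; first by rewrite pure0l !bhom0 pure0l bhom0.
  by rewrite pureDl !bhomD pureDl bhomD Hx Hy.
rewrite word_merge_cons [word_merge _ _ _ _]unitl_pure hcompE tmapE [cpart _ _]hcompE.
by rewrite unitr_pure bhomZr pure_bal.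
Qed.
End Conditional.

Definition rpart b1 b2 bs : bimodHom (Bword I (brk b1 b2 bs)) (hsum I) :=
  cpart (size bs) (factorsF [:: b1, b2 & bs]) (all is_inp [:: b1, b2 & bs]).

Definition rsec b1 b2 bs : bimodHom (hsum I) (Bword I (brk b1 b2 bs)) :=
  csec (size bs) (factorsF [:: b1, b2 & bs]) (all is_inp [:: b1, b2 & bs]).

Lemma rsecK b1 b2 bs w : all is_inp [:: b1, b2 & bs] -> rsec b1 b2 bs (rpart b1 b2 bs w) = w.
Proof. exact: csecK. Qed.

Lemma rpartK b1 b2 bs r : all is_inp [:: b1, b2 & bs] ->
  rpart b1 b2 bs (rsec b1 b2 bs r) = dinj (hcomponent I) (size bs) (r (size bs)).
Proof. exact: cpartK. Qed.

Lemma absorb_right_embV F r w : all is_inp F ->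
  embV (hincl (absorb_right I F (pure r w))) = embV (hincl r) ** fgen F w.
Proof.
elim: F r w => [|[|//] F IH] r w hF.
  by rewrite /= unitr_pure !bhomZr fgen_nil tmul_scalr.
elim/tensor_ind: w => [|x y Hx Hy|v w].
- by rewrite pure0r !bhom0 pure0r bhom0.
- by rewrite pureDr !bhomD pureDr bhomD Hx Hy.
rewrite /= !hcompE tassoc_invE tmapE IH // hincl_mulr fgen_inp.
by rewrite -tgen_mul tmulA; congr (_ ** _); rewrite /embV talg_map_mul talg_map_gen.
Qed.

Lemma bopen_innermost b1 b2 bs w : all is_inp [:: b1, b2 & bs] ->
  bopen I (brk b1 b2 bs) w = embV (hincl (rpart b1 b2 bs w)).
Proof.
move=> h; rewrite [bopen _ _ _]hcompE.
have [x ex ->] : exists2 x, rpart b1 b2 bs w = dinj (hcomponent I) (size bs) x &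
    open_bracket I b1 b2 bs w = inputs_word I [:: b1, b2 & bs] (sub_incl (hpart I (size bs)) x).
  exact: copenE.
by rewrite ex fgen_inputs // hinclE.
Qed.

Lemma absorb_brk b1 b2 bs F w u :
  absorb I (brk b1 b2 bs :: F) (merge (brk b1 b2 bs) F (pure w u)) =
  absorb_right I F (pure (rpart b1 b2 bs w) u).
Proof. exact: cabsorbE. Qed.

Lemma brem_innermost b1 b2 bs : all is_inp [:: b1, b2 & bs] -> brem I (brk b1 b2 bs) = [::].
Proof.
rewrite -nbrkF_eq0 => /eqP h; apply: size0nil.
by rewrite (size_brem I).1 nbrk_brk h.
Qed.

Lemma cobar_gen_innermost b1 b2 bs w : all is_inp [:: b1, b2 & bs] ->
  tinc K1 (delta (bgen (brk b1 b2 bs) w)) = embV (hincl (rpart b1 b2 bs w)).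
Proof.
by move=> h; rewrite cobar_gen_bgen brem_innermost // bhom0 subr0 bopen_innermost.
Qed.

(** Removing the only pair includes R_n in V^n between inputs. Since the product of the ideal is
    that of the tensor algebra, this is the inclusion of the product taken by [absorb]. *)
Lemma tder_fgen_absorb F w : nbrkF F = 1%N -> D (fgen F w) = embV (hincl (absorb I F w)).
Proof.
elim: F w => [//|[|b1 b2 bs] F IH] w hF.
  elim/tensor_ind: w => [|x y Hx Hy|v w]; first by rewrite !bhom0.
    by rewrite !bhomD Hx Hy.
  have -> : absorb I (inp :: F) (pure v w) = hsum_mull I (pure v (absorb I F w)).
    by rewrite [LHS]hcompE tmapE.
  rewrite fgen_inp tder_cons eps_deg0 IH // hincl_mull.
  rewrite {1}deg0_inclE cobar_gen_bgen /= hzeroE bhom0 subr0 pure0l bhom0 add0r.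
  by rewrite /embV talg_map_mul talg_map_gen tgen_mul.
have [hb hF'] : all is_inp [:: b1, b2 & bs] /\ all is_inp F.
  have : (nbrk (brk b1 b2 bs) + nbrkF F = 1)%N by exact: hF.
  rewrite nbrk_brk addSn => -[/eqP]; rewrite addn_eq0 !nbrkF_eq0.
  by move=> /andP[].
elim/BwordF_ind: w => [|x y Hx Hy|w u]; first by rewrite !bhom0.
  by rewrite !bhomD Hx Hy.
rewrite fgen_cons tder_cons cobar_gen_innermost // absorb_brk absorb_right_embV //.
have [v ->] := fgen_inputs_ex u hF'.
by rewrite tder_embV pure0r bhom0 addr0.
Qed.
End Inputs.

(** * The contracting homotopy *)

Section Contraction.
Variables (S : pzRingType) (V : bimodType S) (I : homogIdeal V).
Local Notation K := (Binf_bimod I).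
Local Notation Kt := (Defs.total K).
Local Notation K1 := (Defs.total (shift K)).
Local Notation delta := (cobar_gen (Binf I)).
Local Notation eps := (koszul (shift K) 1).
Local Notation D := (tder eps delta).
Local Notation merge b F := (word_merge I (factors b) (factorsF F)).
Local Notation bgen := (bgen I).
Local Notation fgen := (fgen I).
Local Notation frem := (frem I).
Local Notation embV := (embV I).
Local Notation hincl := (hincl I).

Lemma csec_comp n l (i : bool) r :
  csec I n l i r = csec I n l i (dinj (hcomponent I) n (r n)).
Proof. by case: i; rewrite /csec ?hzeroE // !hcompE dproj_inj. Qed.

(* R_(n+2) as the generators with the bracketing [inp^(n+2)]. *)
Definition inngen : bimodHom (hsum I) K1 :=
  dcopair (fun n => hcomp (bgen (brk inp inp (nseq n inp)))
                   (hcomp (rsec I inp inp (nseq n inp)) (dinj (hcomponent I) n))).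

Lemma rsec_comp b1 b2 bs r :
  rsec I b1 b2 bs r = rsec I b1 b2 bs (dinj (hcomponent I) (size bs) (r (size bs))).
Proof. exact: csec_comp. Qed.

Lemma bgen_rsec b1 b2 bs r : all is_inp [:: b1, b2 & bs] ->
  bgen (brk b1 b2 bs) (rsec I b1 b2 bs r) = inngen (dinj (hcomponent I) (size bs) (r (size bs))).
Proof.
case: b1 b2 => // -[] // h; rewrite /inngen dcopair_inj !hcompE.
have -> : nseq (size bs) inp = bs.
  by elim: bs h {r} => //= -[] // bs IH h; rewrite IH.
by rewrite -rsec_comp.
Qed.

Lemma bgen_innermost b1 b2 bs w : all is_inp [:: b1, b2 & bs] ->
  bgen (brk b1 b2 bs) w = inngen (rpart I b1 b2 bs w).
Proof.
move=> h; rewrite -{1}(rsecK w h) bgen_rsec //; congr (inngen _).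
by rewrite -(rpartK _ h) rsecK.
Qed.

Lemma cobar_gen_inngen r : tinc K1 (delta (inngen r)) = embV (hincl r).
Proof.
elim/dsum_ind: r => [|x y Hx Hy|n x]; first by rewrite !bhom0.
  by rewrite !bhomD Hx Hy.
have h : all is_inp [:: inp, inp & nseq n inp] by rewrite /= all_nseq orbT.
rewrite {1}/inngen dcopair_inj !hcompE cobar_gen_innermost // rpartK //.
by rewrite size_nseq dinj_in.
Qed.

Section CloseBoolean.
Variables (n : nat) (l : seq factor).

(** Passes from the word of a bracket to the word of its content. The two coincide if the bracket is
    not innermost; otherwise the map is replaced by 0. *)
Definition cbool X (i : bool) (phi : bimodHom (word I (cfactors n l i)) X) :
    bimodHom (word I l) X :=
  (match i return bimodHom (word I (cfactors n l i)) X -> bimodHom (word I l) X with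
   | true => fun _ => 0
   | false => fun phi => phi
   end) phi.

Lemma cboolE X (i : bool) (phi : bimodHom (word I (cfactors n l i)) X) Y
    (f : bimodHom Y (word I l)) (g : bimodHom (hcomponent I n) Y) w : ~~ i ->
  exists2 w', cbool phi w = phi w' &
    match i as i' return bimodHom (word I (cfactors n l i')) (word I l) with
    | true => hcomp f (hcomp g (unitr _))
    | false => hid _
    end w' = w.
Proof. by case: i phi => // phi _; exists w. Qed.

Lemma cbool_open X (i : bool) (phi : bimodHom (word I (cfactors n l i)) X) Y
    (f : bimodHom Y (word I l)) (g : bimodHom (hcomponent I n) Y) w : ~~ i ->
  phi w = cbool phi (match i as i' return bimodHom (word I (cfactors n l i')) (word I l) with
    | true => hcomp f (hcomp g (unitr _))
    | false => hid _
    end w).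
Proof. by case: i phi w. Qed.

Lemma cclose_sec Z (i : bool) (g : bimodHom Z (word I l)) (f : bimodHom Z (hsum I)) w : i ->
  match i as i' return bimodHom Z (word I (cfactors n l i')) with
  | true => hcomp (unitr_inv _) (hcomp (dproj (hcomponent I) n) f)
  | false => g
  end w = csec I n l i (f w).
Proof. by case: i => // _; rewrite /csec !hcompE. Qed.

Lemma cbool_true X (i : bool) (phi : bimodHom (word I (cfactors n l i)) X) : i -> cbool phi = 0.
Proof. by case: i phi. Qed.

Lemma cbool_close X Z (i : bool) (phi : bimodHom (word I (cfactors n l i)) X)
    (g : bimodHom Z (word I l)) (f : bimodHom Z (hcomponent I n)) :
  ~~ i -> hcomp phi (match i as i' return bimodHom Z (word I (cfactors n l i')) with
           | true => hcomp (unitr_inv _) f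
           | false => g
           end) = hcomp (cbool phi) g.
Proof. by case: i phi. Qed.

Lemma ccloseE (i : bool) X Y Z (f : bimodHom Y (word I l)) (g : bimodHom (hcomponent I n) Y)
    (c : bimodHom (word I l) Z) (phi : bimodHom Z X) w : ~~ i ->
  phi (match i as i' return bimodHom (word I (cfactors n l i')) Z with
       | true => 0
       | false => c
       end w) =
  phi (c (match i as i' return bimodHom (word I (cfactors n l i')) (word I l) with
    | true => hcomp f (hcomp g (unitr _))
    | false => hid _
    end w)).
Proof. by case: i w. Qed.
End CloseBoolean.

(* The generator [F]; 0 if F has less than two trees or consists of inputs. *)
Definition cbr F : bimodHom (BwordF I F) K1 :=
  match F return bimodHom (BwordF I F) K1 with
  | [:: b1, b2 & bs] => 
      @cbool (size bs) (factorsF [:: b1, b2 & bs]) K1 (all is_inp [:: b1, b2 & bs])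
        (bgen (brk b1 b2 bs))
  | _ => 0
  end.

Lemma cbr_inputs F w : all is_inp F -> cbr F w = 0.
Proof.
case: F w => [|b1 [|b2 bs]] w h; try by rewrite /= hzeroE.
by rewrite /cbr cbool_true // hzeroE.
Qed.

Lemma cbrE b1 b2 bs w : ~~ all is_inp [:: b1, b2 & bs] ->
  exists2 w', cbr [:: b1, b2 & bs] w = bgen (brk b1 b2 bs) w' & open_bracket I b1 b2 bs w' = w.
Proof. exact: cboolE. Qed.

Lemma bgen_cbr b1 b2 bs w : ~~ all is_inp [:: b1, b2 & bs] ->
  bgen (brk b1 b2 bs) w = cbr [:: b1, b2 & bs] (open_bracket I b1 b2 bs w).
Proof. exact: cbool_open. Qed.

(** The removal r carried out inside a bracket around F, as a map on the content F. It departs from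
    [cbr] after [frem_map r] when r leaves only inputs, because [close_map] then multiplies in the
    ideal. *)
Definition kmap F (r : fremoval I (factorsF F)) : bimodHom (BwordF I F) K1 :=
  match frem_to r as G return bimodHom (BwordF I F) (BwordF I G) -> bimodHom (BwordF I F) K1 with
  | [:: c1, c2 & cs] => fun g => hcomp (bgen (brk c1 c2 cs)) (close_map g)
  | _ => fun _ => 0
  end (frem_map r).

Lemma brem_close_kmap b1 b2 bs (r : fremoval I (factorsF [:: b1, b2 & bs])) w :
  ~~ all is_inp [:: b1, b2 & bs] ->
  bgen (brem_to (brem_close r)) (brem_map (brem_close r) w) = kmap r (open_bracket I b1 b2 bs w).
Proof.
case: r => -[|c1 [|c2 cs]] g h; rewrite /kmap /=; try by rewrite !hzeroE bhom0.
rewrite hcompE; exact: ccloseE.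
Qed.

Lemma kmap_cbr F (r : fremoval I (factorsF F)) w : (1 < size (frem_to r))%N ->
  ~~ all is_inp (frem_to r) -> kmap r w = cbr (frem_to r) (frem_map r w).
Proof.
case: r => -[|c1 [|c2 cs]] g // _ h; rewrite /kmap [frem_to _]/= [frem_map _]/=.
rewrite -[RHS]hcompE; congr (bhom_fun _ _); exact: cbool_close.
Qed.

Lemma kmap_innermost F (r : fremoval I (factorsF F)) w : (1 < size (frem_to r))%N ->
  all is_inp (frem_to r) ->
  kmap r w = inngen (dinj (hcomponent I) (size (frem_to r)).-2
                          (absorb I F w (size (frem_to r)).-2)).
Proof.
case: r => -[|c1 [|c2 cs]] g // _ h; rewrite /kmap [frem_to _]/= [frem_map _]/=.
rewrite hcompE -(bgen_rsec _ h); congr (bgen _ _).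
exact: cclose_sec.
Qed.

Lemma frem_gt1 F : (1 < size F)%N -> all (fun r => 1 < size (frem_to r))%N (frem F).
Proof. by move=> F2; apply: sub_all (frem_ge I F) => r; apply: leq_trans. Qed.

(** This is d [F] = F - [d F], with [d F] formed by [kmap] and not by [cbr]. *)
Lemma cobar_gen_cbr F w : (1 < size F)%N -> ~~ all is_inp F ->
  tinc K1 (delta (cbr F w)) = fgen F w - tgen K1 (altsum (frem F) (fun r => kmap r w)).
Proof.
case: F w => [|b1 [|b2 bs]] // w _ h; have [w' -> <-] := cbrE w h.
rewrite cobar_gen_bgen [bopen _ _ _]hcompE brem_brk altsum_map; congr (_ - tgen _ _).
by apply: eq_altsumT => r; apply: brem_close_kmap.
Qed.

Lemma altsum_kmap F w : (1 < size F)%N -> (1 < nbrkF F)%N ->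
  altsum (frem F) (fun r => kmap r w) =
  altsum (frem F) (fun r => cbr (frem_to r) (frem_map r w)).
Proof.
move=> F2 n2; have h := frem_gt1 F2; have h' := nbrkF_frem I F.
apply: (@eq_altsum _ _ (fun r => (1 < size (frem_to r))%N && ~~ all is_inp (frem_to r))).
  elim: (frem F) h h' => //= r s IH /andP[-> /IH {}IH] /andP[/eqP e /IH ->].
  by rewrite -nbrkF_eq0 andbT -lt0n -ltnS e.
by move=> r /andP[r2 ri]; apply: kmap_cbr.
Qed.

Lemma altsum_kmap1 F w : (1 < size F)%N -> nbrkF F = 1%N ->
  altsum (frem F) (fun r => kmap r w) = inngen (absorb I F w).
Proof.
move=> F2 n1; have := tder_fgen w; rewrite (tder_fgen_absorb _ n1).
have := frem_gt1 F2; have := nbrkF_frem I F; have := size_frem I F; rewrite n1.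
case: (frem F) => // r [] // _; rewrite /= !andbT eqSS nbrkF_eq0 => h r2.
rewrite !subr0 kmap_innermost // fgenE => e; congr (inngen _).
(* The single removal leaves [size (frem_to r)] inputs and equals the image of [absorb I F w]; hence
   the latter is concentrated in that one component of the ideal. *)
apply: dsum_ext => m; have [<-|mn] := eqVneq (size (frem_to r)).-2 m; first by rewrite dinj_in.
rewrite dinj_out //; apply: (@sub_incl_inj _ _ (hpart I m)); rewrite bhom0 -hincl_comp.
apply/esym/(@embV_comp0 _ _ I); rewrite e dinj_out //; apply: contra mn => /eqP ->.
by [].
Qed.

Lemma cbr_homog F w :
  exists y : shift K (nbrkF F).+1%:Z, cbr F w = dinj (shift K) (nbrkF F).+1%:Z y.
Proof.
case: F w => [|b1 [|b2 bs]] w; try by exists 0; rewrite bhom0 /= hzeroE.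
have [h|h] := boolP (all is_inp [:: b1, b2 & bs]).
  by exists 0; rewrite bhom0 cbr_inputs.
have [w' -> _] := cbrE w h; have [y ->] := bgen_homog w'; by exists y.
Qed.

(** A tensor in [tpow K1 n] does not display its forest. Passing to this sum over all forests allows
    a map to be defined forest by forest. *)
Definition wsum : bimodType S := dsum (I := seq bracketing) (BwordF I).

Definition wcons_tree b : bimodHom (tensor (Bword I b) wsum) wsum :=
  dcopairr (I := seq bracketing) (M := BwordF I)
    (fun F => hcomp (dinj (I := seq bracketing) (BwordF I) (b :: F)) (merge b F)).

Definition wcons : bimodHom (tensor Kt wsum) wsum :=
  dcopairl (M := K) (fun d =>
    dcopairl (M := fun b : bracketings_of d => Bword I (sval b)) (fun b => wcons_tree (sval b))).

Lemma wconsE b F w u :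
  wcons (pure (Binf_inj I b w) (dinj (I := seq bracketing) (BwordF I) F u)) =
  dinj (I := seq bracketing) (BwordF I) (b :: F) (merge b F (pure w u)).
Proof.
rewrite /Binf_inj hcompE /wcons dcopairlE.
pose b' : bracketings_of (nbrk b).+1%:Z := exist _ b (eqxx _).
apply: etrans (dcopairlE (M := fun b' : bracketings_of _ => Bword I (sval b'))
  (fun b' => wcons_tree (sval b')) (j := b') w _) _.
by rewrite /wcons_tree dcopairrE hcompE.
Qed.

(* The inverse of the maps fpow: it recovers the forest from a tensor of generators. *)
Fixpoint gather n : bimodHom (tpow K1 n) wsum :=
  match n return bimodHom (tpow K1 n) wsum with
  | 0 => dinj (I := seq bracketing) (BwordF I) [::]
  | n'.+1 => hcomp wcons (tmap (desuspend K) (gather n'))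
  end.

Lemma gather_fpow F w : gather (size F) (fpow I F w) = dinj (I := seq bracketing) (BwordF I) F w.
Proof.
elim: F w => [//|b F IH] w.
elim/BwordF_ind: w => [|x y Hx Hy|w u]; first by rewrite !bhom0.
  by rewrite !bhomD Hx Hy.
by rewrite fpow_cons /= hcompE tmapE IH bgenE suspendK wconsE.
Qed.

(** The homotopy h is this map followed by [tgen]. *)
Definition bracket : bimodHom (talg K1) K1 :=
  dcopair (fun n => hcomp (dcopair cbr) (gather n)).

Lemma bracket_fgen F w : bracket (fgen F w) = cbr F w.
Proof. by rewrite fgenE /bracket dcopair_inj hcompE gather_fpow dcopair_inj. Qed.

Lemma talg_fgen_homog_ind d n (t : tpow K1 n) (P : talg K1 -> Prop) : homog d t ->
  P 0 -> (forall x y, P x -> P y -> P (x + y)) ->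
  (forall F w, (nbrkF F)%:Z = d -> P (fgen F w)) -> P (dinj (tpow K1) n t).
Proof.
move=> h; elim: h P => {n d t} [a|n d e x t _ IH|n d|n d t u _ Ht _ Hu] P P0 PD PF.
- by rewrite -fgen_nil; apply: PF.
- rewrite -tconsE; apply: (IH (fun t => P (tcons K1 (pure (dinj (shift K) d x) t)))).
  + by rewrite pure0r bhom0.
  + by move=> y z; rewrite pureDr bhomD; apply: PD.
  move=> F w eF; apply: (@shift_homog_ind _ _ _ _ (fun x => P (tcons K1 (pure x (fgen F w))))).
  + by rewrite pure0l bhom0.
  + by move=> y z; rewrite pureDl bhomD; apply: PD.
  move=> b u eb; rewrite -fgen_cons; apply: PF.
  by rewrite -[nbrkF _]/(nbrk b + nbrkF F)%N PoszD eb eF.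
- by rewrite bhom0.
- by rewrite bhomD; apply: (PD); [exact: Ht P P0 PD PF | exact: Hu P P0 PD PF].
Qed.

Lemma talg_fgen_ind (P : talg K1 -> Prop) :
  P 0 -> (forall x y, P x -> P y -> P (x + y)) ->
  (forall F w, P (fgen F w)) -> forall t, P t.
Proof.
move=> P0 PD PF; elim/dsum_ind => // n t.
elim/homog_span: t => [|x y|d t h]; rewrite ?bhom0 ?bhomD //; first exact: PD.
exact: (talg_fgen_homog_ind h).
Qed.

Lemma thomog_bracket d t : thomog d t -> thomog (d + 1) (tgen K1 (bracket t)).
Proof.
move=> h; rewrite (dsum_recompose t) !bhom_sum; apply: thomog_sum => n.
apply: (talg_fgen_homog_ind (P := fun t => thomog (d + 1) (tgen K1 (bracket t))) (h n)).
- by rewrite !bhom0; apply: thomog0.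
- by move=> x y hx hy; rewrite !bhomD; apply: thomogD.
move=> F w <-; rewrite bracket_fgen; have [y ->] := cbr_homog w.
have -> : (nbrkF F)%:Z + 1 = (nbrkF F).+1%:Z by rewrite intS addrC.
exact: thomog_gen.
Qed.

(** If F has at least two pairs, applying D to F - [d F] cancels d F and leaves [d d F]. Why this
    vanishes depends on whether F has two pairs or more, as [d d F] is formed by [kmap]. *)
Lemma cobar_diff2_bgen : (forall b w, D (tinc K1 (delta (bgen b w))) = 0) /\
  (forall F w, D (D (fgen F w)) = 0).
Proof.
apply: bracketing_forest_ind => [w|b1 b2 bs IH w|w|b F Hb HF w].
- by rewrite cobar_gen_bgen /= hzeroE bhom0 subr0 bhom0.
- set F := [:: b1, b2 & bs] in IH; have F2 : (1 < size F)%N by [].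
  have [h|h] := boolP (all is_inp F); first by rewrite cobar_gen_innermost // tder_embV.
  rewrite bgen_cbr // cobar_gen_cbr // -/F bhomB tder_gen; set u := open_bracket _ _ _ _ _.
  have n0 : (0 < nbrkF F)%N by rewrite lt0n nbrkF_eq0.
  (* With one pair, d F and d [d F] are both the image in V^n of the product taken by [absorb]. *)
  have [n1|n1] := eqVneq (nbrkF F) 1%N.
    by rewrite altsum_kmap1 // cobar_gen_inngen tder_fgen_absorb // subrr.
  have n2 : (1 < nbrkF F)%N by case: (nbrkF F) n0 n1 => // -[].
  rewrite altsum_kmap // !bhom_altsum tder_fgen.
  pose good (r : fremoval I (factorsF F)) :=
    (1 < size (frem_to r))%N && ((nbrkF (frem_to r)).+1 == nbrkF F).
  have hgood : all good (frem F).
    have := frem_gt1 F2; have := nbrkF_frem I F.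
    by elim: (frem F) => //= r s Hs /andP[e /Hs {}Hs] /andP[r2 /Hs ->]; rewrite /good e r2.
  have gni r : good r -> ~~ all is_inp (frem_to r).
    by move=> /andP[_ /eqP e]; rewrite -nbrkF_eq0 -lt0n -ltnS e.
  rewrite [X in _ - X](eq_altsum hgood (g := fun r => fgen (frem_to r) (frem_map r u) -
      tgen K1 (altsum (frem (frem_to r)) (fun r' => kmap r' (frem_map r u))))); last first.
    by move=> r gr; rewrite cobar_gen_cbr ?gni //; case/andP: gr.
  rewrite altsumD altsumN opprD addrA subrr sub0r opprK -bhom_altsum.
  suff -> : altsum (frem F) (fun r =>
      altsum (frem (frem_to r)) (fun r' => kmap r' (frem_map r u))) = 0.
    by rewrite bhom0.
  (* With two pairs every removal leaves one, so [d d F] is [inngen] of an alternating sum of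
     products in the ideal. The image of that sum in V^n is d d F, which is 0 by induction. *)
  have [e2|n3] := eqVneq (nbrkF F) 2.
    have E r : good r -> nbrkF (frem_to r) = 1%N.
      by rewrite /good e2 eqSS => /andP[_ /eqP].
    rewrite (eq_altsum hgood (g := fun r => inngen (absorb I (frem_to r) (frem_map r u))));
      last by move=> r gr; rewrite altsum_kmap1 ?E //; case/andP: gr.
    rewrite -bhom_altsum [X in inngen X](_ : _ = 0) ?bhom0 //.
    apply: hincl_inj; apply: (can_inj (embVK I)); rewrite !bhom0 -(IH u) tder_fgen !bhom_altsum.
    by apply: (eq_altsum hgood) => r gr; rewrite tder_fgen_absorb ?E.
  (* With three pairs or more, [kmap] and [cbr] agree at both removals, so [d d F] is the linear map
     [bracket] applied to d d F = 0. *)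
  transitivity (bracket (D (D (fgen F u)))); last by rewrite IH bhom0.
  rewrite tder_fgen !bhom_altsum; apply: (eq_altsum hgood) => r gr.
  have [r2 /eqP e] := andP gr.
  rewrite altsum_kmap //; last by move: n2 n3; rewrite -e; case: (nbrkF _) => // -[].
  rewrite tder_fgen bhom_altsum; apply: eq_altsumT => r'.
  by rewrite bracket_fgen.
- by rewrite fgen_nil tder_scal bhom0.
elim/BwordF_ind: w => [|x y Hx Hy|w u]; first by rewrite !bhom0.
  by rewrite !bhomD Hx Hy addr0.
rewrite fgen_cons; have [y ey] := bgen_homog w.
rewrite ey tder2_cons; last exact: (cobar_gen_homog (K := Binf I) (@Binf_Delta_homog _ _ I)).
by rewrite -ey Hb HF pure0r !bhom0 pure0l bhom0 addr0.
Qed.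

Lemma Binf_cobar_diff2 x : D (tinc K1 (delta x)) = 0.
Proof.
rewrite -(desuspendK x); elim/total_ind: (desuspend K x) => [|y z Hy Hz|b w].
- by rewrite !bhom0.
- by rewrite !bhomD Hy Hz addr0.
- by rewrite -bgenE cobar_diff2_bgen.1.
Qed.
End Contraction.

(** * The quasi-isomorphism *)

Section QuasiIso.
Variables (S : pzRingType) (V : bimodType S) (I : homogIdeal V).
Local Notation K := (Binf_bimod I).
Local Notation K1 := (Defs.total (shift K)).
Local Notation delta := (cobar_gen (Binf I)).
Local Notation eps := (koszul (shift K) 1).
Local Notation D := (tder eps delta).
Local Notation merge b F := (word_merge I (factors b) (factorsF F)).
Local Notation bgen := (bgen I).
Local Notation fgen := (fgen I).
Local Notation frem := (frem I).
Local Notation embV := (embV I).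
Local Notation hincl := (hincl I).
Local Notation inngen := (inngen I).
Local Notation bracket := (bracket I).
Local Notation h t := (tgen K1 (bracket t)).

Lemma fgen_singleton b w a :
  fgen [:: b] (merge b [::] (pure w a)) = tgen K1 (bgen b (w *:r (a : S))).
Proof.
by rewrite fgen_cons fgen_nil -tgen_mul tmul_scalr -!bhomZr.
Qed.

Lemma bracket_tgen x : bracket (tgen K1 x) = 0.
Proof.
rewrite -(desuspendK x); elim/total_ind: (desuspend K x) => [|y z Hy Hz|b w].
- by rewrite !bhom0.
- by rewrite !bhomD Hy Hz addr0.
rewrite -bgenE -(rscaler1 w) -fgen_singleton bracket_fgen /=.
exact: hzeroE.
Qed.

Lemma bracket_embV t : bracket (embV t) = 0.
Proof.
elim/dsum_ind: t => [|x y Hx Hy|n t]; first by rewrite !bhom0.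
  by rewrite !bhomD Hx Hy addr0.
have hn : all is_inp (nseq n inp) by rewrite all_nseq orbT.
have : size (nseq n inp) = n by rewrite size_nseq.
move: (nseq n inp) hn => F hF en; subst n.
by rewrite -fgen_inputs // bracket_fgen cbr_inputs.
Qed.

(** What 1 - d h - h d leaves is recorded only up to existence: words of inputs and innermost
    generators are all that the computation for cycles distinguishes. *)
Lemma homotopy t : exists v r, t - D (h t) - h (D t) = embV v + tgen K1 (inngen r).
Proof.
elim/talg_fgen_ind: t => [|x y [v [r ex]] [v' [r' ey]]|F w].
- by exists 0, 0; rewrite !bhom0 !subr0 addr0.
- exists (v + v'), (r + r'); rewrite !bhomD [RHS]addrACA -ex -ey.
  by rewrite opprD addrACA opprD [LHS]addrACA.
case: F w => [|b [|b2 bs]] w.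
- exists (dinj (tpow V) 0%N w), 0; rewrite fgen_nil tder_scal -fgen_nil bracket_fgen /= hzeroE.
  by rewrite !bhom0 !subr0 addr0 fgen_nil /embV talg_map_scal.
- elim/BwordF_ind: w => [|x y [v [r ex]] [v' [r' ey]]|w a].
  + by exists 0, 0; rewrite !bhom0 !subr0 addr0.
  + exists (v + v'), (r + r'); rewrite !bhomD [RHS]addrACA -ex -ey.
  by rewrite opprD addrACA opprD [LHS]addrACA.
  rewrite fgen_singleton bracket_tgen !bhom0 subr0 tder_gen; move: (w *:r _) => {}w {a}.
  case: b w => [|b1 b2 bs] w.
    rewrite cobar_gen_bgen /= hzeroE !bhom0 subr0 !bhom0 subr0.
    have [v ev] := fgen_inputs_ex (F := [:: inp]) (merge inp [::] (pure w (1 : regular S))) isT.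
    by exists v, 0; rewrite -ev fgen_singleton rscaler1 !bhom0 addr0.
  have [hi|hi] := boolP (all is_inp [:: b1, b2 & bs]).
    exists 0, (rpart I b1 b2 bs w); rewrite cobar_gen_innermost // bracket_embV !bhom0 subr0 add0r.
    by rewrite bgen_innermost.
  (* The tree is not innermost. Its internal removals are single trees, killed by h, and enclosing
     its opened content gives the tree back. *)
  exists 0, 0; rewrite cobar_gen_bgen bhomB bracket_tgen subr0 [bopen _ _ _]hcompE bracket_fgen.
  by rewrite -bgen_cbr // subrr !bhom0 addr0.
set F := [:: b, b2 & bs] in w *; have F2 : (1 < size F)%N by [].
rewrite bracket_fgen tder_gen.
have [hi|hi] := boolP (all is_inp F).
  have [v ev] := fgen_inputs_ex w hi; exists v, 0.
  by rewrite cbr_inputs // ev tder_embV !bhom0 !subr0 addr0.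
(* As d h F = F - [d F], what remains is [d F] - h (d F), the difference of [kmap] and [cbr] over
   all removals; it can be nonzero for a single pair only. *)
rewrite cobar_gen_cbr // tder_fgen opprB addrCA subrr addr0.
have -> : bracket (altsum (frem F) (fun r => fgen (frem_to r) (frem_map r w))) =
    altsum (frem F) (fun r => cbr I (frem_to r) (frem_map r w)).
  by rewrite bhom_altsum; apply: eq_altsumT => r; rewrite bracket_fgen.
have n0 : (0 < nbrkF F)%N by rewrite lt0n nbrkF_eq0.
have [n1|n1] := eqVneq (nbrkF F) 1%N.
  exists 0, (absorb I F w); rewrite altsum_kmap1 //.
  have := nbrkF_frem I F; rewrite n1 => hr.
  have -> : altsum (frem F) (fun r => cbr I (frem_to r) (frem_map r w)) = 0.
    rewrite -[RHS](altsum0 _ (frem F)); apply: (eq_altsum hr) => r.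
    by rewrite eqSS nbrkF_eq0 => /cbr_inputs ->.
  by rewrite !bhom0 subr0 add0r.
exists 0, 0; rewrite altsum_kmap ?subrr ?bhom0 ?addr0 //.
by case: (nbrkF F) n0 n1 => // -[].
Qed.

Lemma Tplus_ind (M : bimodType S) (P : Tplus M -> Prop) :
  P 0 -> (forall x y, P x -> P y -> P (x + y)) ->
  (forall x, P (Tplus_gen M x)) -> (forall x t, P t -> P (Tplus_cons M (pure x t))) ->
  forall t, P t.
Proof.
move=> P0 PD Pg Pc; elim/dsum_ind => // n; elim: n => [|n IH] t.
  elim/tensor_ind: t => [|t u Pt Pu|x a]; rewrite ?bhom0 ?bhomD //; first exact: PD.
  have -> : dinj (fun i => tpow M i.+1) 0%N (pure x a) = Tplus_gen M (x *:r (a : S)).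
    by rewrite /Tplus_gen hcompE unitr_invE -pure_scaler.
  exact: Pg.
elim/tensor_ind: t => [|t u Pt Pu|x t]; rewrite ?bhom0 ?bhomD //; first exact: PD.
have -> : dinj (fun i => tpow M i.+1) n.+1 (pure x t) =
    Tplus_cons M (pure x (dinj (fun i => tpow M i.+1) n t)) by rewrite /Tplus_cons dcopairrE.
exact/Pc/IH.
Qed.

Lemma qalg_ex (q : qalg I) : exists t, q = qalg_pi I t.
Proof. by eexists; apply: esym; apply: (quot_reprK q). Qed.

Lemma qalg_pi_eq0 t : qalg_pi I t = 0 <-> hideal I t.
Proof.
rewrite -(bhom0 (qalg_pi I)) -[t in hideal I t]subr0.
exact: (quot_eqP (hideal I)).
Qed.

Lemma hideal_hincl t : hideal I t -> exists r, tinc V t = hincl r.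
Proof.
case=> t0 ht; have [s hs] := dsumP t.
have hf : finsupp (M := hcomponent I) (fun n => sub_in (ht n)).
  (* The component n of the ideal has index n + 1 in [Tplus], hence the predecessor. *)
  exists [seq i.-1 | i <- s] => n hn; apply: val_inj; apply: hs.
  by apply: contra hn => hn; apply/mapP; exists n.+1.
exists (DSum hf); apply: dsum_ext => -[|[|n]].
- rewrite tinc_comp0; elim/dsum_ind: (DSum hf) => [|x y Hx Hy|n x].
  + by rewrite bhom0.
  + by rewrite bhomD dsumDE -Hx -Hy addr0.
  + by rewrite hinclE dinj_out.
- rewrite tinc_comp t0; elim/dsum_ind: (DSum hf) => [|x y Hx Hy|n x].
  + by rewrite bhom0.
  + by rewrite bhomD dsumDE -Hx -Hy addr0.
  + by rewrite hinclE dinj_out.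
- by rewrite tinc_comp hincl_comp.
Qed.

Lemma hideal_hincl_tinc r t : tinc V t = hincl r -> hideal I t.
Proof.
move=> e; split=> [|n]; last by rewrite -tinc_comp e hincl_comp; apply: sub_valP.
rewrite -tinc_comp e; elim/dsum_ind: r {e} => [|x y Hx Hy|n x].
- by rewrite bhom0.
- by rewrite bhomD dsumDE Hx Hy addr0.
- by rewrite hinclE dinj_out.
Qed.

Lemma qalg_is_dga : is_dga (qalg_dga I).
Proof.
split=> /=.
- move=> x y z; have [t ->] := qalg_ex x; have [u ->] := qalg_ex y; have [v ->] := qalg_ex z.
  rewrite -!qalg_pi_mul; congr (qalg_pi I _).
  by apply: tinc_inj; rewrite !tinc_mul tmulA.
- by right.
- by move=> n x y [|->]; [left | rewrite add0r].
- by move=> n a x [|->]; [left | right; rewrite scaler0].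
- by move=> n a x [|->]; [left | right; rewrite rscale0r].
- move=> x; exists [:: 0], (fun n => if n == 0 then x else 0).
  split; last by rewrite big_seq1 eqxx.
  by move=> n; case: eqP; [left | right].
- move=> s c us hc e n ns; case: (hc n) => // n0; subst n.
  move: e; rewrite (bigD1_seq 0) //= big1 ?addr0 // => m m0.
  by case: (hc m) => // m00; rewrite m00 eqxx in m0.
- move=> m n x y [m0|->]; last by right; rewrite pure0l bhom0.
  by case=> [n0|->]; [left; rewrite m0 n0 | right; rewrite pure0r bhom0].
- by move=> n x _; right; rewrite hzeroE.
- by move=> x; rewrite !hzeroE.
- by move=> n x y _; rewrite !hzeroE pure0l pure0r !bhom0 mul0rz addr0.
Qed.

Definition cobar_qalg : bimodHom (cobar (Binf I)) (qalg_dga I) :=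
  hcomp (qalg_pi I) (Tplus_map (projV I)).
Local Notation f := cobar_qalg.

Lemma cobar_qalgE x : f x = qalg_pi I (Tplus_map (projV I) x).
Proof. exact: hcompE. Qed.

Lemma cobar_qalgM x y : f (Tplus_mul K1 (pure x y)) = qalg_mul I (pure (f x) (f y)).
Proof.
rewrite !cobar_qalgE -qalg_pi_mul; congr (qalg_pi I _).
by apply: tinc_inj; rewrite tinc_map !tinc_mul talg_map_mul !tinc_map.
Qed.

Lemma cobar_qalg_embV t v : tinc K1 t = embV (tinc V v) -> f t = qalg_pi I v.
Proof.
move=> e; rewrite cobar_qalgE; congr (qalg_pi I _); apply: tinc_inj.
by rewrite tinc_map e embVK.
Qed.

Lemma projV_homog d (x : shift K d) : d != 0 -> projV I (dinj (shift K) d x) = 0.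
Proof.
move=> d0; apply: (@shift_homog_ind _ _ I d (fun x => projV I x = 0)) => [|y z Hy Hz|b w e].
- by rewrite bhom0.
- by rewrite bhomD Hy Hz addr0.
rewrite projV_bgen; case: b w e => // w e.
by rewrite -e in d0.
Qed.

Lemma cobar_qalg_homog n x : dga_homog (d := cobar (Binf I)) n x -> n != 0 -> f x = 0.
Proof.
move=> /cobar_homogE hx n0; rewrite cobar_qalgE.
have -> : Tplus_map (projV I) x = 0; last by rewrite bhom0.
apply: tinc_inj; rewrite tinc_map bhom0; apply: dsum_ext => i.
rewrite /talg_map dcopair_comp.
(* A tensor with a factor of nonzero degree is killed, and a tensor without one has degree 0. The
   disjunction passes to sums because both terms have the same degree d. *)
have E m d (t : tpow K1 m) : homog d t -> d = 0 \/ tpow_map (projV I) m t = 0.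
  elim=> {m d t} [a|m d e y t _ IH|m d|m d t u _ Ht _ Hu]; first by left.
  - have [d0|d0] := eqVneq d 0; last by right; rewrite /= tmapE projV_homog // pure0l.
    case: IH => [e0|IH]; [by left; rewrite d0 e0 | right].
    by rewrite /= tmapE IH pure0r.
  - by right; rewrite bhom0.
  - case: Ht => [|Ht]; [by left|]; case: Hu => [|Hu]; [by left|right].
    by rewrite bhomD Ht Hu addr0.
by case: (E _ _ _ (hx i)) => // e; rewrite e eqxx in n0.
Qed.

(** An input has differential 0; an innermost bracket has its differential in the ideal; any other
    generator has degree at least 2, so its differential has nonzero degree and is killed. *)
Lemma cobar_qalg_gen x : f (delta x) = 0.
Proof.
rewrite -(desuspendK x); elim/total_ind: (desuspend K x) => [|y z Hy Hz|b w].
- by rewrite !bhom0.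
- by rewrite !bhomD Hy Hz addr0.
rewrite -bgenE; case: b w => [|b1 b2 bs] w.
  suff -> : delta (bgen inp w) = 0 by rewrite bhom0.
  by apply: tinc_inj; rewrite cobar_gen_bgen /= hzeroE !bhom0 subr0.
have [hi|hi] := boolP (all is_inp [:: b1, b2 & bs]).
  rewrite cobar_qalgE; apply/qalg_pi_eq0/(@hideal_hincl_tinc (rpart I b1 b2 bs w)).
  by rewrite tinc_map cobar_gen_innermost // embVK.
have [y ->] := bgen_homog w.
apply: (@cobar_qalg_homog ((nbrk (brk b1 b2 bs))%:Z - 1)).
  exact/cobar_homogE/(cobar_gen_homog (K := Binf I) (@Binf_Delta_homog _ _ I)).
by rewrite nbrk_brk intS addrC addKr; rewrite -nbrkF_eq0 in hi.
Qed.

Lemma cobar_qalg_diff x : f (dga_diff (cobar (Binf I)) x) = 0.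
Proof.
rewrite /=; elim/Tplus_ind: x => [|x y Hx Hy|x|x t IH].
- by rewrite !bhom0.
- by rewrite !bhomD Hx Hy addr0.
- rewrite [leibniz_ext _ _ _](_ : _ = delta x) ?cobar_qalg_gen //.
  by apply: tinc_inj; rewrite tinc_leibniz tinc_gen tder_gen.
have -> : leibniz_ext eps delta (Tplus_cons K1 (pure x t)) =
    Tplus_mul K1 (pure (delta x) t) +
    Tplus_mul K1 (pure (Tplus_gen K1 (eps x)) (leibniz_ext eps delta t)).
  apply: tinc_inj; rewrite tinc_leibniz tinc_cons tder_cons bhomD !tinc_mul tinc_leibniz tinc_gen.
  by rewrite tgen_mul.
by rewrite bhomD !cobar_qalgM cobar_qalg_gen IH pure0l pure0r !bhom0 addr0.
Qed.

Lemma thomog_inconsistent d e t : thomog (K := shift K) d t -> thomog e t -> d != e -> t = 0.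
Proof.
move=> hd he de; apply: dsum_ext => i.
have := tdegs_homog (hd i); rewrite (tdegs_homog (he i)) => /(congr1 (fun z : dsum _ => z e)).
by rewrite dinj_in dinj_out // eq_sym.
Qed.

Lemma tinc_surj (M : bimodType S) (t : talg M) : t 0%N = 0 -> exists u, t = tinc M u.
Proof.
move=> t0; have [s hs] := dsumP t.
have hf : finsupp (M := fun i => tpow M i.+1) (fun n => t n.+1).
  exists [seq i.-1 | i <- s] => n hn; apply: hs.
  by apply: contra hn => hn; apply/mapP; exists n.+1.
exists (DSum hf); apply: dsum_ext => -[|n]; first by rewrite tinc_comp0.
by rewrite tinc_comp.
Qed.

Lemma cobar_cycle x : dga_diff (cobar (Binf I)) x = 0 ->
  exists y v, tinc K1 x = D (tgen K1 (bracket (tinc K1 x))) + y /\ y = embV (tinc V v).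
Proof.
move=> dx; have {dx} dx : D (tinc K1 x) = 0 by rewrite -tinc_leibniz dx bhom0.
have [v [r e]] := homotopy (tinc K1 x).
rewrite dx !bhom0 subr0 in e.
(* Applying D to the equation kills every term but the image of r in V^n, and this image determines
   r. *)
have r0 : r = 0.
  apply: hincl_inj; apply: (can_inj (embVK I)); move/(congr1 D): e.
  rewrite bhomB dx bhomD tder_embV !tder_gen cobar_gen_inngen Binf_cobar_diff2 subr0 add0r.
  by move=> <-; rewrite !bhom0.
rewrite r0 !bhom0 addr0 in e.
(* The left side lies in the image of [Tplus], so v has no scalar component. *)
have [v' ev] : exists v', v = tinc V v'.
  apply: tinc_surj; apply: (@embV_comp0 _ _ I); rewrite -e dsumDE dsumNE tinc_comp0.
  by rewrite tder_gen tinc_comp0 subr0.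
by exists (embV v), v'; rewrite -ev -e addrC subrK.
Qed.

Lemma inngen_homog r : thomog 1 (tgen K1 (inngen r)).
Proof.
elim/dsum_ind: r => [|x y Hx Hy|n x]; first by rewrite !bhom0; apply: thomog0.
  by rewrite !bhomD; apply: thomogD.
rewrite /inngen dcopair_inj hcompE; move: (hcomp _ _ x) => w.
have [y ->] := bgen_homog w.
have -> : 1 = (nbrk (brk inp inp (nseq n inp)))%:Z; last exact: thomog_gen.
have /eqP := nbrkF_eq0 [:: inp, inp & nseq n inp].
by rewrite nbrk_brk /= all_nseq orbT => /eqP/eqP ->.
Qed.

Lemma cobar_qalg_quasi_iso : quasi_isomorphism f.
Proof.
move=> n; split=> [x [hx dx] [q [_ bq]]|y [hy _]]; last first.
  case: hy => [n0|y0]; last first.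
    exists 0; first by split; [move=> i; apply: homog_zero | rewrite bhom0].
    by exists 0; split; [right | rewrite y0 !bhom0 subr0].
  have [v ev] := qalg_ex y; exists (Tplus_map (deg0_incl I) v).
    split; first by apply/cobar_homogE; rewrite n0 tinc_map; apply: embV_homog.
    by apply: tinc_inj; rewrite tinc_leibniz tinc_map tder_embV bhom0.
  exists 0; split; first by right.
  by rewrite bhom0 (@cobar_qalg_embV _ v) ?tinc_map // ev subrr.
have [y [v [ex ey]]] := cobar_cycle dx.
have hh : thomog (n + 1) (tgen K1 (bracket (tinc K1 x))).
  by apply: thomog_bracket; apply/(cobar_homogE (K := Binf I)).
have [n0|n0] := eqVneq n 0.
  have fx : f x = 0 by rewrite -bq [dga_diff _ _]hzeroE.
  (* The morphism kills boundaries, so x and v have the same image in the quotient; that image is 0,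
     so v comes from some r in the ideal. *)
  have /qalg_pi_eq0/hideal_hincl [r er] : qalg_pi I v = 0.
    pose y' := Tplus_gen K1 (bracket (tinc K1 x)).
    rewrite -(@cobar_qalg_embV (x - dga_diff (cobar (Binf I)) y') v).
      by rewrite bhomB fx cobar_qalg_diff subr0.
    by rewrite bhomB tinc_leibniz tinc_gen {1}ex ey addrC addKr.
  (* As v is the image of r, it is the boundary of [inngen r]; adding h x gives a primitive of x. *)
  exists (Tplus_gen K1 (bracket (tinc K1 x)) + Tplus_gen K1 (inngen r)); split.
    apply/cobar_homogE; rewrite bhomD !tinc_gen; apply: thomogD => //.
    by rewrite n0; apply: inngen_homog.
  apply: tinc_inj; rewrite tinc_leibniz !bhomD !tinc_gen [in RHS]ex ey er.
  by rewrite [D (tgen _ (inngen r))]tder_gen cobar_gen_inngen.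
(* The remainder y = x - d h x has degree n, but a word of inputs has degree 0. *)
have y0 : y = 0.
  apply: (@thomog_inconsistent n 0) => //; last by rewrite ey; apply: embV_homog.
  have -> : y = tinc K1 x - D (tgen K1 (bracket (tinc K1 x))) by rewrite {1}ex addrC addKr.
  apply: thomogD; first exact/(cobar_homogE (K := Binf I)).
  apply: thomogN; rewrite -[n in thomog n](addrK 1).
  have delta_homog := cobar_gen_homog (K := Binf I) (@Binf_Delta_homog _ _ I).
  exact: (@thomog_tder _ (shift K) delta delta_homog (n + 1)).
exists (Tplus_gen K1 (bracket (tinc K1 x))); split.
  by apply/cobar_homogE; rewrite tinc_gen.
by apply: tinc_inj; rewrite tinc_leibniz tinc_gen [in RHS]ex y0 addr0.
Qed.
End QuasiIso.

Theorem theorem2p2 (S : pzRingType) (V : bimodType S) (I : homogIdeal V) :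
  [/\ is_ainf_coalgebra (Binf I),
      is_dga (cobar (Binf I)),
      is_dga (qalg_dga I)
    & exists f : bimodHom (cobar (Binf I)) (qalg_dga I),
        [/\ is_dga_morphism f,
            forall t : Tplus V, f (Tplus_map (deg0_incl I) t) = qalg_pi I t,
            forall (n : int) (x : cobar (Binf I)),
              (0 < n)%R -> dga_homog n x -> f x = 0
          & quasi_isomorphism f]].
Proof.
split.
- exact: (cobar_ainf (K := Binf I) (@Binf_Delta_homog _ _ I) (@Binf_cobar_diff2 _ _ I)).
- exact: (cobar_dga (K := Binf I) (@Binf_Delta_homog _ _ I) (@Binf_cobar_diff2 _ _ I)).
- exact: qalg_is_dga.
exists (cobar_qalg I); split.
- split=> [x y|n x hx|x].
  + exact: cobar_qalgM.
  + have [->|n0] := eqVneq n 0; [by left | right].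
    exact: cobar_qalg_homog hx n0.
  + by rewrite cobar_qalg_diff [RHS]hzeroE.
- by move=> t; apply: cobar_qalg_embV; rewrite tinc_map.
- move=> n x n0 hx; apply: cobar_qalg_homog hx _.
  by apply: contraTneq n0 => ->.
- exact: cobar_qalg_quasi_iso.
Qed.
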